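(* Let $p\in(2,\infty)$ and let $\mathbb{D}$ be the open unit disk. There exist a Jordan domain $\mathbb{Y}\subset\mathbb{C}$ with rectifiable boundary and a homeomorphism $\varphi\colon\partial\mathbb{D}\to\partial\mathbb{Y}$ (onto) such that \[ \int_{\partial\mathbb{D}}\int_{\partial\mathbb{D}}\frac{|\varphi(x)-\varphi(y)|^p}{|x-y|^p}\,dx\,dy<\infty, \] but there is no homeomorphism $h\colon\overline{\mathbb{D}}\to\overline{\mathbb{Y}}$ with $h=\varphi$ on $\partial\mathbb{D}$ and $h\in\mathscr{W}^{1,p}(\mathbb{D},\mathbb{R}^2)$.
   Context: Integrals over $\partial\mathbb{D}$ are with respect to arc length measure. *)

(* Defs.v *)
From HB Require Import structures.
From mathcomp Require Import all_boot all_order all_algebra.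
From mathcomp Require Import all_classical all_reals all_analysis.
Set Implicit Arguments. Unset Strict Implicit. Unset Printing Implicit Defensive.
Import Order.TTheory GRing.Theory Num.Theory.
Import numFieldNormedType.Exports.
Local Open Scope classical_set_scope.
Local Open Scope ring_scope.

Section Defs.
Variable R : realType.
Notation P := (R * R)%type.

Definition pdist (a b : P) : R :=
  Num.sqrt ((a.1 - b.1) ^+ 2 + (a.2 - b.2) ^+ 2).

Definition disk : set P := [set z | z.1 ^+ 2 + z.2 ^+ 2 < 1].
Definition circle : set P := [set z | z.1 ^+ 2 + z.2 ^+ 2 = 1].

Definition cexp (t : R) : P := (cos t, sin t).

Definition homeo_onto (A B : set P) (f : P -> P) : Prop :=
  exists g : P -> P,
    [/\ (forall x, A x -> B (f x)), (forall y, B y -> A (g y)),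
        (forall x, A x -> g (f x) = x), (forall y, B y -> f (g y) = y) &
        {within A, continuous f} /\ {within B, continuous g}].

Definition jordan_param (g : R -> P) : Prop :=
  [/\ {within `[0, 1], continuous g}, g 0 = g 1 &
      {in `[0, 1[ &, injective g}].

Definition rectifiable_param (g : R -> P) : Prop :=
  exists M : R, forall s : seq R,
    sorted <=%R s -> all (fun t => (0 <= t <= 1)) s ->
    \sum_(i < (size s).-1) pdist (g (nth 0 s i)) (g (nth 0 s i.+1)) <= M.

Definition bounded_plane (Y : set P) : Prop :=
  exists M : R, forall z, Y z -> z.1 ^+ 2 + z.2 ^+ 2 <= M.

Definition jordan_domain (Y : set P) : Prop :=
  [/\ open Y, connected Y, bounded_plane Y &
      exists g, jordan_param g /\ g @` `[0, 1] = closure Y `\` Y].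

Definition rectifiable_boundary (Y : set P) : Prop :=
  exists g, [/\ jordan_param g, g @` `[0, 1] = closure Y `\` Y &
                rectifiable_param g].

Definition leb2 := (@lebesgue_measure R \x @lebesgue_measure R)%E.

Definition iter_deriv (vs : seq P) (f : P -> R) : P -> R :=
  foldr (fun v g => 'D_v g) f vs.

Definition smooth (f : P -> R) : Prop :=
  forall (vs : seq P) (x : P), differentiable (iter_deriv vs f) x.

Definition test_fun (U : set P) (psi : P -> R) : Prop :=
  smooth psi /\
  exists K : set P, [/\ compact K, K `<=` U & forall x, ~ K x -> psi x = 0].

Definition Lp (U : set P) (p : R) (f : P -> R) : Prop :=
  measurable_fun U f /\
  (\int[leb2]_(x in U) ((`|f x| `^ p)%:E) < +oo)%E.

Definition e1 : P := (1, 0).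
Definition e2 : P := (0, 1).

Definition sobolev1p (U : set P) (p : R) (f : P -> R) : Prop :=
  Lp U p f /\
  forall v : P, v = e1 \/ v = e2 ->
    exists gv : P -> R, Lp U p gv /\
      forall psi, test_fun U psi ->
        (\int[leb2]_(x in U) (f x * 'D_v psi x)%:E =
         - \int[leb2]_(x in U) (gv x * psi x)%:E)%E.

Definition sobolev1p_R2 (U : set P) (p : R) (h : P -> P) : Prop :=
  sobolev1p U p (fun x => (h x).1) /\ sobolev1p U p (fun x => (h x).2).

End Defs.

(* Main.v *)
Require Import Defs.
From HB Require Import structures.
From mathcomp Require Import all_boot all_order all_algebra.
From mathcomp Require Import all_classical all_reals all_analysis.
Import Order.TTheory GRing.Theory Num.Theory.
Import numFieldNormedType.Exports.
From mathcomp Require Import measurable_realfun.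
From mathcomp Require Import ring lra.
Set Implicit Arguments.
Unset Strict Implicit.
Unset Printing Implicit Defensive.
Local Open Scope classical_set_scope.
Local Open Scope ring_scope.

(* The domain is the image of the disk under the homeomorphism [spiral m], which turns the circle of
   radius d around a boundary point [tip] by the angle d^-m.  For m < 1 the boundary stays rectifiable,
   and the boundary map has finite energy as soon as m (p - 1) < 2.

   An extension [h] in W^{1,p} is absolutely continuous on almost every line parallel to an axis,
   the derivatives being the slices of the weak ones.  At scale r near [tip], join two boundary points
   at distances at least 8r and at most 4r from [tip] by a vertical and a horizontal segment inside the
   disk.  The argument of the image, clamped at the value it takes at distance 4r from the origin, is
   1/r-Lipschitz and varies by about r^-m along the path, so one of the two segments carries gradient at
   least of order r^(1-m).  Integrating over the positions of the segments (an interval of length r),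
   the p-energy of [h] near [tip] is at least of order r^(2-mp), which is unbounded when m p > 2. *)

(** * Plane geometry and the spiral map *)

Section Plane.
Variable R : realType.
Notation P := (R * R)%type.

(** For boundary points at distance r from the tip and at distance d from each other, the quotient
    is at most of order min(r^-m, r/d): the displacement saturates at r because the twist keeps
    distances to the tip. Integrating the p-th power over d gives r^(1+m-mp), integrable in r
    exactly when m (p - 1) < 2. In the disk the gradient r^-m of the spiral is not tempered by any
    saturation, and finite energy would require m p < 2. The example lives in the window 2/p < m <
    2/(p - 1) between the two conditions.

    The obstacle is that the extension is an arbitrary homeomorphism, known only on the circle.
    Topology supplies the rigidity: only the tip is sent to 0, and the spiralling domain carries a
    single-valued argument, so its variation between two boundary points is forced on every path
    joining them. Such a path may run through points whose images are extremely close to 0, where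
    the argument has a huge gradient; there the argument is itself huge, so clamping it from above
    discards exactly these pieces. *)

Definition enorm (w : P) : R := Num.sqrt (w.1 ^+ 2 + w.2 ^+ 2).

Definition rotp (t : R) (w : P) : P :=
  (cos t * w.1 - sin t * w.2, sin t * w.1 + cos t * w.2).

Lemma pair_ext (x y : P) : x.1 = y.1 -> x.2 = y.2 -> x = y.
Proof. by case: x => a b; case: y => c d /= -> ->. Qed.

Lemma rotp0 w : rotp 0 w = w.
Proof. by apply: pair_ext; rewrite /rotp cos0 sin0 /=; ring. Qed.

Lemma rotpD s t w : rotp s (rotp t w) = rotp (s + t) w.
Proof. by apply: pair_ext; rewrite /rotp /= cosD sinD; ring. Qed.

Lemma rotpB t v w : rotp t (v - w) = rotp t v - rotp t w.
Proof. by apply: pair_ext; rewrite /rotp /=; ring. Qed.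

Lemma sqr_enorm w : enorm w ^+ 2 = w.1 ^+ 2 + w.2 ^+ 2.
Proof. by rewrite sqr_sqrtr// addr_ge0// sqr_ge0. Qed.

Lemma enorm_ge0 w : 0 <= enorm w.
Proof. exact: sqrtr_ge0. Qed.

Lemma enorm_sqr_eq v w : v.1 ^+ 2 + v.2 ^+ 2 = w.1 ^+ 2 + w.2 ^+ 2 -> enorm v = enorm w.
Proof. by rewrite /enorm => ->. Qed.

Lemma enorm_le v (r : R) : 0 <= r -> v.1 ^+ 2 + v.2 ^+ 2 <= r ^+ 2 -> enorm v <= r.
Proof. by move=> r0 h; rewrite -(@ler_sqr _ (enorm v)) ?nnegrE ?enorm_ge0// sqr_enorm. Qed.

Lemma le_enorm v (r : R) : 0 <= r -> r ^+ 2 <= v.1 ^+ 2 + v.2 ^+ 2 -> r <= enorm v.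
Proof. by move=> r0 h; rewrite -(@ler_sqr _ r) ?nnegrE ?enorm_ge0// sqr_enorm. Qed.

Lemma enorm_rot t w : enorm (rotp t w) = enorm w.
Proof.
apply: enorm_sqr_eq; rewrite /rotp /=.
by have := cos2Dsin2 t; set c := cos t; set s := sin t => h; nra.
Qed.

Lemma enorm0 : enorm 0 = 0.
Proof. by rewrite /enorm /= expr0n /= addr0 sqrtr0. Qed.

Lemma enorm_eq0 w : enorm w = 0 -> w = 0.
Proof.
move=> h; have := sqr_enorm w; rewrite h expr0n /= => /esym/eqP.
by rewrite paddr_eq0 ?sqr_ge0// !sqrf_eq0 => /andP[/eqP ? /eqP ?]; apply: pair_ext.
Qed.

Lemma enorm_gt0 w : w != 0 -> 0 < enorm w.
Proof.
by move=> w0; rewrite lt_def enorm_ge0 andbT; apply: contra_neq w0; exact: enorm_eq0.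
Qed.

Lemma enormN w : enorm (- w) = enorm w.
Proof. by apply: enorm_sqr_eq => /=; ring. Qed.

Lemma enorm_distC v w : enorm (v - w) = enorm (w - v).
Proof. by rewrite -enormN opprB. Qed.

Lemma ler_enormD v w : enorm (v + w) <= enorm v + enorm w.
Proof.
apply: enorm_le; first by rewrite addr_ge0 ?enorm_ge0.
have := sqr_enorm v; have := sqr_enorm w; have := enorm_ge0 v; have := enorm_ge0 w.
move=> /=.
set a := enorm v; set b := enorm w => b0 a0 hb ha.
have h : v.1 * w.1 + v.2 * w.2 <= a * b.
  have [h|h] := leP (v.1 * w.1 + v.2 * w.2) 0; first by rewrite (le_trans h)// mulr_ge0.
  rewrite -(@ler_sqr _ (v.1 * w.1 + v.2 * w.2)) ?nnegrE ?mulr_ge0 ?(ltW h)// exprMn ha hb.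
  have := sqr_ge0 (v.1 * w.2 - v.2 * w.1); nra.
nra.
Qed.

Lemma ler_enormB v w : enorm (v - w) <= enorm v + enorm w.
Proof. by rewrite (le_trans (ler_enormD _ _))// enormN. Qed.

Lemma ler_enorm_triangle u v w : enorm (v - w) <= enorm (v - u) + enorm (u - w).
Proof. by rewrite (le_trans _ (ler_enormD _ _))// addrA subrK. Qed.

Lemma ler_enorm_dist v w : `|enorm v - enorm w| <= enorm (v - w).
Proof.
rewrite ler_norml; apply/andP; split.
  have := ler_enormB v (v - w); rewrite opprB addrC subrK; lra.
have := ler_enormD (v - w) w; rewrite subrK; lra.
Qed.

(** The norm of a pair is the maximum norm, and it is the one behind the topology of the plane; this
    comparison and the next one carry Euclidean estimates over to limits. *)
Lemma norm_le_enorm (w : P) : `|w| <= enorm w.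
Proof.
rewrite /Num.norm /= ge_max; apply/andP; split; apply: le_enorm => //;
  rewrite real_normK ?num_real// ?lerDl ?lerDr sqr_ge0//.
Qed.

Lemma enorm_le_norm (w : P) : enorm w <= 2 * `|w|.
Proof.
apply: enorm_le; first by rewrite mulr_ge0.
have h1 : `|w.1| <= `|w| by rewrite [X in _ <= X]/Num.norm /= le_max lexx.
have h2 : `|w.2| <= `|w| by rewrite [X in _ <= X]/Num.norm /= le_max lexx orbT.
rewrite -(real_normK (num_real w.1)) -(real_normK (num_real w.2)).
have := normr_ge0 w.1; have := normr_ge0 w.2; nra.
Qed.

Lemma abs_le_enorm1 (w : P) : `|w.1| <= enorm w.
Proof. by apply: le_trans (norm_le_enorm w); rewrite [X in _ <= X]/Num.norm /= le_max lexx. Qed.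

Lemma abs_le_enorm2 (w : P) : `|w.2| <= enorm w.
Proof. by apply: le_trans (norm_le_enorm w); rewrite [X in _ <= X]/Num.norm /= le_max lexx orbT. Qed.

Lemma enorm_le_abs (w : P) : enorm w <= `|w.1| + `|w.2|.
Proof.
apply: enorm_le; first by rewrite addr_ge0.
rewrite -(real_normK (num_real w.1)) -(real_normK (num_real w.2)).
have := normr_ge0 w.1; have := normr_ge0 w.2; nra.
Qed.

Lemma pdistE (a b : P) : pdist a b = enorm (a - b).
Proof. by []. Qed.

Lemma continuous_enorm : continuous enorm.
Proof.
move=> w; apply/cvgrPdist_lt => e e0; near=> v.
rewrite (le_lt_trans (ler_enorm_dist _ _))// (le_lt_trans (enorm_le_norm _))//.
have : `|w - v| < e / 2 by near: v; apply: cvgr_dist_lt => //; rewrite divr_gt0.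
lra.
Unshelve. all: by end_near. Qed.

Lemma ler_sin_abs (x : R) : `|sin x| <= `|x|.
Proof.
wlog x0 : x / 0 <= x.
  move=> h; have [/h//|x0] := leP 0 x.
  by rewrite -normrN -sinN -(normrN x); apply: h; rewrite oppr_ge0 ltW.
have [|c] := @MVT_segment R sin cos 0 x x0.
  by apply: continuous_subspaceT; exact: continuous_sin.
move=> _; rewrite sin0 !subr0 => ->; rewrite normrM ler_piMl//.
exact: cos_max.
Qed.

Lemma cos_half (u : R) : 1 - cos u = 2 * sin (u / 2) ^+ 2.
Proof.
rewrite {1}(_ : u = (u / 2) *+ 2); last by rewrite mulr2n; field.
by rewrite cos_mulr2n; have := cos2Dsin2 (u / 2); set c := cos _; set s := sin _; rewrite mulr2n; nra.
Qed.

(** Chord length: the squared left side expands to 2 (1 - cos (s - t)) |w|^2, and [cos_half] turns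
    this into a square. *)
Lemma enorm_rotB s t w : enorm (rotp s w - rotp t w) = 2 * `|sin ((s - t) / 2)| * enorm w.
Proof.
have -> : 2 * `|sin ((s - t) / 2)| * enorm w = Num.sqrt ((2 * `|sin ((s - t) / 2)| * enorm w) ^+ 2).
  by rewrite sqrtr_sqr [RHS]ger0_norm// mulr_ge0 ?enorm_ge0// mulr_ge0.
rewrite {1}/enorm; congr (Num.sqrt _).
rewrite !exprMn sqr_enorm real_normK ?num_real//.
have -> : 2 ^+ 2 * sin ((s - t) / 2) ^+ 2 = 2 * (2 * sin ((s - t) / 2) ^+ 2) :> R by ring.
rewrite -cos_half cosB /rotp /=.
have := cos2Dsin2 s; have := cos2Dsin2 t.
set a := cos s; set b := sin s; set c := cos t; set d := sin t => h1 h2.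
transitivity ((a ^+ 2 + b ^+ 2 + (c ^+ 2 + d ^+ 2) - 2 * (a * c + b * d)) * (w.1 ^+ 2 + w.2 ^+ 2)); first by ring.
by rewrite h1 h2; ring.
Qed.

Lemma enorm_rotB_le s t w : enorm (rotp s w - rotp t w) <= `|s - t| * enorm w.
Proof.
rewrite enorm_rotB ler_wpM2r ?enorm_ge0//.
have := ler_sin_abs ((s - t) / 2); rewrite normrM (ger0_norm (_ : 0 <= 2^-1)) ?invr_ge0//; lra.
Qed.

Lemma cvg_pairP (T : topologicalType) (F : set_system T) (f g : T -> R) (a b : R) : Filter F ->
  f x @[x --> F] --> a -> g x @[x --> F] --> b -> (f x, g x) @[x --> F] --> (a, b).
Proof. by move=> FF hf hg; exact: (@cvg_pair _ _ _ F (nbhs a) (nbhs b)). Qed.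

Lemma continuous_rot (T : topologicalType) (t : T -> R) (f : T -> P) (x : T) :
  {for x, continuous t} -> {for x, continuous f} ->
  {for x, continuous (fun x => rotp (t x) (f x))}.
Proof.
move=> ct cf.
have c1 : {for x, continuous (fun x => (f x).1)} by apply: (continuous_comp cf); exact: cvg_fst.
have c2 : {for x, continuous (fun x => (f x).2)} by apply: (continuous_comp cf); exact: cvg_snd.
have cc : {for x, continuous (fun x => cos (t x))} by apply: (continuous_comp ct); exact: continuous_cos.
have cs : {for x, continuous (fun x => sin (t x))} by apply: (continuous_comp ct); exact: continuous_sin.
apply: cvg_pairP.
  by apply: cvgB; apply: cvgM.
by apply: cvgD; apply: cvgM.
Qed.

Lemma continuous_powR (a x : R) : 0 < x -> {for x, continuous (fun x => x `^ a)}.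
Proof.
move=> x0; apply: differentiable_continuous; apply/derivable1_diffP; apply: derivable_powR.
by rewrite in_itv /= x0.
Qed.

Lemma cvg0_enorm (T : topologicalType) (F : set_system T) (f : T -> P) : Filter F ->
  enorm (f x) @[x --> F] --> (0 : R) -> f x @[x --> F] --> (0 : P).
Proof.
move=> FF h; apply/cvgrPdist_lt => e e0.
near=> x; have : `|0 - enorm (f x)| < e by near: x; by move/cvgrPdist_lt : h; exact.
rewrite !sub0r !normrN => h1; apply: le_lt_trans (norm_le_enorm _) _.
by apply: le_lt_trans h1; rewrite ler_norm.
Unshelve. all: by end_near. Qed.

(** The factor [s] is 1 or -1: since the distance to the origin is kept, the opposite angle undoes
    the twist. At the origin any value of the power gives 0, because rotations fix it. *)
Definition twist (s m : R) (w : P) : P := rotp (s * enorm w `^ (- m)) w.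

Lemma enorm_twist s m w : enorm (twist s m w) = enorm w.
Proof. exact: enorm_rot. Qed.

Lemma twistK m w : twist (-1) m (twist 1 m w) = w.
Proof. by rewrite /twist enorm_rot rotpD mulN1r mul1r addNr rotp0. Qed.

Lemma twistVK m w : twist 1 m (twist (-1) m w) = w.
Proof. by rewrite /twist enorm_rot rotpD mulN1r mul1r subrr rotp0. Qed.

Lemma continuous_twist s m : continuous (twist s m).
Proof.
move=> w; have [->|w0] := eqVneq w 0.
  (* The angle blows up at the origin, but continuity there needs only that the twist preserves the
     Euclidean norm. *)
  rewrite /continuous_at; have -> : twist s m 0 = 0 by apply: enorm_eq0; rewrite enorm_twist enorm0.
  apply: cvg0_enorm; under eq_fun do rewrite enorm_twist.
  by have := @continuous_enorm (0 : P); rewrite /continuous_at enorm0.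
apply: (@continuous_rot _ (fun w : P => s * enorm w `^ (- m)) (fun w : P => w)); last exact: cvg_id.
apply: cvgM; first exact: cvg_cst.
apply: (@continuous_comp _ _ _ enorm (fun x => x `^ (- m))); first exact: continuous_enorm.
by apply: continuous_powR; exact: enorm_gt0.
Qed.

Lemma image_closure_sub (T U : topologicalType) (f : T -> U) (A : set T) :
  continuous f -> f @` closure A `<=` closure (f @` A).
Proof.
move=> cf _ [x xA <-] B Bfx.
by have [z [Az Bz]] := xA _ (cf x _ Bfx); exists (f z); split => //; exists z.
Qed.

Lemma closure_homeo (T U : topologicalType) (f : T -> U) (g : U -> T) (A : set T) :
  continuous f -> continuous g -> cancel f g -> cancel g f ->
  closure (f @` A) = f @` closure A.
Proof.
move=> cf cg fK gK; apply/seteqP; split; last exact: image_closure_sub.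
move=> y yA; exists (g y) => //.
have : (g @` closure (f @` A)) (g y) by exists y.
move/(image_closure_sub cg); rewrite image_comp.
by rewrite (_ : g \o f = id) ?image_id//; apply/funext => z /=; rewrite fK.
Qed.

(** * The unit disk and its spiral image *)

Lemma diskE (z : P) : disk z <-> enorm z < 1.
Proof.
rewrite /disk /= -sqr_enorm; have := enorm_ge0 z; split; nra.
Qed.

Lemma circleE (z : P) : circle z <-> enorm z = 1.
Proof.
rewrite /circle /= -sqr_enorm; have := enorm_ge0 z; split; last by move=> ->; rewrite expr1n.
by move=> h; nra.
Qed.

Lemma open_disk : open (@disk R).
Proof.
rewrite (_ : @disk R = enorm @^-1` [set r | r < 1]); last by apply/seteqP; split => z /diskE.
by apply: open_comp; [move=> z _; exact: continuous_enorm | exact: open_lt].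
Qed.

Lemma continuous_scale (z : P) : continuous (fun t : R => (t * z.1, t * z.2) : P).
Proof.
by move=> t; apply: cvg_pairP; apply: cvgM; by [exact: cvg_id | exact: cvg_cst].
Qed.

Lemma enorm_scale (t : R) (z : P) : 0 <= t -> enorm (t * z.1, t * z.2) = t * enorm z.
Proof.
move=> t0; rewrite -[RHS]ger0_norm ?mulr_ge0 ?enorm_ge0// -sqrtr_sqr exprMn sqr_enorm /enorm /=.
by congr (Num.sqrt _); ring.
Qed.

Lemma closure_diskE : closure (@disk R) = [set z | enorm z <= 1].
Proof.
apply/seteqP; split => z /=.
  move=> zD; rewrite leNgt; apply/negP => z1.
  have /zD[w [/diskE w1]] : nbhs z [set w | 1 < enorm w].
    by near=> w => /=; near: w; move/cvgr_gt : (@continuous_enorm z); exact.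
  by rewrite /= ltNge (ltW w1).
move=> z1 B Bz.
(* A point of the closed disk is approached by its multiples [t z] with [t] tending to 1 from
   below. *)
have h : (fun t : R => (t * z.1, t * z.2) : P) t @[t --> 1^'-] --> z.
  rewrite [in X in _ --> X](_ : z = (1 * z.1, 1 * z.2)); last by apply: pair_ext; rewrite /= mul1r.
  by apply: cvg_at_left_filter; exact: continuous_scale.
have /= hB := h _ Bz.
near (1 : R)^'- => t.
exists (t * z.1, t * z.2); split; last by near: t; exact: hB.
apply/diskE; rewrite enorm_scale; last by near: t; exact: nbhs_left_ge.
have t1 : t < 1 by near: t; exact: nbhs_left_lt.
have t0 : 0 < t by near: t; exact: nbhs_left_gt.
have := enorm_ge0 z; nra.
Unshelve. all: by end_near. Qed.

Lemma closure_disk_circle : closure (@disk R) `\` @disk R = @circle R.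
Proof.
rewrite closure_diskE; apply/seteqP; split => z /=.
  by move=> [z1 /diskE z2]; apply/circleE; move: z1 z2; case: ltgtP.
by move/circleE => z1; split; rewrite ?z1//; move/diskE; rewrite z1 ltxx.
Qed.

Lemma connected_disk : connected (@disk R).
Proof.
rewrite (_ : @disk R = \bigcup_(z in @disk R)
   ((fun t : R => (t * z.1, t * z.2) : P) @` `[0, 1])); last first.
  apply/seteqP; split => z /=.
    by move=> zd; exists z => //; exists 1; [rewrite /= in_itv /= lexx ler01 | apply: pair_ext; rewrite /= mul1r].
  move=> [w /diskE wd [t]]; rewrite /= in_itv /= => /andP[t0 t1] <-; apply/diskE.
  by rewrite enorm_scale//; have := enorm_ge0 w; nra.
apply: bigcup_connected.
  exists 0 => w wd; exists 0; first by rewrite /= in_itv/= lexx ler01.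
  by apply: pair_ext; rewrite /= mul0r.
move=> w wd; apply: connected_continuous_connected; first exact: segment_connected.
by apply: continuous_subspaceT; exact: continuous_scale.
Qed.

(* A rational point of the circle at which both axis directions are transversal to it. *)
Definition tip : P := (- (3 / 5), - (4 / 5)).

Definition spiral (m : R) (x : P) : P := twist 1 m (x - tip).
Definition unspiral (m : R) (y : P) : P := twist (-1) m y + tip.

Lemma spiralK m : cancel (spiral m) (unspiral m).
Proof. by move=> x; rewrite /unspiral /spiral twistK subrK. Qed.

Lemma unspiralK m : cancel (unspiral m) (spiral m).
Proof. by move=> x; rewrite /unspiral /spiral addrK twistVK. Qed.

Lemma enorm_spiral m x : enorm (spiral m x) = enorm (x - tip).
Proof. exact: enorm_twist. Qed.

Lemma continuous_spiral m : continuous (spiral m).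
Proof.
move=> x; have c : {for x, continuous (twist 1 m \o (fun x : P => x - tip))}.
  apply: continuous_comp; last exact: continuous_twist.
  by apply: cvgB; [exact: cvg_id | exact: cvg_cst].
exact: c.
Qed.

Lemma continuous_unspiral m : continuous (unspiral m).
Proof. by move=> x; apply: cvgD; [exact: continuous_twist | exact: cvg_cst]. Qed.

Lemma closure_spiral m (A : set P) : closure (spiral m @` A) = spiral m @` closure A.
Proof.
by apply: (@closure_homeo _ _ _ (unspiral m)); [exact: continuous_spiral|exact: continuous_unspiral|exact: spiralK|exact: unspiralK].
Qed.

Lemma spiral_boundary m : closure (spiral m @` @disk R) `\` (spiral m @` @disk R) = spiral m @` @circle R.
Proof.
rewrite closure_spiral -closure_disk_circle; apply/seteqP; split => y /=.
  by move=> [[x xd <-]] h; exists x => //; split => // dx; apply: h; exists x.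
move=> [x [xc xd] <-]; split; first by exists x.
by move=> [z zd] /(can_inj (@spiralK m)) zx; apply: xd; rewrite -zx.
Qed.

Lemma spiral_disk_preimage m : spiral m @` @disk R = unspiral m @^-1` @disk R.
Proof.
apply/seteqP; split => y /=; first by move=> [x xd <-]; rewrite spiralK.
by move=> h; exists (unspiral m y) => //; rewrite unspiralK.
Qed.

Lemma open_spiral_disk m : open (spiral m @` @disk R).
Proof.
rewrite spiral_disk_preimage; apply: open_comp; last exact: open_disk.
by move=> x _; exact: continuous_unspiral.
Qed.

Lemma connected_spiral_disk m : connected (spiral m @` @disk R).
Proof.
apply: connected_continuous_connected; first exact: connected_disk.
by apply: continuous_subspaceT; exact: continuous_spiral.
Qed.

Lemma sqr_tip : tip.1 ^+ 2 + tip.2 ^+ 2 = 1.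
Proof. by rewrite /tip /=; field. Qed.

Lemma enorm_tip : enorm tip = 1.
Proof. by apply/circleE; exact: sqr_tip. Qed.

Lemma bounded_spiral_disk m : bounded_plane (spiral m @` @disk R).
Proof.
exists 4 => _ [x /diskE xd <-]; rewrite -sqr_enorm enorm_spiral.
have := ler_enormB x tip; rewrite enorm_tip; have := enorm_ge0 (x - tip); nra.
Qed.

Lemma homeo_onto_spiral m (A : set P) : homeo_onto A (spiral m @` A) (spiral m).
Proof.
exists (unspiral m); split.
- by move=> x Ax; exists x.
- by move=> _ [x Ax <-]; rewrite spiralK.
- by move=> x _; rewrite spiralK.
- by move=> x _; rewrite unspiralK.
- by split; apply: continuous_subspaceT; [exact: continuous_spiral | exact: continuous_unspiral].
Qed.

End Plane.

(** * The boundary curve *)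

Section Curve.
Variable R : realType.
Notation P := (R * R)%type.

Definition tip_angle : R := acos (3 / 5) + pi.

Lemma cexp_rot (t : R) : cexp t = rotp t (1, 0).
Proof. by apply: pair_ext; rewrite /= ?mulr1 ?mulr0 ?subr0 ?addr0. Qed.

Lemma cexp_tip : cexp tip_angle = tip R.
Proof.
have h : -1 <= (3 / 5 : R) <= 1 by apply/andP; split; lra.
apply: pair_ext; rewrite /cexp /tip_angle /=.
  by rewrite cosDpi acosK.
rewrite sinDpi sin_acos//; congr (- _).
by rewrite (_ : 1 - _ = (4 / 5) ^+ 2); [rewrite sqrtr_sqr ger0_norm//; lra | field].
Qed.

Lemma tip_angle_itv : 0 <= tip_angle <= 2 * pi.
Proof.
have h : -1 <= (3 / 5 : R) <= 1 by apply/andP; split; lra.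
have := acos_ge0 h; have := acos_lepi h; have := @pi_ge0 R; rewrite /tip_angle => *; apply/andP; split; lra.
Qed.

Lemma enorm_cexp (t : R) : enorm (cexp t) = 1.
Proof. by apply/circleE; exact: cos2Dsin2. Qed.

Lemma enorm_e1 : enorm ((1, 0) : P) = 1.
Proof. by apply/circleE; rewrite /circle /= expr1n expr0n addr0. Qed.

Lemma enorm_cexpB (s t : R) : enorm (cexp s - cexp t) = 2 * `|sin ((s - t) / 2)|.
Proof. by rewrite !cexp_rot enorm_rotB enorm_e1 mulr1. Qed.

Lemma enorm_cexpB_le (s t : R) : enorm (cexp s - cexp t) <= `|s - t|.
Proof. by rewrite !cexp_rot (le_trans (enorm_rotB_le _ _ _))// enorm_e1 mulr1. Qed.

Lemma continuous_cexp : continuous (@cexp R).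
Proof. by move=> t; apply: cvg_pairP; [exact: continuous_cos | exact: continuous_sin]. Qed.

Lemma cexp_inj (s t : R) : `|s - t| < 2 * pi -> cexp s = cexp t -> s = t.
Proof.
move=> st e; have := enorm_cexpB s t; rewrite e subrr enorm0 => /esym/eqP.
rewrite mulf_eq0 pnatr_eq0 /= normr_eq0 => /eqP h.
apply/eqP; rewrite -subr_eq0; move: st h; set u := s - t.
have [u0|u0|//] := ltgtP u 0; move=> hu h.
  have : 0 < sin (- (u / 2)).
    by apply: sin_gt0_pi; move: hu; rewrite ltr0_norm// => hu; apply/andP; split; lra.
  by rewrite sinN h oppr0 ltxx.
have : 0 < sin (u / 2).
  by apply: sin_gt0_pi; move: hu; rewrite gtr0_norm// => hu; apply/andP; split; lra.
by rewrite h ltxx.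
Qed.

Lemma cexp_surj (x : P) : circle x -> exists2 t : R, 0 <= t <= 2 * pi & cexp t = x.
Proof.
rewrite /circle /= => hx.
have h : -1 <= x.1 <= 1 by have h2 := sqr_ge0 x.2; apply/andP; split; nra.
have s : sin (acos x.1) = `|x.2|.
  by rewrite sin_acos// (_ : 1 - _ = x.2 ^+ 2) ?sqrtr_sqr// -hx addrAC subrr add0r.
have a0 := acos_ge0 h; have a1 := acos_lepi h; have p0 := @pi_ge0 R.
have [x2|x2] := leP 0 x.2.
  exists (acos x.1); first by apply/andP; split; lra.
  by apply: pair_ext; rewrite /= ?acosK// s ger0_norm.
exists (2 * pi - acos x.1); first by apply/andP; split; lra.
rewrite (_ : 2 * pi = pi *+ 2); last by rewrite mulr2n; lra.
apply: pair_ext; rewrite /= addrC.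
  by rewrite cosD2pi cosN acosK.
by rewrite sinD2pi sinN s ltr0_norm ?opprK.
Qed.

(** Starts and ends at [tip], so that the singularity of the spiral sits at both ends of the
    parameter interval and the distance to [tip] is the unimodal function 2 sin (pi t). *)
Definition circle_param (t : R) : P := cexp (tip_angle + 2 * pi * t).

Lemma circle_param_surj : circle_param @` `[0, 1] = @circle R.
Proof.
apply/seteqP; split => x /=; first by move=> [t _ <-]; apply/circleE; exact: enorm_cexp.
move=> xc.
have : circle (rotp (- tip_angle) x) by apply/circleE; rewrite enorm_rot; apply/circleE.
move/cexp_surj => [t /andP[t0 t1] e].
have p0 := @pi_gt0 R.
exists (t / (2 * pi)).
  by rewrite /= in_itv /= divr_ge0//= ?ler_pdivrMr ?mul1r// ?mulr_gt0// mulr_ge0// ltW.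
rewrite /circle_param mulrC divfK; last by rewrite gt_eqF// mulr_gt0.
by rewrite cexp_rot -rotpD -cexp_rot e rotpD subrr rotp0.
Qed.

Lemma circle_param_dist_le (s t : R) : enorm (circle_param s - circle_param t) <= 2 * pi * `|s - t|.
Proof.
apply: (le_trans (enorm_cexpB_le _ _)).
rewrite (_ : _ - _ = 2 * pi * (s - t)); last by ring.
by rewrite normrM [`|2 * pi|]ger0_norm// mulr_ge0// pi_ge0.
Qed.

Lemma circle_param_dist_tip (t : R) : 0 <= t <= 1 ->
  enorm (circle_param t - tip R) = 2 * sin (pi * t).
Proof.
move=> /andP[t0 t1]; rewrite -cexp_tip enorm_cexpB (_ : _ / 2 = pi * t); last by field.
by rewrite ger0_norm// sin_ge0_pi//; have := @pi_gt0 R; move=> p0; apply/andP; split; nra.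
Qed.

Section Exponent.
Variable m : R.
Hypothesis m01 : 0 < m < 1.

Definition boundary_param (t : R) : P := spiral m (circle_param t).

Lemma jordan_boundary : jordan_param boundary_param /\
  boundary_param @` `[0, 1] = spiral m @` @circle R.
Proof.
have p0 := @pi_gt0 R.
split; last by rewrite -circle_param_surj image_comp.
split.
- apply: continuous_subspaceT => t.
  have c : {for t, continuous (spiral m \o @cexp R \o (fun t : R => tip_angle + 2 * pi * t))}.
    apply: continuous_comp; last by apply: continuous_comp; [exact: continuous_cexp | exact: continuous_spiral].
    by apply: cvgD; [exact: cvg_cst | apply: cvgM; [exact: cvg_cst | exact: cvg_id]].
  exact: c.
- rewrite /boundary_param /circle_param mulr0 mulr1 addr0; congr spiral.
  rewrite (_ : 2 * pi = pi *+ 2); last by rewrite mulr2n; lra.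
  by apply: pair_ext; rewrite /= ?cosD2pi ?sinD2pi.
- move=> s t; rewrite !in_itv /= => /andP[s0 s1] /andP[t0 t1].
  move=> /(can_inj (@spiralK R m)) /cexp_inj h.
  have : tip_angle + 2 * pi * s = tip_angle + 2 * pi * t.
    apply: h; rewrite (_ : _ - _ = 2 * pi * (s - t)); last by ring.
    rewrite normrM [`|2 * pi|]ger0_norm ?mulr_ge0 ?ltW//.
    by rewrite gtr_pMr ?mulr_gt0// ltr_norml; apply/andP; split; lra.
  by move/addrI/mulfI; apply; rewrite mulf_neq0// gt_eqF.
Qed.

Lemma powR_expR (a r : R) : 0 < a -> a `^ r = expR (r * ln a).
Proof. by move=> a0; rewrite /powR gt_eqF. Qed.

(** The left side is the displacement caused by two different twist angles at radius [a]. With u =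
    ln b - ln a >= 0 and a common factor removed, the claims become 1 - exp(-m u) <= m/(1-m)
    (exp((1-m) u) - 1) and 1 - exp(-m u) <= exp u - 1; both pass through m u and use only 1 + x <=
    exp x. The first bound telescopes along a curve and yields rectifiability, the second is a
    Lipschitz bound for the energy. *)
Lemma powR_diff (a b : R) : 0 < a -> a <= b ->
  a * (a `^ (- m) - b `^ (- m)) <= m / (1 - m) * (b `^ (1 - m) - a `^ (1 - m)) /\
  a * (a `^ (- m) - b `^ (- m)) <= a `^ (- m) * (b - a).
Proof.
case/andP: m01 => m0 m1 a0 ab; have b0 : 0 < b := lt_le_trans a0 ab.
rewrite !powR_expR//.
have L0 : ln a <= ln b by rewrite ler_ln.
have ea : a = expR (ln a) by rewrite lnK.
have eb : b = expR (ln b) by rewrite lnK.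
move: L0 ea eb; set x := ln a; set y := ln b => L0 ea eb; rewrite ea eb.
have E1 : expR x * (expR (- m * x) - expR (- m * y)) = expR ((1 - m) * x) * (1 - expR (- m * (y - x))).
  by rewrite !mulrBr mulr1 -!expRD; congr (expR _ - expR _); ring.
have E2 : expR ((1 - m) * y) - expR ((1 - m) * x) = expR ((1 - m) * x) * (expR ((1 - m) * (y - x)) - 1).
  by rewrite !mulrBr mulr1 -!expRD; congr (expR _ - expR _); ring.
have E3 : expR (- m * x) * (expR y - expR x) = expR ((1 - m) * x) * (expR (y - x) - 1).
  by rewrite !mulrBr mulr1 -!expRD; congr (expR _ - expR _); ring.
rewrite E1 E2 E3.
have h1 := expR_ge1Dx (- m * (y - x)).
have h2 := expR_ge1Dx ((1 - m) * (y - x)).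
have h3 := expR_ge1Dx (y - x).
have m1' : 0 < 1 - m by lra.
split.
  rewrite mulrCA ler_wpM2l ?expR_ge0//.
  rewrite mulrAC ler_pdivlMr//; nra.
by rewrite ler_wpM2l ?expR_ge0//; nra.
Qed.

(** The two points are compared through an intermediate one: the point nearer to the tip, rotated by
    the angle that belongs to the farther one. The first leg is an isometric copy of the original
    distance, and the second is an angle difference at the smaller radius, which [powR_diff]
    controls. *)
Lemma spiral_dist (x y : P) : enorm (y - tip R) <= enorm (x - tip R) ->
  enorm (spiral m x - spiral m y) <= enorm (x - y) +
    m / (1 - m) * (enorm (x - tip R) `^ (1 - m) - enorm (y - tip R) `^ (1 - m)) /\
  enorm (spiral m x - spiral m y) <= enorm (x - y) * (1 + enorm (y - tip R) `^ (- m)).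
Proof.
case/andP: m01 => m0 m1.
rewrite /spiral; have -> : x - y = (x - tip R) - (y - tip R) by rewrite opprB addrA subrK.
set w := x - tip R; set v := y - tip R => vw.
have m1' : 0 < 1 - m by lra.
have [v0|/enorm_gt0 v0] := eqVneq v 0.
  have -> : twist 1 m v = 0 by apply: enorm_eq0; rewrite enorm_twist v0 enorm0.
  rewrite v0 !subr0 enorm_twist enorm0 powR0; last by rewrite gt_eqF.
  rewrite subr0; split; last by rewrite ler_peMr ?enorm_ge0// lerDl powR_ge0.
  by rewrite lerDl mulr_ge0 ?powR_ge0// divr_ge0// ltW.
have h : enorm (twist 1 m w - twist 1 m v) <= enorm (w - v) + enorm v * (enorm v `^ (- m) - enorm w `^ (- m)).
  (* The intermediate point is [v] rotated by the angle of [w]. *)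
  rewrite /twist !mul1r; apply: (le_trans (ler_enorm_triangle (rotp (enorm w `^ (- m)) v) _ _)).
  rewrite -rotpB enorm_rot lerD2l; apply: (le_trans (enorm_rotB_le _ _ _)).
  rewrite mulrC ler_wpM2l ?enorm_ge0// distrC ger0_norm// subr_ge0.
  rewrite !powRN lef_pV2 ?posrE ?powR_gt0 ?(lt_le_trans v0)//.
  by rewrite ge0_ler_powR ?nnegrE ?enorm_ge0// ltW.
have [h1 h2] := powR_diff v0 vw.
split; apply: (le_trans h); first by rewrite lerD2l.
rewrite [X in _ <= X]mulrDr mulr1 lerD2l (le_trans h2)// mulrC ler_wpM2r ?powR_ge0//.
by apply: le_trans (ler_enorm_dist _ _); exact: ler_norm.
Qed.

Lemma ler_sin (s t : R) : 0 <= s -> s <= t -> t <= 1 / 2 -> sin (pi * s) <= sin (pi * t).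
Proof.
move=> s0 st t1; have p0 := @pi_gt0 R.
rewrite -[sin (pi * s)]cosBpihalf -[sin (pi * t)]cosBpihalf.
rewrite -[X in X <= _]cosN -[X in _ <= X]cosN !opprB.
rewrite leNgt ltr_cos ?in_itv/= -?leNgt; first by nra.
  by apply/andP; split; nra.
by apply/andP; split; nra.
Qed.

(* The distance from [circle_param t] to [tip], to the power [1 - m]. *)
Definition tip_dist (t : R) := (2 * sin (pi * t)) `^ (1 - m).
(** The total variation of [tip_dist] over [[0, t]]: this function starts at 0, increases up to 1/2
    and then decreases symmetrically. *)
Definition tip_dist_var (t : R) := if t <= 1 / 2 then tip_dist t else 2 * tip_dist (1 / 2) - tip_dist t.

Lemma tip_distC t : tip_dist (1 - t) = tip_dist t.
Proof.
rewrite /tip_dist; congr ((2 * _) `^ _).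
by rewrite mulrBr mulr1 -[pi - _]opprB sinN sinB sinpi cospi; ring.
Qed.

Lemma tip_dist_le (s t : R) : 0 <= s -> s <= t -> t <= 1 / 2 -> tip_dist s <= tip_dist t.
Proof.
case/andP: m01 => m0 m1 s0 st t1; have p0 := @pi_gt0 R; rewrite /tip_dist.
apply: ge0_ler_powR; rewrite ?nnegrE; [lra|..].
- by rewrite mulr_ge0// sin_ge0_pi//; apply/andP; split; nra.
- by rewrite mulr_ge0// sin_ge0_pi//; apply/andP; split; nra.
by rewrite ler_wpM2l// ler_sin.
Qed.

Lemma tip_dist_variation (s t : R) : 0 <= s -> s <= t -> t <= 1 -> `|tip_dist s - tip_dist t| <= tip_dist_var t - tip_dist_var s.
Proof.
move=> s0 st t1; rewrite /tip_dist_var; case: (leP s (1 / 2)) => hs; case: (leP t (1 / 2)) => ht.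
- by rewrite distrC ger0_norm// subr_ge0 tip_dist_le.
- have h1 := tip_dist_le s0 hs (lexx _).
  have : tip_dist (1 - t) <= tip_dist (1 / 2) by apply: tip_dist_le; lra.
  by rewrite tip_distC ler_norml => h2; apply/andP; split; lra.
- lra.
have : tip_dist (1 - t) <= tip_dist (1 - s) by apply: tip_dist_le; lra.
by rewrite !tip_distC => h; rewrite ger0_norm; lra.
Qed.

(** A function whose increments dominate the chords of the boundary curve: the first summand
    accounts for motion along the circle, the second for the change of the twist angle. Sums of
    chords then telescope. *)
Definition param_var (t : R) := 2 * pi * t + m / (1 - m) * tip_dist_var t.

Lemma boundary_param_variation (s t : R) : 0 <= s -> s <= t -> t <= 1 ->
  enorm (boundary_param s - boundary_param t) <= param_var t - param_var s.
Proof.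
move=> s0 st t1; case/andP: m01 => m0 m1.
have e1 : tip_dist s = enorm (circle_param s - tip R) `^ (1 - m).
  by rewrite circle_param_dist_tip//; apply/andP; split; lra.
have e2 : tip_dist t = enorm (circle_param t - tip R) `^ (1 - m).
  by rewrite circle_param_dist_tip//; apply/andP; split; lra.
have c0 : 0 <= m / (1 - m) by rewrite divr_ge0; lra.
have := tip_dist_variation s0 st t1; rewrite ler_norml => /andP[h1 h2].
have := circle_param_dist_le s t; rewrite [`|s - t|]distrC ger0_norm ?subr_ge0// => h3.
rewrite /param_var /boundary_param.
have [h|/ltW h] := leP (enorm (circle_param t - tip R)) (enorm (circle_param s - tip R)).
  have [+ _] := spiral_dist h; rewrite -e1 -e2; nra.
rewrite enorm_distC in h3; rewrite (enorm_distC (spiral _ _)).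
have [+ _] := spiral_dist h; rewrite -e1 -e2; nra.
Qed.

Lemma rectifiable_boundary_param : rectifiable_param boundary_param.
Proof.
exists (param_var 1 - param_var 0) => s ss sa.
have var_le (a b : R) : 0 <= a -> a <= b -> b <= 1 -> param_var a <= param_var b.
  by move=> a0 ab b1; rewrite -subr_ge0 (le_trans _ (boundary_param_variation a0 ab b1))// enorm_ge0.
have s01 i : (i < size s)%N -> 0 <= nth 0 s i <= 1 by move=> h; exact: (all_nthP 0 sa).
(* A list with at most one point gives an empty sum; in the other case all indices of the
   telescoping sum lie inside the list. *)
case: (posnP (size s).-1) => [->|n0]; first by rewrite big_ord0 subr_ge0 var_le.
have lts i : (i < (size s).-1)%N -> (i.+1 < size s)%N by case: (size s) n0.
apply: (@le_trans _ _ (\sum_(i < (size s).-1) (param_var (nth 0 s i.+1) - param_var (nth 0 s i)))).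
  apply: ler_sum => i _; rewrite pdistE.
  have i1 := lts _ (ltn_ord i); have i0 : (i < size s)%N := ltnW i1.
  have /andP[a0 a1] := s01 _ i0; have /andP[b0 b1] := s01 _ i1.
  apply: boundary_param_variation => //.
  by apply: (sorted_leq_nth (@le_trans _ R) (@lexx _ R)) => //; exact: leqnSn.
rewrite -(big_mkord xpredT (fun i => param_var (nth 0 s i.+1) - param_var (nth 0 s i))) telescope_sumr; last exact: leq0n.
have sz : ((size s).-1 < size s)%N by case: (size s) n0.
have /andP[a0 a1] := s01 _ sz; have /andP[b0 b1] := s01 _ (leq_ltn_trans (leq0n _) sz).
by apply: lerB; apply: var_le.
Qed.

End Exponent.
End Curve.

(** * The boundary energy *)

Section Energy.
Variable R : realType.
Notation P := (R * R)%type.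
Notation mu := (@lebesgue_measure R).

(** A nonnegative integral is the supremum over the simple functions below the integrand, so
    monotonicity holds without measurability. The double integral of the energy can thus be bounded
    without discussing the measurability of its inner integral in the outer variable. *)
Lemma le_integral_ge0 d (T : measurableType d) (nu : {measure set T -> \bar R}) (D : set T) (f g : T -> \bar R) :
  (forall x, D x -> (0 <= f x)%E) -> (forall x, D x -> (f x <= g x)%E) ->
  (\int[nu]_(x in D) f x <= \int[nu]_(x in D) g x)%E.
Proof.
move=> f0 fg; have g0 x : D x -> (0 <= g x)%E by move=> Dx; exact: le_trans (f0 _ Dx) (fg _ Dx).
rewrite !ge0_integralE//; apply: ereal_sup_le => _ /= [h hf <-]; exists h => // x.
apply: (le_trans (hf x)); rewrite /patch; case: ifPn => // xD; apply: fg; exact: set_mem.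
Qed.

Lemma FTC2_closed (f F : R -> R) (a b : R) : a < b ->
  (forall x, a <= x <= b -> is_derive x 1 F (f x)) ->
  (forall x, a <= x <= b -> {for x, continuous f}) ->
  (\int[mu]_(x in `[a, b]) (f x)%:E = (F b - F a)%:E)%E.
Proof.
move=> ab dF cf.
have cF x : a <= x <= b -> {for x, continuous F}.
  move=> xab; apply: differentiable_continuous; apply/derivable1_diffP.
  by have := dF x xab => h; exact: ex_derive.
rewrite EFinB; apply: continuous_FTC2 => //.
- by apply: continuous_in_subspaceT => x /set_mem /=; rewrite in_itv /=; exact: cf.
- split.
  + move=> x; rewrite in_itv /= => /andP[ax xb].
    by have h := dF x; apply: ex_derive; apply: h; rewrite !ltW.
  + by apply: cvg_at_right_filter; apply: cF; rewrite lexx ltW.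
  + by apply: cvg_at_left_filter; apply: cF; rewrite lexx ltW.
- move=> x; rewrite in_itv /= => /andP[ax xb].
  have h : is_derive x 1 F (f x) by apply: dF; rewrite !ltW.
  by rewrite derive1E; exact: derive_val.
Qed.

Lemma is_derive_powR_affine (s c k x : R) : 0 < s * (x - c) ->
  is_derive x 1 (fun t => (s * (t - c)) `^ k) (k * (s * (x - c)) `^ (k - 1) * s).
Proof.
move=> h.
have h1 : is_derive x 1 (fun t : R => s * (t - c)) s.
  have -> : (fun t : R => s * (t - c)) = s \*o (id - cst c) by apply/funext.
  by apply: is_derive_eq; rewrite subr0 /GRing.scale /= mulr1.
have h2 : is_derive (s * (x - c)) 1 (fun t : R => t `^ k) (k * (s * (x - c)) `^ (k - 1)).
  have hin : s * (x - c) \in `]0, +oo[ by rewrite in_itv /= h.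
  apply: DeriveDef; first exact: derivable_powR.
  by rewrite -derive1E powR_derive1.
exact: (@is_derive1_comp _ (fun t : R => t `^ k) (fun t : R => s * (t - c)) x _ _ h2 h1).
Qed.

Lemma le_integral_bigcup d (T : measurableType d) (nu : {measure set T -> \bar R}) (F : (set T)^nat) (f : T -> \bar R) (M : \bar R) :
  nondecreasing_seq F -> (forall i, measurable (F i)) -> measurable_fun setT f ->
  (forall x, (0 <= f x)%E) -> (forall i, (\int[nu]_(x in F i) f x <= M)%E) ->
  (\int[nu]_(x in \bigcup_i F i) f x <= M)%E.
Proof.
move=> ndF mF mf f0 fM.
have h := @ge0_nondecreasing_set_cvg_integral _ _ _ F f nu ndF mF
  (fun i => measurable_funS measurableT (@subsetT _ _) mf) (fun i x _ => f0 x).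
rewrite -(cvg_lim _ h)//; apply: lime_le; first by apply/cvg_ex; eexists; exact: h.
by apply: nearW.
Qed.

(** The sign [s] selects the side of the singularity [c]. On a closed interval away from [c] the
    fundamental theorem applies to an explicit antiderivative, and s * s = 1 absorbs the sign
    produced by differentiation. *)
Lemma integral_powR_closed (s c k L a b : R) : 0 < k < 1 -> s = 1 \/ s = -1 ->
  (forall x, a <= x <= b -> 0 < s * (x - c) <= L) -> 0 <= L ->
  (\int[mu]_(x in `[a, b]) ((s * (x - c)) `^ (- k))%:E <= (L `^ (1 - k) / (1 - k))%:E)%E.
Proof.
move=> /andP[k0 k1] hs h L0; have k1' : 0 < 1 - k by lra.
have M0 : 0 <= L `^ (1 - k) / (1 - k) by rewrite divr_ge0 ?powR_ge0// ltW.
case: (ltP a b) => ab; last first.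
  move: ab; rewrite le_eqVlt => /predU1P[->|ba]; first by rewrite set_itv1 integral_set1 lee_fin.
  by rewrite set_itv_ge ?integral_set0 ?lee_fin// bnd_simp -ltNge.
have s2 : s * s = 1 by case: hs => ->; lra.
pose F t := s / (1 - k) * (s * (t - c)) `^ (1 - k).
have -> : (\int[mu]_(x in `[a, b]) ((s * (x - c)) `^ (- k))%:E = (F b - F a)%:E)%E.
  apply: FTC2_closed => // x; last first.
+ move=> /h /andP[x0 _].
  apply: differentiable_continuous; apply/derivable1_diffP.
  by have h1 := is_derive_powR_affine (- k) x0; exact: ex_derive.
+ move=> /h /andP[x0 _]; have h1 := is_derive_powR_affine (1 - k) x0.
  have -> : F = (s / (1 - k)) \*o (fun t => (s * (t - c)) `^ (1 - k)) by apply/funext.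
  apply: is_derive_eq; rewrite (_ : 1 - k - 1 = - k); last by ring.
  by rewrite /GRing.scale /=; transitivity ((s * s) * ((1 - k) / (1 - k)) * (s * (x - c)) `^ (- k));
    [field; rewrite gt_eqF | rewrite s2 divff ?gt_eqF// !mul1r].
rewrite lee_fin /F.
have /h/andP[a0 aL] : a <= a <= b by rewrite lexx ltW.
have /h/andP[b0 bL] : a <= b <= b by rewrite lexx ltW.
have pa : (s * (a - c)) `^ (1 - k) <= L `^ (1 - k) by apply: ge0_ler_powR; rewrite ?nnegrE//; lra.
have pb : (s * (b - c)) `^ (1 - k) <= L `^ (1 - k) by apply: ge0_ler_powR; rewrite ?nnegrE//; lra.
have pa0 := powR_ge0 (s * (a - c)) (1 - k); have pb0 := powR_ge0 (s * (b - c)) (1 - k).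
rewrite -mulrBr (mulrAC s) ler_pM2r ?invr_gt0//.
by move: pa pb pa0 pb0; case: hs => -> *; lra.
Qed.

Lemma integral_powR_le (s c k L : R) : 0 < k < 1 -> s = 1 \/ s = -1 -> 0 <= L ->
  (\int[mu]_(x in [set x | (0 < s * (x - c) <= L)%R]) ((s * (x - c)) `^ (- k))%:E
     <= (L `^ (1 - k) / (1 - k))%:E)%E.
Proof.
move=> k01 hs L0.
(* The half neighbourhood of [c] is exhausted by closed intervals that stay at distance at least
   1/(i+1) from [c], with a bound independent of [i]. *)
pose F (i : nat) : set R := [set x | i.+1%:R^-1 <= s * (x - c) <= L].
have FE i : F i = if s == 1 then [set` `[c + i.+1%:R^-1, c + L]] else [set` `[c - L, c - i.+1%:R^-1]].
  have n0 : (0 : R) < i.+1%:R^-1 by rewrite invr_gt0.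
  rewrite /F; move: (_^-1) n0 => n n0; case: hs => ->.
    rewrite eqxx; apply/seteqP; split => x; rewrite /= in_itv /= ?mul1r => /andP[? ?]; apply/andP; split; lra.
  rewrite (_ : (-1 == 1) = false); last by apply/negbTE/eqP; lra.
  apply/seteqP; split => x; rewrite /= in_itv /= ?mulN1r => /andP[? ?]; apply/andP; split; lra.
rewrite (_ : [set x | _] = \bigcup_i F i); last first.
  apply/seteqP; split => x /=; last first.
    move=> [i _]; rewrite /F /= => /andP[h ->]; rewrite andbT; apply: lt_le_trans h.
    by rewrite invr_gt0.
  move=> /andP[h hL].
  have [i _ hi] := near_infty_natSinv_lt (PosNum h).
  exists i => //; rewrite /F /= hL andbT ltW//; exact: (hi i (leqnn i)).
apply: le_integral_bigcup.
- move=> i j ij; apply/subsetPset => x; rewrite /F /= => /andP[h ->]; rewrite andbT.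
  by apply: le_trans h; rewrite lef_pV2 ?posrE// ler_nat ltnS.
- by move=> i; rewrite FE; case: ifP => _; exact: measurable_itv.
- apply/measurable_EFinP; apply: (@measurableT_comp _ _ _ _ _ _ (fun x : R => x `^ (- k))) => //.
  by apply: measurable_funM => //; apply: measurable_funB.
- by move=> x; rewrite lee_fin powR_ge0.
move=> i; have n0 : (0 : R) < i.+1%:R^-1 by rewrite invr_gt0.
by move: (FE i); case: ifP => _ e; rewrite e; apply: integral_powR_closed => // x;
  move=> hx; have : F i x by [rewrite e /= in_itv]; rewrite /F /= => /andP[h1 h2];
  rewrite h2 andbT (lt_le_trans n0).
Qed.

(** The mean value theorem gives sin (u/2) >= (u/2) cos (u/2), hence sin u >= u cos (u/2)^2; the
    last factor is at least 1/2 because cos u >= 0. *)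
Lemma ler_sin_half (u : R) : 0 <= u <= pi / 2 -> u / 2 <= sin u.
Proof.
move=> /andP[u0 u1]; have p0 := @pi_gt0 R.
have e : u = (u / 2) *+ 2 by rewrite mulr2n; field.
have h : u / 2 * cos (u / 2) <= sin (u / 2).
  have u20 : 0 <= u / 2 by lra.
  have [|c] := @MVT_segment R sin cos 0 (u / 2) u20.
    by apply: continuous_subspaceT; exact: continuous_sin.
  rewrite in_itv /= sin0 !subr0 => /andP[c0 c1] ->; rewrite mulrC ler_wpM2r//.
  rewrite leNgt ltr_cos ?in_itv/= -?leNgt//; apply/andP; split; lra.
have c0 : 0 <= cos (u / 2) by apply: cos_ge0_pihalf; apply/andP; split; lra.
have cu : 0 <= cos u by apply: cos_ge0_pihalf; apply/andP; split; lra.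
have e1 : sin u = cos (u / 2) * sin (u / 2) * 2 by rewrite [in LHS]e sin_mulr2n mulr_natr.
have e2 : cos u = cos (u / 2) ^+ 2 * 2 - 1 by rewrite [in LHS]e cos_mulr2n mulr_natr.
rewrite e1; move: cu; rewrite e2; nra.
Qed.

(** A chord is at least half of the shorter arc, and the shorter arc has length |s - t| or 2 pi - |s
    - t|. *)
Lemma enorm_cexpB_ge (s t : R) : `|s - t| <= 2 * pi ->
  `|s - t| <= 2 * enorm (cexp s - cexp t) \/ 2 * pi - `|s - t| <= 2 * enorm (cexp s - cexp t).
Proof.
rewrite enorm_cexpB => h; have p0 := @pi_gt0 R.
have -> : `|sin ((s - t) / 2)| = `|sin (`|s - t| / 2)|.
  have [st|st] := leP 0 (s - t); first by rewrite [in RHS](ger0_norm st).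
  by rewrite [in RHS](ltr0_norm st) mulNr sinN normrN.
have := normr_ge0 (s - t); move: h; set v := `|s - t| => h v0.
have [vp|vp] := leP v pi; [left|right].
  have : v / 2 / 2 <= sin (v / 2) by apply: ler_sin_half; apply/andP; split; lra.
  by have := ler_norm (sin (v / 2)); lra.
have : (pi - v / 2) / 2 <= sin (pi - v / 2) by apply: ler_sin_half; apply/andP; split; lra.
rewrite -[pi - _]opprB sinN sinB sinpi cospi mulr0 subr0 mulrN1 opprK.
by have := ler_norm (sin (v / 2)); lra.
Qed.

(* The tip is the only singularity, and both bounds of the minimum hold up to a factor when
   [y] is close to [x]; for far apart points the quotient is bounded. *)
Lemma spiral_quotient_le (m : R) (x y : P) : 0 < m < 1 ->
  enorm (spiral m x - spiral m y) <= 5 * enorm (x - y) \/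
  0 < enorm (x - tip R) /\
  enorm (spiral m x - spiral m y) <= 5 * (enorm (x - y) * (1 + enorm (x - tip R) `^ (- m))) /\
  enorm (spiral m x - spiral m y) <= 5 * enorm (x - tip R).
Proof.
move=> m01; have /andP[m0 m1] := m01.
have h1 : enorm (spiral m x - spiral m y) <= enorm (x - tip R) + enorm (y - tip R).
  by apply: (le_trans (ler_enormB _ _)); rewrite !enorm_spiral.
have h2 : enorm (y - tip R) <= enorm (y - x) + enorm (x - tip R) by exact: ler_enorm_triangle.
have h3 : enorm (x - tip R) <= enorm (x - y) + enorm (y - tip R) by exact: ler_enorm_triangle.
rewrite (enorm_distC y x) in h2.
(* If the points are farther apart than half the distance from [x] to the tip, the sum of both
   distances to the tip is at most five times their distance. Otherwise [y] is at least half as far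
   from the tip as [x], and the two powers agree up to a factor 2^m <= 2. *)
have [c|c] := leP (enorm (x - y)) (enorm (x - tip R) / 2); last by left; have := enorm_ge0 (x - y); lra.
have [x0|x0] := eqVneq (enorm (x - tip R)) 0.
  by left; have := enorm_ge0 (x - y); lra.
have x1 : 0 < enorm (x - tip R) by rewrite lt_def x0 enorm_ge0.
right; split => //; split; last by lra.
have y1 : enorm (x - tip R) / 2 <= enorm (y - tip R) by lra.
have key : enorm (y - tip R) `^ (- m) <= 2 * enorm (x - tip R) `^ (- m).
  apply: (@le_trans _ _ ((enorm (x - tip R) / 2) `^ (- m))).
    rewrite !powRN lef_pV2 ?posrE ?powR_gt0 ?divr_gt0//; last by lra.
    by rewrite ge0_ler_powR ?nnegrE ?enorm_ge0 ?divr_ge0 ?enorm_ge0// ltW.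
  rewrite powRM ?enorm_ge0 ?invr_ge0// mulrC ler_wpM2r ?powR_ge0//.
  rewrite -powR_inv1 -?powRrM// mulN1r opprK.
  have one2 : (1 : R) <= 2 by rewrite ler1n.
  by have := ler_powR one2 (ltW m1); rewrite powRr1.
have d0 := enorm_ge0 (x - y); have p0 := powR_ge0 (enorm (x - tip R)) (- m).
have [yx|xy] := leP (enorm (y - tip R)) (enorm (x - tip R)).
  have [_ +] := spiral_dist m01 yx; nra.
have [_ +] := spiral_dist m01 (ltW xy).
by rewrite enorm_distC (enorm_distC y); nra.
Qed.

(** The numbers [k] and [a] are the exponents of d and r after interpolating min(r^-m, r/d)^p by
    (r^-m)^(p-k) (r/d)^k. At k = 1 the exponent [a] would be m (p - 1) - 1 < 1, but d^-1 is not
    integrable; the proof lowers [k] by an [e] that spends half of the slack 2 - m (p - 1), which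
    makes [a] equal to m (p - 1) / 2. *)
Lemma energy_exponents (m p : R) : 0 < m < 1 -> 2 < m * p -> m * (p - 1) < 2 ->
  exists k a : R, [/\ 0 < k < 1, 0 < a < 1, a = m * p - (m + 1) * k & 2 < p].
Proof.
move=> /andP[m0 m1] mp pm.
pose e := (2 - m * (p - 1)) / (2 * (m + 1)).
have e1 : (m + 1) * e = (2 - m * (p - 1)) / 2 by rewrite /e; field; rewrite gt_eqF//; lra.
have e0 : 0 < e by rewrite divr_gt0//; lra.
have e2 : e < 1 by rewrite ltr_pdivrMr; nra.
exists (1 - e), (m * p - (m + 1) * (1 - e)); clearbody e; split => //.
- by apply/andP; split; lra.
- by apply/andP; split; nra.
- by rewrite ltNge; apply/negP => h; nra.
Qed.

(** Separates the singularity at the tip from the one on the diagonal, so that each can be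
    integrated in a single variable. The constant 20 is a common bound for all the cases. *)
Lemma energy_integrand_le (m p k a : R) (x y : P) : 0 < m < 1 -> 0 < k < 1 -> 0 < a < 1 ->
  a = m * p - (m + 1) * k -> 2 < p ->
  (pdist (spiral m x) (spiral m y)) `^ p / (pdist x y) `^ p <=
  20 `^ p * (1 + enorm (x - tip R) `^ (- a) * enorm (x - y) `^ (- k)).
Proof.
move=> m01 /andP[k0 k1] /andP[a0 a1] aE p2.
rewrite !pdistE; case/andP: (m01) => m0 m1.
have p0 : 0 < p by lra.
have rhs0 : 0 <= enorm (x - tip R) `^ (- a) * enorm (x - y) `^ (- k) by rewrite mulr_ge0 ?powR_ge0.
have C0 : 0 <= 20 `^ p :> R by rewrite powR_ge0.
(* On the diagonal the quotient is 0, by the convention that the inverse of 0 is 0. *)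
have [d0|d0] := eqVneq (enorm (x - y)) 0.
  by rewrite d0 (powR0 (lt0r_neq0 p0)) invr0 mulr0 mulr_ge0 ?addr_ge0 ?mulr_ge0 ?powR_ge0.
have d1 : 0 < enorm (x - y) by rewrite lt_def d0 enorm_ge0.
rewrite -powRN.
set r := enorm (x - tip R); set d := enorm (x - y).
pose q := enorm (spiral m x - spiral m y) / d.
have q0 : 0 <= q by rewrite divr_ge0 ?enorm_ge0.
suff h : q `^ p <= 20 `^ p * (1 + r `^ (- a) * d `^ (- k)).
  apply: le_trans h; rewrite /q powRM ?invr_ge0 ?enorm_ge0//.
  by rewrite -(powR_inv1 (enorm_ge0 (x - y))) -powRrM mulN1r.
have [h|[r0 [h1 h2]]] := spiral_quotient_le x y m01.
  have q5 : q <= 5 by rewrite ler_pdivrMr.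
  apply: (@le_trans _ _ (20 `^ p)); last by rewrite ler_peMr// lerDl.
  by apply: ge0_ler_powR; rewrite ?nnegrE//; lra.
have [r1|r1] := leP 1 r.
  have q10 : q <= 10.
    rewrite ler_pdivrMr//; apply: (le_trans h1).
    have : r `^ (- m) <= 1 by rewrite -(powRr0 r) ler_powR// oppr_le0 ltW.
    by have dd : 0 < d := d1; rewrite -/d -/r => ?; nra.
  apply: (@le_trans _ _ (20 `^ p)); last by rewrite ler_peMr// lerDl.
  by apply: ge0_ler_powR; rewrite ?nnegrE//; lra.
(* Close to the tip the summand 1 in 1 + r^-m is absorbed by r^-m, at the price of a factor 2. *)
have rm1 : 1 <= r `^ (- m).
  by rewrite powRN invr_ge1 ?unitf_gt0 ?powR_gt0// -(powRr0 r) ger_powR// ?r0 ltW.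
have A : q <= 20 * r `^ (- m) by rewrite ler_pdivrMr//; have dd : 0 < d := d1; rewrite -/d -/r in h1; nra.
have B : q <= 20 * (r / d).
  by rewrite ler_pdivrMr// -mulrA divfK//; have rr : 0 < r := r0; rewrite -/r in h2; lra.
rewrite mulrDr -[X in X <= _]add0r lerD ?mulr1//.
(* Interpolation: [p - k] of the powers are bounded by [A] and the remaining [k] by [B]. *)
have pk : 0 <= p - k by lra.
have -> : q `^ p = q `^ (p - k) * q `^ k.
  by rewrite -powRD ?subrK//; apply/implyP => /eqP; lra.
have -> : 20 `^ p * (r `^ (- a) * d `^ (- k)) = (20 * r `^ (- m)) `^ (p - k) * (20 * (r / d)) `^ k.
  rewrite !powRM ?powR_ge0 ?divr_ge0 ?invr_ge0 ?enorm_ge0//.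
  rewrite -powRrM -(powR_inv1 (enorm_ge0 (x - y))) -powRrM mulN1r.
  have -> : 20 `^ p = 20 `^ (p - k) * 20 `^ k :> R.
    by rewrite -powRD ?subrK// pnatr_eq0 implybT.
  have -> : r `^ (- a) = r `^ (- m * (p - k)) * r `^ k.
    have -> : - a = - m * (p - k) + k by rewrite aE; ring.
    by rewrite powRD// (gt_eqF (r0 : 0 < r)) implybT.
  by rewrite -/d; ring.
apply: ler_pM; rewrite ?powR_ge0//; apply: ge0_ler_powR; rewrite ?nnegrE ?mulr_ge0 ?powR_ge0 ?divr_ge0 ?enorm_ge0//.
all: by [rewrite invr_ge0 enorm_ge0 | exact: ltW].
Qed.

Lemma measurable_affine (s c : R) : measurable_fun [set: R] (fun t : R => s * (t - c)).
Proof. by apply: measurable_funM => //; apply: measurable_funB. Qed.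

Lemma measurable_half_neighbourhood (s c L : R) : measurable [set x : R | (0 < s * (x - c) <= L)%R].
Proof.
rewrite (_ : [set x | _] = setT `&` (fun t : R => s * (t - c)) @^-1` [set` `]0, L]]); last first.
  by apply/seteqP; split => x /=; rewrite in_itv /= => h; [split | case: h].
exact: measurable_affine.
Qed.

(** The chord is at least half the distance from [t] to one of [s], [s + 2 pi], [s - 2 pi]. The
    integrand is therefore dominated by four one-sided powers: two around [s], one to the left of
    [s + 2 pi] and one to the right of [s - 2 pi]. The factor 2 in front bounds 2^k. *)
Lemma integral_cexpB_powR_le (k : R) : 0 < k < 1 -> exists C : R, 0 <= C /\
  forall s, 0 <= s <= 2 * pi ->
  (\int[mu]_(t in `[0%R, (2 * pi)%R]) (enorm (cexp s - cexp t) `^ (- k))%:E <= C%:E)%E.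
Proof.
move=> k01; have /andP[k0 k1] := k01; have p0 := @pi_gt0 R.
pose L : R := 2 * pi; have L0 : 0 <= L by rewrite /L; lra.
pose M : R := L `^ (1 - k) / (1 - k).
have M0 : 0 <= M by rewrite divr_ge0 ?powR_ge0//; lra.
exists (2 * (M + M + (M + M))); split; first by lra.
move=> s /andP[s0 s1].
pose D (e c : R) := [set x : R | (0 < e * (x - c) <= L)%R].
pose G (e c : R) : R -> \bar R := (fun x : R => ((e * (x - c)) `^ (- k))%:E) \_ (D e c).
have G0 e c x : (0 <= G e c x)%E by apply: erestrict_ge0 => *; rewrite lee_fin powR_ge0.
have mG e c : measurable_fun setT (G e c).
  apply/(measurable_restrictT _ (measurable_half_neighbourhood _ _ _)).
  apply: measurable_funS (@measurableT _ R) (@subsetT _ _) _.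
  apply/measurable_EFinP; apply: (@measurableT_comp _ _ _ _ _ _ (fun x : R => x `^ (- k))) => //.
  exact: measurable_affine.
have iG e c : e = 1 \/ e = -1 -> (\int[mu]_x G e c x <= M%:E)%E.
  by move=> he; rewrite -integral_mkcond; exact: integral_powR_le.
have GE e c x : 0 < e * (x - c) <= L -> G e c x = ((e * (x - c)) `^ (- k))%:E.
  by move=> h; rewrite /G patchE mem_set.
rewrite integral_mkcond.
apply: (@le_trans _ _ (\int[mu]_x (2%:E * ((G 1%R s x + G (-1)%R s x) + (G (-1)%R (s + 2 * pi)%R x + G 1%R (s - 2 * pi)%R x))))%E).
  apply: le_integral_ge0 => t _; first by apply: erestrict_ge0 => *; rewrite lee_fin powR_ge0.
  rewrite patchE; case: ifPn => [|_]; last by rewrite mule_ge0// !adde_ge0.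
  rewrite inE /= in_itv /= => /andP[t0 t1].
  have [d0|d0] := eqVneq (enorm (cexp s - cexp t)) 0.
    by rewrite d0 powR0 ?oppr_eq0 ?lt0r_neq0// mule_ge0// !adde_ge0.
  have d1 : 0 < enorm (cexp s - cexp t) by rewrite lt_def d0 enorm_ge0.
  have st : s - t != 0.
    by apply: contra_neq d0 => /eqP; rewrite subr_eq0 => /eqP ->; rewrite subrr enorm0.
  have v0 : 0 < `|s - t| by rewrite normr_gt0.
  have vL : `|s - t| < 2 * pi.
    have : `|s - t| <= 2 * pi by rewrite ler_norml; apply/andP; split; lra.
    rewrite le_eqVlt => /predU1P[e|//]; exfalso; move: d0; apply/negP; rewrite negbK.
    rewrite enorm_cexpB mulf_eq0 normr_eq0; apply/orP; right.
    have [h|h] := leP 0 (s - t).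
      by move: e; rewrite ger0_norm// => ->; rewrite mulrAC divff ?mul1r ?sinpi.
    move: e; rewrite ltr0_norm// => /eqP; rewrite eqr_oppLR => /eqP ->.
    by rewrite mulNr sinN mulrAC divff ?mul1r ?sinpi ?oppr0.
  have half (v : R) : 0 < v -> v <= 2 * enorm (cexp s - cexp t) -> enorm (cexp s - cexp t) `^ (- k) <= 2 * v `^ (- k).
    move=> w0 hv; apply: (@le_trans _ _ ((v / 2) `^ (- k))).
      rewrite !powRN lef_pV2 ?posrE ?powR_gt0 ?divr_gt0//.
      by rewrite ge0_ler_powR ?nnegrE ?divr_ge0 ?enorm_ge0 ?(ltW k0) ?(ltW w0)//; lra.
    rewrite powRM ?invr_ge0 ?(ltW w0)// mulrC ler_wpM2r ?powR_ge0//.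
    rewrite -powR_inv1 -?powRrM// mulN1r opprK.
    have one2 : (1 : R) <= 2 by rewrite ler1n.
    by have := ler_powR one2 (ltW k1); rewrite powRr1.
  have pick (e c : R) : 0 < e * (t - c) <= L -> e * (t - c) <= 2 * enorm (cexp s - cexp t) ->
      ((enorm (cexp s - cexp t) `^ (- k))%:E <= 2%:E * G e c t)%E.
    by move=> /[dup] h /andP[h1 _] h2; rewrite (GE _ _ _ h) -EFinM lee_fin half.
  have [h|h] := enorm_cexpB_ge (ltW vL); have [u|u] := ltP 0 (s - t).
  - apply: (le_trans (pick (-1) s _ _)).
    + by move: vL; rewrite gtr0_norm// => vL; apply/andP; split; rewrite /L; lra.
    + by move: h; rewrite gtr0_norm//; lra.
    by apply: lee_wpmul2l => //; rewrite -[leLHS]add0e lee_paddr// ?adde_ge0// leeD.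
  - have {}u : s - t < 0 by rewrite lt_def eq_sym st.
    apply: (le_trans (pick 1 s _ _)).
    + by move: vL; rewrite ltr0_norm// => vL; apply/andP; split; rewrite /L; lra.
    + by move: h; rewrite ltr0_norm//; lra.
    by apply: lee_wpmul2l => //; rewrite lee_paddr// ?adde_ge0// lee_paddr.
  - apply: (le_trans (pick 1 (s - 2 * pi) _ _)).
    + by move: vL; rewrite gtr0_norm// => vL; apply/andP; split; rewrite /L; lra.
    + by move: h; rewrite gtr0_norm//; lra.
    by apply: lee_wpmul2l => //; rewrite lee_paddl// ?adde_ge0// lee_paddl.
  - have {}u : s - t < 0 by rewrite lt_def eq_sym st.
    apply: (le_trans (pick (-1) (s + 2 * pi) _ _)).
    + by move: vL; rewrite ltr0_norm// => vL; apply/andP; split; rewrite /L; lra.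
    + by move: h; rewrite ltr0_norm//; lra.
    by apply: lee_wpmul2l => //; rewrite lee_paddl// ?adde_ge0// lee_paddr.
rewrite ge0_integralZl//; last 2 first.
- by do 2! apply: emeasurable_funD; exact: mG.
- by move=> x _; rewrite !adde_ge0.
rewrite EFinM; apply: lee_wpmul2l => //.
rewrite ge0_integralD//; try by [move=> x _; rewrite adde_ge0 | apply: emeasurable_funD; exact: mG].
have iD e c e' c' : e = 1 \/ e = -1 -> e' = 1 \/ e' = -1 ->
    (\int[mu]_x (G e c x + G e' c' x) <= (M + M)%:E)%E.
  move=> he he'; rewrite (@ge0_integralD _ _ _ mu _ measurableT _ _ (fun x _ => G0 e c x) (mG e c) (fun x _ => G0 e' c' x) (mG e' c')).
  by rewrite EFinD leeD// iG.
by rewrite EFinD leeD// iD//; by [left|right].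
Qed.

Lemma integral_affine_le (D : set R) (g : R -> R) (A B C : R) : measurable D -> mu D = (2 * pi)%:E ->
  0 <= A -> 0 <= B -> (forall x, 0 <= g x) -> measurable_fun setT g ->
  (\int[mu]_(x in D) (g x)%:E <= C%:E)%E ->
  (\int[mu]_(x in D) (A + B * g x)%:E <= (A * (2 * pi) + B * C)%:E)%E.
Proof.
move=> mD muD A0 B0 g0 mg gC.
have mg' : measurable_fun D (EFin \o g).
  by apply/measurable_EFinP; apply: measurable_funS mg.
under eq_integral do rewrite EFinD EFinM.
rewrite ge0_integralD//; last 2 first.
- by move=> x _; rewrite -EFinM lee_fin mulr_ge0.
- by apply/emeasurable_funM.
have -> : (\int[mu]_(x in D) A%:E = (A * (2 * pi))%:E)%E by rewrite EFinM -muD; exact: integral_cst.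
rewrite EFinD leeD// EFinM.
rewrite ge0_integralZl//; last by move=> x _; rewrite lee_fin.
by rewrite lee_wpmul2l.
Qed.

(** The integral over [t] removes the diagonal singularity uniformly in [s]. What remains is a power
    of the distance from [cexp s] to [tip]; as [tip] is [cexp] of [tip_angle], the same one-variable
    estimate bounds it. *)
Lemma energy_finite (m p : R) : 0 < m < 1 -> 2 < m * p -> m * (p - 1) < 2 ->
  (\int[mu]_(s in `[0%R, (2 * pi)%R])
     \int[mu]_(t in `[0%R, (2 * pi)%R])
        (powR (pdist (spiral m (cexp s)) (spiral m (cexp t))) p /
         powR (pdist (cexp s) (cexp t)) p)%:E < +oo)%E.
Proof.
move=> m01 mp pm; have [k [a [k01 a01 aE p2]]] := energy_exponents m01 mp pm.
have p0 := @pi_gt0 R.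
have [Ck [Ck0 hk]] := integral_cexpB_powR_le k01.
have [Ca [Ca0 ha]] := integral_cexpB_powR_le a01.
have C0 : 0 <= 20 `^ p :> R by rewrite powR_ge0.
have mD : measurable ([set` `[0%R, (2 * pi)%R]] : set R) by exact: measurable_itv.
have muD : mu [set` `[0%R, (2 * pi)%R]] = (2 * pi)%:E.
  by rewrite lebesgue_measure_itv /= lte_fin mulr_gt0// oppr0 adde0.
have mc (s b : R) : measurable_fun setT (fun t : R => enorm (cexp s - cexp t) `^ (- b)).
  apply: (@measurableT_comp _ _ _ _ _ _ (fun x : R => x `^ (- b))) => //.
  apply: continuous_measurable_fun => t.
  have c : {for t, continuous (@enorm R \o (fun t => cexp s - cexp t))}.
    apply: continuous_comp; last exact: continuous_enorm.
    by apply: cvgB; [exact: cvg_cst | exact: continuous_cexp].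
  exact: c.
apply: (@le_lt_trans _ _ (\int[mu]_(s in `[0%R, (2 * pi)%R])
  (20 `^ p * (2 * pi) + (20 `^ p * Ck) * enorm (cexp (tip_angle R) - cexp s) `^ (- a))%:E)%E).
  apply: le_integral_ge0 => s.
    by move=> _; apply: integral_ge0 => t _; rewrite lee_fin divr_ge0 ?powR_ge0.
  rewrite /= in_itv /= => hs.
  apply: (@le_trans _ _ (\int[mu]_(t in `[0%R, (2 * pi)%R])
     (20 `^ p + (20 `^ p * enorm (cexp (tip_angle R) - cexp s) `^ (- a)) * enorm (cexp s - cexp t) `^ (- k))%:E)%E).
    apply: le_integral_ge0 => t _; rewrite lee_fin ?divr_ge0 ?powR_ge0//.
    apply: (le_trans (energy_integrand_le (cexp s) (cexp t) m01 k01 a01 aE p2)).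
    by rewrite cexp_tip (enorm_distC (tip R)) mulrDr mulr1 mulrA.
  apply: (le_trans (integral_affine_le mD muD C0 (mulr_ge0 C0 (powR_ge0 _ _)) (fun t => powR_ge0 _ _) (mc s k) (hk s hs))).
  by rewrite lee_fin [X in _ + X]mulrAC.
have tp : 0 <= tip_angle R <= 2 * pi := tip_angle_itv R.
have A0 : 0 <= 20 `^ p * (2 * pi) :> R by rewrite !mulr_ge0// ltW.
apply: (le_lt_trans (integral_affine_le mD muD A0 (mulr_ge0 C0 Ck0) (fun t => powR_ge0 _ _) (mc _ a) (ha _ tp))).
exact: ltry.
Qed.

End Energy.

(** * Smooth test functions *)

Section Smooth.
Variable R : realType.
Notation P := (R * R)%type.

(* The family is closed under derivation up to linear combinations, see [is_derive_flat]. *)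
Definition flat (k : nat) (x : R) : R := if x <= 0 then 0 else x^-1 ^+ k * expR (- x^-1).

Lemma flat_le0 k x : x <= 0 -> flat k x = 0.
Proof. by rewrite /flat => ->. Qed.

Lemma flat_gt0E k x : 0 < x -> flat k x = x^-1 ^+ k * expR (- x^-1).
Proof. by rewrite /flat ltNge => /negbTE ->. Qed.

Lemma flat_ge0 k x : 0 <= flat k x.
Proof.
have [x0|x0] := leP x 0; first by rewrite flat_le0.
by rewrite flat_gt0E// mulr_ge0 ?expR_ge0// exprn_ge0// invr_ge0 ltW.
Qed.

Lemma flat_gt0 k x : 0 < x -> 0 < flat k x.
Proof. by move=> x0; rewrite flat_gt0E// mulr_gt0 ?expR_gt0// exprn_gt0// invr_gt0. Qed.

(** One term of the exponential series, exp(1/x) >= x^-(k+1) / (k+1)!. The linear bound yields the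
    limit at 0 on which differentiability there rests. *)
Lemma flat_le k x : flat k x <= (k.+1)`!%:R * `|x|.
Proof.
have [x0|x0] := leP x 0; first by rewrite flat_le0// mulr_ge0.
rewrite flat_gt0E// gtr0_norm// expRN.
have t0 : 0 < x^-1 by rewrite invr_gt0.
have h := @expR_ge1Dxn R x^-1 k (ltW t0).
have f0 : (0 : R) < (k.+1)`!%:R by rewrite ltr0n fact_gt0.
rewrite ler_pdivrMr ?expR_gt0//.
have {}h : x^-1 ^+ k.+1 <= (k.+1)`!%:R * expR x^-1.
  by rewrite mulrC -ler_pdivrMr//; apply: le_trans h; rewrite lerDr.
rewrite -(ler_pM2l t0) -exprS; apply: (le_trans h).
by rewrite [X in _ <= X](_ : _ = (k.+1)`!%:R * expR x^-1)//; field; rewrite gt_eqF.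
Qed.

Lemma is_derive_flat k (x : R) : is_derive x 1 (flat k) (flat k.+2 x - k%:R * flat k.+1 x).
Proof.
have [x0|x0|->] := ltgtP x 0.
- rewrite !flat_le0 ?(ltW x0)// mulr0 subrr.
  apply: (@near_eq_is_derive _ _ _ (cst 0)).
  near=> y; rewrite flat_le0//; apply: ltW; near: y; exact: lt_nbhsl.
- have xn0 : x != 0 by rewrite gt_eqF.
  have h1 : is_derive x 1 (fun y : R => y^-1) (- x ^- 2).
    have h : is_derive x 1 (id : R -> R) 1 by exact: is_derive_id.
    have := @is_deriveV R id x 1 1 xn0 h.
    by rewrite /GRing.scale /= mulr1.
  have h2 : is_derive x 1 (fun y : R => expR (- y^-1)) (expR (- x^-1) * x ^- 2).
    have hN : is_derive x 1 (fun y : R => - y^-1) (x ^- 2).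
      by have := is_deriveN h1; rewrite opprK.
    exact: (@is_derive1_comp _ expR (fun y : R => - y^-1) x _ _ (is_derive_expR _) hN).
  have h3 : is_derive x 1 (fun y : R => y^-1 ^+ k) (k%:R * x^-1 ^+ k.-1 * - x ^- 2).
    have h := is_deriveX k h1.
    have e : (fun y : R => y^-1) ^+ k = (fun y : R => y^-1 ^+ k) by exact: exprfctE.
    by rewrite -e; exact: h.
  have h4 : is_derive x 1 (fun y : R => y^-1 ^+ k * expR (- y^-1)) (flat k.+2 x - k%:R * flat k.+1 x).
    have h5 := is_deriveM h3 h2.
    apply: is_derive_eq; rewrite !flat_gt0E// /GRing.scale /=.
    rewrite -exprVn !exprS; case: k {h3 h5} => [|k] /=; rewrite ?expr0 ?mul0r ?mulr0 ?exprS; ring.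
  apply: near_eq_is_derive h4.
  near=> y; rewrite flat_gt0E//; near: y; exact: lt_nbhsr.
- rewrite !flat_le0// mulr0 subrr.
  have key : (fun h : R => h^-1 *: ((flat k \o shift 0) (h *: 1) - flat k 0)) @ 0^' --> (0 : R).
    (* At 0 the difference quotient of [flat k] is [flat k.+1] itself, so only the limit of the
       latter is needed. *)
    have -> : (fun h : R => h^-1 *: ((flat k \o shift 0) (h *: 1) - flat k 0)) = flat k.+1.
      apply/funext => h; rewrite (flat_le0 k (lexx 0)) subr0 /= addr0 /GRing.scale /= mulr1.
      have [h0|h0] := leP h 0; first by rewrite !flat_le0// mulr0.
      by rewrite !flat_gt0E// exprS mulrA.
    apply: cvg_within_filter.
    apply/cvgrPdist_lt => e e0; near=> h; rewrite sub0r normrN ger0_norm ?flat_ge0//.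
    apply: (le_lt_trans (flat_le _ _)).
    rewrite mulrC -ltr_pdivlMr ?ltr0n ?fact_gt0//.
    near: h; exists (e / (k.+2)`!%:R); first by rewrite /= divr_gt0// ltr0n fact_gt0.
    by move=> h /=; rewrite sub0r normrN.
  apply: DeriveDef; first by apply/cvg_ex; exists 0; exact: key.
  by apply: cvg_lim => //; exact: key.
Unshelve. all: by end_near. Qed.

(** A syntactic class closed under differentiation: derivatives of every order exist by induction
    and never have to be computed. *)
Inductive smooth1 : (R -> R) -> Prop :=
| smooth1_flat k a b : smooth1 (fun x => flat k (a * x + b))
| smooth1D f g : smooth1 f -> smooth1 g -> smooth1 (fun x => f x + g x)
| smooth1M f g : smooth1 f -> smooth1 g -> smooth1 (fun x => f x * g x)
| smooth1Z c f : smooth1 f -> smooth1 (fun x => c * f x)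
| smooth1V f : smooth1 f -> (forall x, f x != 0) -> smooth1 (fun x => (f x)^-1).

Lemma smooth1_derive f : smooth1 f -> exists2 f', smooth1 f' & forall x : R, is_derive x 1 f (f' x).
Proof.
elim=> [k a b|{}f g _ [f' sf df] _ [g' sg dg]|{}f g sf0 [f' sf df] sg0 [g' sg dg]|c {}f _ [f' sf df]|{}f sf0 [f' sf df] f0].
- exists (fun x => a * (flat k.+2 (a * x + b) + (- k%:R) * flat k.+1 (a * x + b))).
    by apply: smooth1Z; apply: smooth1D; [exact: smooth1_flat | apply: smooth1Z; exact: smooth1_flat].
  move=> x.
  have h1 : is_derive x 1 (fun x : R => a * x + b) a.
    have -> : (fun x : R => a * x + b) = a \*o id + cst b by apply/funext.
    by apply: is_derive_eq; rewrite addr0 /GRing.scale /= mulr1.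
  have := @is_derive1_comp _ (flat k) (fun x : R => a * x + b) x _ _ (is_derive_flat k _) h1.
  by move=> h; apply: is_derive_eq; rewrite mulrC mulNr.
- exists (fun x => f' x + g' x); first exact: smooth1D.
  by move=> x; exact: is_deriveD.
- exists (fun x => f x * g' x + g x * f' x).
    by apply: smooth1D; exact: smooth1M.
  by move=> x; exact: is_deriveM.
- exists (fun x => c * f' x); first exact: smooth1Z.
  by move=> x; have := is_deriveZ c (df x); exact.
- exists (fun x => (-1) * ((f x)^-1 * (f x)^-1) * f' x).
    apply: smooth1M => //; apply: smooth1Z; apply: smooth1M; exact: smooth1V.
  move=> x; have := is_deriveV (f0 x) (df x).
  by move=> h; apply: is_derive_eq; rewrite /GRing.scale /= -exprVn expr2 mulN1r.
Qed.

Definition step (x : R) : R := flat 0 x / (flat 0 x + flat 0 (1 - x)).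

Lemma step_den_gt0 x : 0 < flat 0 x + flat 0 (1 - x).
Proof.
have [x0|x0] := ltP 0 x; first by rewrite ltr_pwDl ?flat_gt0// flat_ge0.
by rewrite ltr_wpDl ?flat_ge0// flat_gt0// subr_gt0 (le_lt_trans x0).
Qed.

Lemma step_le0 x : x <= 0 -> step x = 0.
Proof. by move=> x0; rewrite /step flat_le0// mul0r. Qed.

Lemma step_ge1 x : 1 <= x -> step x = 1.
Proof.
move=> x1; rewrite /step [flat 0 (1 - x)]flat_le0 ?subr_le0// addr0 divff// gt_eqF// flat_gt0//.
exact: lt_le_trans x1.
Qed.

Lemma step_itv x : 0 <= step x <= 1.
Proof.
rewrite /step divr_ge0 ?flat_ge0 ?(ltW (step_den_gt0 x))//=.
by rewrite ler_pdivrMr ?step_den_gt0// mul1r lerDl flat_ge0.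
Qed.

Lemma smooth1_step_affine (a b : R) : smooth1 (fun x => step (a * x + b)).
Proof.
have e : forall x, 1 - (a * x + b) = (- a) * x + (1 - b) by move=> x; ring.
apply: smooth1M; first exact: smooth1_flat.
apply: (@smooth1V (fun x => flat 0 (a * x + b) + flat 0 (1 - (a * x + b)))); last first.
  by move=> x; rewrite gt_eqF// step_den_gt0.
apply: smooth1D; first exact: smooth1_flat.
under eq_fun do rewrite e.
exact: smooth1_flat.
Qed.

Lemma smooth1_continuous f : smooth1 f -> continuous f.
Proof.
move=> /smooth1_derive[f' _ df] x; apply: differentiable_continuous; apply/derivable1_diffP.
by have h := df x; exact: ex_derive.
Qed.

(** Outside [[0, 1]] the derivative vanishes because [step] is locally constant there, so its
    maximum over that interval bounds it everywhere. *)
Lemma step_derivative : exists (d : R -> R) (K : R), [/\ continuous d,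
  forall x : R, is_derive x 1 step (d x), forall x, `|d x| <= K &
  forall x, x < 0 \/ 1 < x -> d x = 0].
Proof.
have ss : smooth1 step.
  have := smooth1_step_affine 1 0; rewrite (_ : (fun x => step (1 * x + 0)) = step)//.
  by apply/funext => x; rewrite mul1r addr0.
have [d sd dd] := smooth1_derive ss; have cd := smooth1_continuous sd.
have c01 : {within `[0, 1], continuous (fun x => `|d x|)}.
  apply: continuous_subspaceT => x.
  have c : {for x, continuous (Num.norm \o d)}.
    by apply: continuous_comp; [exact: cd | exact: norm_continuous].
  exact: c.
have [c _ hc] := EVT_max (@ler01 R) c01.
have zero (y : R) : is_derive y 1 step 0 -> d y = 0.
  by move=> h; rewrite -(@derive_val _ _ _ y 1 step (d y) (dd y)) (@derive_val _ _ _ y 1 step 0 h).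
have d0 x : x < 0 \/ 1 < x -> d x = 0.
  move=> hx; apply: zero; case: hx => hx.
    apply: (@near_eq_is_derive _ _ _ (cst 0)).
    near=> y; rewrite step_le0//; apply: ltW; near: y; exact: lt_nbhsl.
  have e1 : is_derive x 1 (cst 1 : R -> R) 0 by exact: is_derive_cst.
  apply: near_eq_is_derive e1.
  near=> y; rewrite step_ge1//; apply: ltW; near: y; exact: lt_nbhsr.
exists d, `|d c|; split => // x.
have [x0|x0] := ltP x 0; first by rewrite d0 ?normr0//; left.
have [x1|x1] := ltP 1 x; first by rewrite d0 ?normr0//; right.
by apply: hc; rewrite in_itv /= x0 x1.
Unshelve. all: by end_near. Qed.

(** The same device in two variables. Sums and products of functions of one coordinate are enough,
    since all test functions used are tensor products. *)
Inductive smooth2 : (P -> R) -> Prop :=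
| smooth2_fst f : smooth1 f -> smooth2 (fun z => f z.1)
| smooth2_snd f : smooth1 f -> smooth2 (fun z => f z.2)
| smooth2D f g : smooth2 f -> smooth2 g -> smooth2 (fun z => f z + g z)
| smooth2M f g : smooth2 f -> smooth2 g -> smooth2 (fun z => f z * g z)
| smooth2Z c f : smooth2 f -> smooth2 (fun z => c * f z).

Lemma is_diff_fst (z : P) : is_diff z (fst : P -> R) (fst : P -> R).
Proof.
have l : linear (fst : P -> R) by move=> a u v.
pose lM := GRing.isLinear.Build _ _ _ _ _ l.
pose L : {linear _ -> _} := HB.pack (fst : P -> R) lM.
have c : continuous L by move=> x; exact: cvg_fst.
by apply: DiffDef; [exact: (@linear_differentiable _ _ _ L) | exact: (@diff_lin _ _ _ L)].
Qed.

Lemma is_diff_snd (z : P) : is_diff z (snd : P -> R) (snd : P -> R).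
Proof.
have l : linear (snd : P -> R) by move=> a u v.
pose lM := GRing.isLinear.Build _ _ _ _ _ l.
pose L : {linear _ -> _} := HB.pack (snd : P -> R) lM.
have c : continuous L by move=> x; exact: cvg_snd.
by apply: DiffDef; [exact: (@linear_differentiable _ _ _ L) | exact: (@diff_lin _ _ _ L)].
Qed.

(** The hypothesis [is_diff z l l] says that [l] is its own differential, as a coordinate projection
    is. *)
Lemma derive_comp_diff (f f' : R -> R) (l : P -> R) (z v : P) :
  (forall x : R, is_derive x 1 f (f' x)) -> is_diff z l l ->
  differentiable (fun z => f (l z)) z /\ 'D_v (fun z => f (l z)) z = l v * f' (l z).
Proof.
move=> df dl.
have fl : differentiable f (l z) by apply/derivable1_diffP; have h := df (l z); exact: ex_derive.
have ll : differentiable l z by exact: ex_diff.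
have dfl : differentiable (f \o l) z by exact: differentiable_comp.
split; first exact: dfl.
rewrite (deriveE v dfl) diff_comp//= diff_val.
have h := df (l z).
have -> : 'd f (l z) (l v) = l v *: 'd f (l z) 1.
  by rewrite -linearZ /= /GRing.scale /= mulr1.
by rewrite -deriveE// derive_val.
Qed.

Lemma smooth2_derive g : smooth2 g -> (forall z, differentiable g z) /\
  forall v, exists2 g', smooth2 g' & forall z, 'D_v g z = g' z.
Proof.
elim=> [f sf|f sf|{}g h _ [dg eg] _ [dh eh]|{}g h sg0 [dg eg] sh0 [dh eh]|c {}g _ [dg eg]].
- have [f' sf' df] := smooth1_derive sf.
  split=> [z|v]; first by have [] := derive_comp_diff 0 df (is_diff_fst z).
  exists (fun z => v.1 * f' z.1); first by apply: smooth2Z; exact: smooth2_fst.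
  by move=> z; have [] := derive_comp_diff v df (is_diff_fst z).
- have [f' sf' df] := smooth1_derive sf.
  split=> [z|v]; first by have [] := derive_comp_diff 0 df (is_diff_snd z).
  exists (fun z => v.2 * f' z.2); first by apply: smooth2Z; exact: smooth2_snd.
  by move=> z; have [] := derive_comp_diff v df (is_diff_snd z).
- split=> [z|v]; first exact: differentiableD.
  have [g' sg eg'] := eg v; have [h' sh eh'] := eh v.
  exists (fun z => g' z + h' z); first exact: smooth2D.
  by move=> z; rewrite -eg' -eh'; apply: deriveD; exact: diff_derivable.
- split=> [z|v]; first exact: differentiableM.
  have [g' sg eg'] := eg v; have [h' sh eh'] := eh v.
  exists (fun z => g z * h' z + h z * g' z).
    by apply: smooth2D; exact: smooth2M.
  by move=> z; rewrite -eg' -eh'; apply: deriveM; exact: diff_derivable.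
- split=> [z|v]; first exact: (@differentiableZ _ _ _ g c z).
  have [g' sg eg'] := eg v.
  exists (fun z => c * g' z); first exact: smooth2Z.
  by move=> z; rewrite -eg'; apply: (@deriveZ _ _ _ g c z v); exact: diff_derivable.
Qed.

Lemma smooth2_smooth g : smooth2 g -> smooth g.
Proof.
move=> sg vs; suff [g' sg' ->] : exists2 g', smooth2 g' & iter_deriv vs g = g'.
  by have [] := smooth2_derive sg'.
elim: vs => [|v vs [g' sg' /= ->]]; first by exists g.
have [_ /(_ v)[g2 sg2 e]] := smooth2_derive sg'.
by exists g2 => //; apply/funext.
Qed.

Lemma derive_tensor (f g f' g' : R -> R) (z : P) :
  (forall x : R, is_derive x 1 f (f' x)) -> (forall x : R, is_derive x 1 g (g' x)) ->
  'D_(e1 R) (fun z : P => f z.1 * g z.2) z = f' z.1 * g z.2 /\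
  'D_(e2 R) (fun z : P => f z.1 * g z.2) z = f z.1 * g' z.2.
Proof.
move=> df dg.
have key v : 'D_v (fun z : P => f z.1 * g z.2) z = f z.1 * (v.2 * g' z.2) + g z.2 * (v.1 * f' z.1).
  have [d1 <-] := derive_comp_diff v df (is_diff_fst z).
  have [d2 <-] := derive_comp_diff v dg (is_diff_snd z).
  by apply: deriveM; exact: diff_derivable.
by split; rewrite key /=; ring.
Qed.

(** A smooth approximation of the indicator of []c, d]], which is its pointwise limit as [n] grows.
    As a difference of two translates of one transition function, it has a derivative made of two
    opposite bumps, next to [c] and next to [d]. *)
Definition plateau (n c d x : R) : R := step (n * (x - c)) - step (n * (x - d)).

Lemma smooth1_plateau n c d : smooth1 (plateau n c d).
Proof.
have -> : plateau n c d = (fun x => step (n * x + - (n * c)) + -1 * step (n * x + - (n * d))).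
  by apply/funext => x; rewrite /plateau !mulrBr mulN1r.
by apply: smooth1D; [|apply: smooth1Z]; exact: smooth1_step_affine.
Qed.

Lemma plateau_eq0 n c d x : 0 < n -> c <= d -> x <= c \/ d + n^-1 <= x -> plateau n c d x = 0.
Proof.
move=> n0 cd [h|h]; rewrite /plateau.
  by rewrite !step_le0 ?subrr// pmulr_rle0// subr_le0// (le_trans h).
have v0 : 0 < n^-1 by rewrite invr_gt0.
rewrite !step_ge1 ?subrr//; rewrite -[X in X <= _](divff (lt0r_neq0 n0)) ler_pM2l//; lra.
Qed.

Lemma plateau_le1 n c d x : `|plateau n c d x| <= 1.
Proof.
rewrite /plateau; have /andP[a b] := step_itv (n * (x - c)); have /andP[a' b'] := step_itv (n * (x - d)).
by rewrite ler_norml; apply/andP; split; lra.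
Qed.

Lemma test_fun_plateau (U : set P) (n c d k s t : R) : 0 < n -> 0 < k -> c <= d -> s <= t ->
  (forall z : P, c <= z.1 <= d + n^-1 -> s <= z.2 <= t + k^-1 -> U z) ->
  test_fun U (fun z : P => plateau n c d z.1 * plateau k s t z.2).
Proof.
move=> n0 k0 cd st hU; split.
  apply: smooth2_smooth; apply: smooth2M.
    by apply: smooth2_fst; exact: smooth1_plateau.
  by apply: smooth2_snd; exact: smooth1_plateau.
exists ([set` `[c, d + n^-1]] `*` [set` `[s, t + k^-1]]); split.
- by apply: compact_setX; exact: segment_compact.
- by move=> z [/=]; rewrite !in_itv /=; exact: hU.
move=> z; rewrite /setX /= !in_itv /= => h.
have [a|a] := leP z.1 c; first by rewrite (plateau_eq0 n0 cd (or_introl a)) mul0r.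
have [b|b] := leP (d + n^-1) z.1; first by rewrite (plateau_eq0 n0 cd (or_intror b)) mul0r.
have [a'|a'] := leP z.2 s; first by rewrite (plateau_eq0 k0 st (or_introl a')) mulr0.
have [b'|b'] := leP (t + k^-1) z.2; first by rewrite (plateau_eq0 k0 st (or_intror b')) mulr0.
by exfalso; apply: h; rewrite !ltW.
Qed.

End Smooth.

(** * Variation of Sobolev functions along lines *)

Section Slices.
Variable R : realType.
Notation P := (R * R)%type.
Notation mu := (@lebesgue_measure R).

Lemma ae_impl (Q S : R -> Prop) : (forall x, Q x -> S x) ->
  {ae mu, forall x, Q x} -> {ae mu, forall x, S x}.
Proof.
by move=> QS; apply: filterS; first exact: (ae_filter_ringOfSetsType mu).
Qed.

Lemma ae_impl2 (Q1 Q2 S : R -> Prop) : (forall x, Q1 x -> Q2 x -> S x) ->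
  {ae mu, forall x, Q1 x} -> {ae mu, forall x, Q2 x} -> {ae mu, forall x, S x}.
Proof.
by move=> QS; apply: filterS2; first exact: (ae_filter_ringOfSetsType mu).
Qed.

Lemma step_scale_cvg (x c : R) :
  step (n%:R * (x - c)) @[n --> \oo] --> ((if c < x then 1 else 0) : R).
Proof.
case: ifPn => [cx|]; last first.
  rewrite -leNgt => xc; apply: cvg_near_cst; apply: nearW => n.
  by rewrite step_le0// mulr_ge0_le0// subr_le0.
apply: cvg_near_cst; near=> n; apply: step_ge1.
have d0 : 0 < x - c by rewrite subr_gt0.
rewrite -ler_pdivrMr// div1r.
by near: n; exact: nbhs_infty_ger.
Unshelve. all: by end_near. Qed.

Lemma measurable_plateau (n c d : R) : measurable_fun [set: R] (plateau n c d).
Proof. by apply: continuous_measurable_fun; apply: smooth1_continuous; exact: smooth1_plateau. Qed.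

(** Dominated convergence with majorant |F|, since plateau functions are bounded by 1. *)
Lemma integral_itv_eq0 (F : R -> R) (A B c d : R) : mu.-integrable setT (EFin \o F) ->
  (forall n c d : R, 0 < n -> c <= d -> A <= c -> d + n^-1 <= B ->
     (\int[mu]_x (plateau n c d x * F x)%:E = 0)%E) ->
  A <= c -> c <= d -> d < B -> (\int[mu]_(x in `]c, d]) (F x)%:E = 0)%E.
Proof.
move=> iF hF Ac cd dB.
have mF : measurable_fun setT F by apply/measurable_EFinP; exact: measurable_int iF.
pose f_ (n : nat) (x : R) : \bar R := (plateau n%:R c d x * F x)%:E.
pose f (x : R) : \bar R := ((EFin \o F) \_ [set` `]c, d]]) x.
have mf : measurable_fun setT f.
  apply/(measurable_restrictT _ (measurable_itv _)).
  by apply: measurable_funS (@measurableT _ R) (@subsetT _ _) _; exact/measurable_EFinP.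
have := @dominated_convergence _ _ _ mu setT measurableT f_ f (fun x => `|F x|%:E) _ mf _ _ _.
case.
- move=> n; apply/measurable_EFinP; apply: measurable_funM => //; exact: measurable_plateau.
- apply: aeW => x _; rewrite /f_ /f patchE.
  have -> : (if x \in [set` `]c, d]] then (EFin \o F) x else 0%E) =
    (((if c < x then 1 else 0) - (if d < x then 1 else 0)) * F x)%:E.
    have e : (x \in [set` `]c, d]]) = (c < x <= d) by apply/idP/idP; rewrite inE /= in_itv.
    rewrite e; have [cx|cx] := ltP c x; have [dx|dx] := ltP d x => /=; rewrite ?subrr ?subr0 ?mul0r ?mul1r//.
    by move: (lt_le_trans dx cx); rewrite ltNge cd.
  apply: cvg_EFin; first exact: nearW.
  by apply: cvgM; [apply: cvgB; exact: step_scale_cvg | exact: cvg_cst].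
- by apply/integrable_norm.
- apply: aeW => x n _; rewrite /f_ lee_fin normrM -[X in _ <= X]mul1r ler_wpM2r//.
  exact: plateau_le1.
move=> _ _ /=.
have -> : (\int[mu]_x f x = \int[mu]_(x in `]c, d]) (F x)%:E)%E by rewrite [RHS]integral_mkcond.
move=> h; symmetry; apply: cvg_unique h => //=.
apply: cvg_near_cst; near=> n.
have n0 : (0 : R) < n%:R by rewrite ltr0n; near: n; exact: nbhs_infty_gt.
apply: hF => //.
(* The plateau overhangs [d] by 1/n; the strict inequality d < B leaves room for it once [n] is
   large. *)
have : n%:R^-1 <= B - d.
  rewrite -[B - d]invrK lef_pV2 ?posrE ?invr_gt0 ?subr_gt0//.
  by near: n; exact: nbhs_infty_ger.
lra.
Unshelve. all: by end_near. Qed.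

(** By Lebesgue differentiation [F] is almost everywhere the derivative of its primitive from [A],
    and this primitive vanishes up to [B]. *)
Lemma ae_eq0_of_itv (F : R -> R) (A B : R) : mu.-integrable setT (EFin \o F) ->
  (forall d, A <= d -> d < B -> (\int[mu]_(x in `]A, d]) (F x)%:E = 0)%E) ->
  {ae mu, forall x, A < x < B -> F x = 0}.
Proof.
move=> iF hF.
have iS (y : R) : mu.-integrable [set` Interval (BLeft A) (BRight y)] (EFin \o F).
  by apply: integrableS iF => //; exact: measurable_itv.
have lF : locally_integrable [set: R] F by apply: open_integrable_locally => //; exact: openT.
move: (FTC1 iS lF); apply: filterS; first exact: (ae_filter_ringOfSetsType mu).
move=> x /= h /andP[Ax xB].
have /h[dG <-] : (A%:E < x%:E)%E by rewrite lte_fin.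
set G := fun x : R => _.
have Gx y : A <= y -> y < B -> G y = 0.
  move=> Ay yB; rewrite /G /Rintegral -integral_itv_obnd_cbnd ?hF//.
  by apply: measurable_funS (measurable_int _ iF).
rewrite derive1E.
have D0 : is_derive x 1 G 0.
  have e1 : is_derive x 1 (cst 0 : R -> R) 0 by exact: is_derive_cst.
  apply: near_eq_is_derive e1.
  near=> y; rewrite Gx//; first by apply: ltW; near: y; exact: lt_nbhsr.
  near: y; exact: lt_nbhsl.
by rewrite (@derive_val _ _ _ x 1 G 0 D0).
Unshelve. all: by end_near. Qed.

(* Du Bois-Reymond's lemma, tested against plateau functions only. *)
Lemma plateau_ae_eq0 (F : R -> \bar R) (A B : R) : mu.-integrable setT F ->
  (forall n c d : R, 0 < n -> c <= d -> A <= c -> d + n^-1 <= B ->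
     (\int[mu]_x ((plateau n c d x)%:E * F x) = 0)%E) ->
  {ae mu, forall x, A < x < B -> F x = 0%E}.
Proof.
move=> iF hF.
have mF := measurable_int _ iF.
have fF : {ae mu, forall x, F x = ((fine (F x))%:E)}.
  have := integrable_ae measurableT iF; apply: filterS => x /= /(_ I) h.
  by rewrite fineK.
have iF' : mu.-integrable setT (EFin \o (fine \o F)).
  apply: le_integrable iF => //.
    by apply/measurable_EFinP; exact: measurableT_comp.
  by move=> x _ /=; case: (F x) => [r| |] //=; rewrite ?normr0 ?leey.
have key : {ae mu, forall x, A < x < B -> (fine \o F) x = 0}.
  apply: ae_eq0_of_itv => // d Ad dB; apply: (@integral_itv_eq0 _ A B) => //.
  move=> n c d' n0 cd Ac dB'; rewrite -[RHS](hF n c d')//.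
  apply: ae_eq_integral => //.
  - apply/measurable_EFinP; apply: measurable_funM; first exact: measurable_plateau.
    by apply/measurable_EFinP; exact: measurable_int iF'.
  - by apply: emeasurable_funM => //; apply/measurable_EFinP; exact: measurable_plateau.
  - by apply: (ae_impl _ fF) => x e _; rewrite [in RHS]e EFinM.
by apply: (ae_impl2 _ key fF) => x h e /h; rewrite e /= => ->.
Qed.

(* [b = true] stands for vertical lines: [a] is the fixed coordinate and [s] the running one. *)
Definition pt (b : bool) (a s : R) : P := if b then (a, s) else (s, a).
Definition across (b : bool) (z : P) : R := if b then z.1 else z.2.
Definition along (b : bool) (z : P) : R := if b then z.2 else z.1.

Lemma across_pt b a s : across b (pt b a s) = a.
Proof. by case: b. Qed.

Lemma along_pt b a s : along b (pt b a s) = s.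
Proof. by case: b. Qed.

Lemma measurable_across (b : bool) : measurable_fun [set: P] (across b).
Proof. by case: b; [exact: measurable_fst | exact: measurable_snd]. Qed.

Lemma measurable_along (b : bool) : measurable_fun [set: P] (along b).
Proof. by case: b; [exact: measurable_snd | exact: measurable_fst]. Qed.

(** For horizontal lines the coordinates are exchanged, and integrability is transferred through the
    iterated integrals taken in the other order. *)
Lemma integrable_pt (b : bool) (k : P -> \bar R) : (@leb2 R).-integrable setT k ->
  (@leb2 R).-integrable setT (fun z : P => k (pt b z.1 z.2)).
Proof.
case: b => ik; first by rewrite (_ : (fun z : P => _) = k)//; apply/funext => -[].
have mk := measurable_int _ ik.
apply/integrable12ltyP; last exact: (integrable21ltyP _ _ mk).1.
have h : measurable_fun setT (fun z : P => (z.2, z.1)).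
  by apply: measurable_fun_pair; [exact: measurable_snd | exact: measurable_fst].
exact: (measurableT_comp mk h).
Qed.

Lemma slice_integrable (b : bool) (k : P -> \bar R) : (@leb2 R).-integrable setT k ->
  {ae mu, forall a, mu.-integrable setT (fun s => k (pt b a s))}.
Proof. by move=> /(integrable_pt b) ik; exact: (ae_integrable1 ik). Qed.

Lemma integrable_slice (b : bool) (k : P -> \bar R) : (@leb2 R).-integrable setT k ->
  mu.-integrable setT (fun a => \int[mu]_s k (pt b a s))%E.
Proof. by move=> /(integrable_pt b) ik; exact: (integrable_fubini_F ik). Qed.

Lemma integral_slice (b : bool) (k : P -> \bar R) : (@leb2 R).-integrable setT k ->
  (\int[mu]_a \int[mu]_s k (pt b a s) = \int[@leb2 R]_z k z)%E.
Proof.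
by case: b => ik; [exact: (integral12_prod_meas1 ik) | exact: (integral21_prod_meas1 ik)].
Qed.

(** By Fubini a factor depending on [across] only leaves the inner integral, so the slice integral,
    as a function of [a], is orthogonal to all plateau functions and the one-dimensional lemma
    applies. *)
Lemma slice_ae_eq0 (b : bool) (k : P -> \bar R) (A B : R) : (@leb2 R).-integrable setT k ->
  (forall n c d : R, 0 < n -> c <= d -> A <= c -> d + n^-1 <= B ->
     (\int[@leb2 R]_z ((plateau n c d (across b z))%:E * k z) = 0)%E) ->
  {ae mu, forall a, A < a < B -> (\int[mu]_s k (pt b a s) = 0)%E}.
Proof.
move=> ik hk; have mk := measurable_int _ ik.
have mb n c d : measurable_fun setT (fun z : P => plateau n c d (across b z)).
  apply: (@measurableT_comp _ _ _ _ _ _ (plateau n c d)); first exact: measurable_plateau.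
  exact: measurable_across.
have ikn n c d : (@leb2 R).-integrable setT (fun z => ((plateau n c d (across b z))%:E * k z)%E).
  apply: le_integrable ik => //.
    by apply: emeasurable_funM => //; apply/measurable_EFinP; exact: mb.
  move=> z _; rewrite abseM /= -[X in (_ <= X)%E]mul1e lee_wpmul2r// lee_fin.
  exact: plateau_le1.
have zl (x : R) (g : R -> \bar R) : mu.-integrable setT g -> (\int[mu]_s (x%:E * g s) = x%:E * \int[mu]_s g s)%E.
  by move=> ig; exact: integralZl.
apply: plateau_ae_eq0.
  exact: integrable_slice.
move=> n c d n0 cd Ac dB; rewrite -[RHS](hk n c d n0 cd Ac dB).
have as_ := slice_integrable b ik.
have eqae : ae_eq mu setT (fun a => (plateau n c d a)%:E * \int[mu]_s k (pt b a s))%E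
     (fun a => \int[mu]_s ((plateau n c d a)%:E * k (pt b a s)))%E.
  by apply: (ae_impl _ as_) => a ia _; rewrite zl.
transitivity (\int[mu]_a \int[mu]_s ((plateau n c d a)%:E * k (pt b a s)))%E.
  apply: ae_eq_integral => //.
    apply: emeasurable_funM; first by apply/measurable_EFinP; exact: measurable_plateau.
    exact: (measurable_int _ (integrable_slice b ik)).
  rewrite (_ : (fun a => _) = (fun a => \int[mu]_s ((plateau n c d (across b (pt b a s)))%:E * k (pt b a s)))%E).
    exact: (measurable_int _ (integrable_slice b (ikn n c d))).
  by apply/funext => a; apply: eq_integral => s _; rewrite across_pt.
rewrite -(integral_slice b (ikn n c d)).
by apply: eq_integral => a _; apply: eq_integral => s _; rewrite across_pt.
Qed.

Lemma norm_le_of_close (X1 X2 X3 v w J k e : R) : `|X1 - v| <= k -> `|X2 - w| <= k -> `|X3| <= J ->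
  0 = X1 - X2 + X3 -> k <= e / 2 -> `|w - v| <= J + e.
Proof.
rewrite !ler_norml => /andP[? ?] /andP[? ?] /andP[? ?] ? ?.
by apply/andP; split; lra.
Qed.

(** * Increments of a function on an interval from its weak derivative *)

Section Variation.
Variables (d : R -> R) (K : R).
Hypothesis cd : continuous d.
Hypothesis dstep : forall x : R, is_derive x 1 (@step R) (d x).
Hypothesis dK : forall x, `|d x| <= K.
Hypothesis d0 : forall x, x < 0 \/ 1 < x -> d x = 0.

(** The derivative of the rescaled [step]: an averaging kernel of integral 1 carried by
    [[c, c + 1/n]]. *)
Definition bump_at (n c y : R) : R := n * d (n * (y - c)).

Lemma continuous_bump_at n c : continuous (bump_at n c).
Proof.
move=> y; apply: cvgM; first exact: cvg_cst.
have h : {for y, continuous (d \o (fun y : R => n * (y - c)))}.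
  apply: continuous_comp; last exact: cd.
  by apply: cvgM; [exact: cvg_cst | apply: cvgB; [exact: cvg_id | exact: cvg_cst]].
exact: h.
Qed.

Lemma is_derive_step_at (n c y : R) : is_derive y 1 (fun y : R => step (n * (y - c))) (bump_at n c y).
Proof.
have h1 : is_derive y 1 (fun t : R => n * (t - c)) n.
  have -> : (fun t : R => n * (t - c)) = n \*o (id - cst c) by apply/funext.
  by apply: is_derive_eq; rewrite subr0 /GRing.scale /= mulr1.
have := @is_derive1_comp _ (@step R) (fun t : R => n * (t - c)) y _ _ (dstep _) h1.
by rewrite /bump_at mulrC.
Qed.

Lemma is_derive_plateau (n c c' y : R) : is_derive y 1 (plateau n c c') (bump_at n c y - bump_at n c' y).
Proof. by apply: is_deriveB; exact: is_derive_step_at. Qed.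

Lemma bump_at_le n c y : 0 < n -> `|bump_at n c y| <= n * K.
Proof. by move=> n0; rewrite normrM gtr0_norm// ler_pM2l. Qed.

Lemma bump_at_eq0 n c y : 0 < n -> y < c \/ c + n^-1 < y -> bump_at n c y = 0.
Proof.
move=> n0 h; rewrite /bump_at d0 ?mulr0//; case: h => h; [left|right].
  by rewrite pmulr_rlt0// subr_lt0.
by rewrite mulrC -ltr_pdivrMr// div1r; lra.
Qed.

(** The kernel has integral 1 by the fundamental theorem. Its size is at most n K on an interval of
    length 1/n, so an oscillation [e] of [f] there costs at most K e. *)
Lemma average_close (f : R -> R) (n t T c v e : R) : 0 < n -> t < T -> t <= c -> c + n^-1 <= T ->
  (forall y, t <= y <= T -> {for y, continuous f}) -> 0 <= e ->
  (forall y, c <= y <= c + n^-1 -> `|f y - v| <= e) ->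
  mu.-integrable `[t, T] (fun y => (f y * bump_at n c y)%:E) /\
  `|\int[mu]_(y in `[t, T]) (f y * bump_at n c y) - v| <= K * e.
Proof.
move=> n0 tT tc cT cf e0 fe.
have K0 : 0 <= K by exact: le_trans (normr_ge0 _) (dK 0).
have ci (g : R -> R) : (forall y, t <= y <= T -> {for y, continuous g}) ->
    mu.-integrable `[t, T] (EFin \o g).
  move=> cg; apply: continuous_compact_integrable; first exact: segment_compact.
  by apply: continuous_in_subspaceT => y /set_mem /=; rewrite in_itv /=; exact: cg.
have i1 : mu.-integrable `[t, T] (EFin \o (fun y => f y * bump_at n c y)).
  by apply: ci => y hy; apply: cvgM; [exact: cf | exact: continuous_bump_at].
have i2 : mu.-integrable `[t, T] (EFin \o (fun y => v * bump_at n c y)).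
  by apply: ci => y hy; apply: cvgM; [exact: cvg_cst | exact: continuous_bump_at].
split; first exact: i1.
have ev : \int[mu]_(y in `[t, T]) (v * bump_at n c y) = v.
  have D1 y : t <= y <= T -> is_derive y 1 (fun y => v * step (n * (y - c))) (v * bump_at n c y).
    by move=> _; have := is_deriveZ v (is_derive_step_at n c y); exact.
  have D2 y : t <= y <= T -> {for y, continuous (fun y => v * bump_at n c y)}.
    by move=> _; apply: cvgM; [exact: cvg_cst | exact: continuous_bump_at].
  rewrite /Rintegral (FTC2_closed tT D1 D2) /= step_ge1; last by rewrite mulrC -ler_pdivrMr// div1r; lra.
  by rewrite step_le0 ?mulr1 ?mulr0 ?subr0//= pmulr_rle0// subr_le0.
rewrite -[X in `|_ - X|]ev -RintegralB//.
have i3 : mu.-integrable `[t, T] (EFin \o (fun y => f y * bump_at n c y - v * bump_at n c y)).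
  by have := @integrableB _ _ _ mu _ (measurable_itv _) _ _ i1 i2; exact.
apply: (le_trans (le_normr_Rintegral _ i3)) => //.
have v0 : 0 < n^-1 by rewrite invr_gt0.
(* The error integrand is dominated by a constant on the support of the bump and by 0 elsewhere. *)
pose g := (fun y : R => (e * (n * K))%:E) \_ [set` `[c, c + n^-1]].
have mg : measurable_fun setT g.
  by apply/(measurable_restrictT _ (measurable_itv _)); exact: measurable_cst.
have c0 : 0 <= e * (n * K) by rewrite !mulr_ge0// ltW.
have g0 y : (0 <= g y)%E by apply: erestrict_ge0 => *; rewrite lee_fin.
rewrite -lee_fin /Rintegral fineK; last first.
  apply: integrable_fin_num => //; exact: integrable_norm i3.
apply: (@le_trans _ _ (\int[mu]_(y in `[t, T]) g y)%E).
  apply: le_integral_ge0 => y _; first by rewrite lee_fin.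
  rewrite -mulrBl normrM /g patchE; case: ifPn.
    rewrite inE /= in_itv /= => hy; rewrite lee_fin; apply: ler_pM => //; first exact: fe.
    exact: bump_at_le.
  rewrite notin_setE /= in_itv /= => hy; rewrite bump_at_eq0 ?normr0 ?mulr0//.
  have [yc|yc] := ltP y c; first by left.
  by right; rewrite ltNge; apply/negP => h; apply: hy; rewrite yc.
apply: (@le_trans _ _ (\int[mu]_y g y)%E).
  apply: ge0_subset_integral => //; exact: measurable_itv.
rewrite -integral_mkcond integral_cst//= lebesgue_measure_itv /= lte_fin ltrDl v0.
rewrite -EFinB -EFinM lee_fin addrAC subrr add0r.
by rewrite [X in X <= _](_ : _ = K * e)//; field; rewrite gt_eqF.
Qed.

(** Tested against a plateau, the weak identity equates, up to sign, the difference of two averages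
    of [f], near [s] and near [s'], with the integral of [g] against a function bounded by 1.
    Rational endpoints keep the family of tests countable, so that one null set of lines serves for
    all of them. *)
Lemma variation_le (f g : R -> R) (s s' : R) : s < s' ->
  (forall y, s <= y <= s' -> {for y, continuous f}) ->
  mu.-integrable `[s, s'] (EFin \o g) ->
  (forall (n : nat) (q1 q2 : rat), s < ratr q1 -> q1 < q2 -> ratr q2 + n.+1%:R^-1 < s' ->
    (\int[mu]_(y in `[ratr q1, (ratr q2 + n.+1%:R^-1)%R])
      (f y * (bump_at n.+1%:R (ratr q1) y - bump_at n.+1%:R (ratr q2) y) +
       g y * plateau n.+1%:R (ratr q1) (ratr q2) y)%:E = 0)%E) ->
  ((`|f s' - f s|)%:E <= \int[mu]_(y in `[s, s']) (`|g y|)%:E)%E.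
Proof.
move=> ss' cf ig hz.
have K0 : 0 <= K by exact: le_trans (normr_ge0 _) (dK 0).
have ign := integrable_norm ig.
have If : (\int[mu]_(y in `[s, s']) (`|g y|)%:E)%E \is a fin_num.
  by apply: integrable_fin_num => //; exact: measurable_itv.
rewrite -(fineK If) lee_fin.
apply/ler_addgt0Pr => e e0.
(* Each average costs K e', hence at most e / 2; the summand 1 keeps the denominator positive. *)
pose e' := e / (2 * (K + 1)).
have K1 : 0 < 2 * (K + 1) by lra.
have e'0 : 0 < e' by rewrite divr_gt0.
have near_c x : s <= x <= s' -> exists2 r, 0 < r & forall y, `|y - x| < r -> `|f y - f x| <= e'.
  move=> /cf/cvgrPdist_le/(_ _ e'0) [r r0 hr]; exists r => // y yx.
  by rewrite distrC; apply: hr; rewrite /= distrC.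
have [r1 r10 h1] : exists2 r, 0 < r & forall y, `|y - s| < r -> `|f y - f s| <= e'.
  by apply: near_c; rewrite lexx ltW.
have [r2 r20 h2] : exists2 r, 0 < r & forall y, `|y - s'| < r -> `|f y - f s'| <= e'.
  by apply: near_c; rewrite lexx ltW.
pose r := Num.min (Num.min r1 r2) ((s' - s) / 2) / 2.
have r0 : 0 < r by rewrite divr_gt0// !lt_min r10 r20 divr_gt0// subr_gt0.
have [rr1 rr2 rr3] : [/\ r * 2 <= r1, r * 2 <= r2 & r * 2 <= (s' - s) / 2].
  by rewrite /r divfK//; split; rewrite !ge_min lexx ?orbT.
clearbody r.
have [n _ hn] := near_infty_natSinv_lt (PosNum r0).
have {hn} := hn n (leqnn n) => /= nr.
have n0 : (0 : R) < n.+1%:R by [].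
have [N NE] : exists N : R, N = n.+1%:R by exists n.+1%:R.
rewrite -NE in nr n0.
have Ninv : 0 < N^-1 by rewrite invr_gt0.
have [q1 hq1] : exists q : rat, ratr q \in `]s, (s + N^-1)[ by apply: rat_in_itvoo; rewrite ltrDl.
(* The falling edge occupies [[q2, q2 + 1/N]]: it must end before [s'] and yet stay within 2/N of
   it. *)
have [q2 hq2] : exists q : rat, ratr q \in `](s' - 2 * N^-1), (s' - N^-1)[ by apply: rat_in_itvoo; lra.
move: hq1 hq2; rewrite !in_itv /= => /andP[a1 a2] /andP[b1 b2].
have q12 : q1 < q2 by rewrite -(ltr_rat R); lra.
have qT : ratr q2 + N^-1 < s' by lra.
have := hz n q1 q2 a1 q12; rewrite -NE => /(_ qT).
set c1 : R := ratr q1 in a1 a2 *; set c2 : R := ratr q2 in b1 b2 qT *; set T := c2 + N^-1.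
have cc : c1 < c2 by rewrite /c1 /c2 ltr_rat.
have c1T : c1 < T by rewrite /T; lra.
have cf' y : c1 <= y <= T -> {for y, continuous f}.
  by move=> /andP[y1 y2]; apply: cf; rewrite (le_trans (ltW a1) y1) (le_trans y2 (ltW qT)).
have [i1 A1] : mu.-integrable `[c1, T] (fun y => (f y * bump_at N c1 y)%:E) /\
    `|\int[mu]_(y in `[c1, T]) (f y * bump_at N c1 y) - f s| <= K * e'.
  apply: average_close => //; [by rewrite /T; lra | exact: ltW|].
  move=> y /andP[y1 y2]; apply: h1; rewrite ltr_norml; clear -y1 y2 a1 a2 nr rr1 Ninv; apply/andP; split; lra.
have [i2 A2] : mu.-integrable `[c1, T] (fun y => (f y * bump_at N c2 y)%:E) /\
    `|\int[mu]_(y in `[c1, T]) (f y * bump_at N c2 y) - f s'| <= K * e'.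
  apply: average_close => //; [exact: ltW | exact: ltW|].
  move=> y /andP[y1 y2]; apply: h2; rewrite ltr_norml; clear -y1 y2 b1 b2 nr rr2 Ninv; apply/andP; split; lra.
have sub : ([set` `[c1, T]] : set R) `<=` [set` `[s, s']].
  by move=> y /=; rewrite !in_itv /= => /andP[y1 y2]; rewrite (le_trans (ltW a1) y1) (le_trans y2 (ltW qT)).
have mcT : measurable ([set` `[c1, T]] : set R) by exact: measurable_itv.
have mss : measurable ([set` `[s, s']] : set R) by exact: measurable_itv.
have ig' : mu.-integrable `[c1, T] (EFin \o g) by exact: integrableS ig.
have mg' : measurable_fun [set` `[c1, T]] g by apply/measurable_EFinP; exact: measurable_int ig'.
have i3 : mu.-integrable `[c1, T] (EFin \o (fun y => g y * plateau N c1 c2 y)).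
  apply: le_integrable ig' => //.
    apply/measurable_EFinP; apply: measurable_funM => //.
    by apply: measurable_funS (@measurableT _ R) (@subsetT _ _) _; exact: measurable_plateau.
  by move=> y _ /=; rewrite lee_fin normrM ler_piMr// plateau_le1.
have i12 : mu.-integrable `[c1, T] (EFin \o (fun y => f y * bump_at N c1 y - f y * bump_at N c2 y)).
  by have := @integrableB _ _ _ mu _ mcT _ _ i1 i2; exact.
have e12 : \int[mu]_(y in `[c1, T]) (f y * (bump_at N c1 y - bump_at N c2 y) + g y * plateau N c1 c2 y) =
    \int[mu]_(y in `[c1, T]) (f y * bump_at N c1 y) - \int[mu]_(y in `[c1, T]) (f y * bump_at N c2 y)
    + \int[mu]_(y in `[c1, T]) (g y * plateau N c1 c2 y).
  rewrite -RintegralB// -RintegralD//; apply: eq_Rintegral => y _; ring.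
move=> hz0; move: e12; rewrite {1}/Rintegral hz0 /= => e12.
have A3 : `|\int[mu]_(y in `[c1, T]) (g y * plateau N c1 c2 y)| <= fine (\int[mu]_(y in `[s, s']) (`|g y|)%:E)%E.
  apply: (le_trans (le_normr_Rintegral _ i3)) => //.
  apply: fine_le => //.
    by apply: integrable_fin_num => //; exact: integrable_norm i3.
  apply: (@le_trans _ _ (\int[mu]_(y in `[c1, T]) (`|g y|)%:E)%E).
    apply: le_integral_ge0 => y _; first by rewrite lee_fin.
    by rewrite lee_fin normrM ler_piMr// plateau_le1.
  apply: ge0_subset_integral => //.
  exact: (measurable_int _ ign).
have eK : K * e' <= e / 2.
  by rewrite /e' mulrCA ler_pM2l// ler_pdivrMr// mulKf// lerDl.
exact: norm_le_of_close A1 A2 A3 e12 eK.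
Qed.

End Variation.

Lemma ae_countable (I : countType) (Q : I -> R -> Prop) : (forall i, {ae mu, forall a, Q i a}) ->
  {ae mu, forall a, forall i, Q i a}.
Proof.
move=> h.
have : {ae mu, forall a, forall n, if unpickle n is Some i then Q i a else True}.
  by apply: ae_foralln => n; case: unpickle => [i|]; [exact: h | exact: aeW].
by apply: ae_impl => a hn i; have := hn (pickle i); rewrite pickleK.
Qed.

Definition dir (b : bool) : P := if b then e2 R else e1 R.

Lemma disk_pt b a s : disk (pt b a s) <-> a ^+ 2 + s ^+ 2 < 1.
Proof. by case: b; rewrite /disk /= // addrC. Qed.

Lemma measurable_disk : measurable (@disk R).
Proof.
rewrite (_ : @disk R = setT `&` (fun z : P => z.1 ^+ 2 + z.2 ^+ 2) @^-1` [set` `]-oo, 1[]); last first.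
  by apply/seteqP; split => z /=; rewrite in_itv /=; [split | case].
have h : measurable_fun setT (fun z : P => z.1 ^+ 2 + z.2 ^+ 2).
  by apply: measurable_funD; apply: measurable_funX; [exact: measurable_fst | exact: measurable_snd].
by apply: h => //; exact: measurable_itv.
Qed.

Lemma leb2_disk_lty : (@leb2 R (@disk R) < +oo)%E.
Proof.
have mI : measurable ([set` `[-1, 1]] : set R) by exact: measurable_itv.
apply: (@le_lt_trans _ _ (@leb2 R ([set` `[-1, 1]] `*` [set` `[-1, 1]]))).
  apply: le_measure; rewrite ?inE; [exact: measurable_disk | exact: measurableX |].
  move=> z /=; rewrite /disk /= !in_itv /= => h.
  have h1 := sqr_ge0 z.1; have h2 := sqr_ge0 z.2.
  by split; apply/andP; split; nra.
rewrite /leb2 product_measure1E//= lebesgue_measure_itv /= lte_fin.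
by case: ifP => _; rewrite -?EFinB -?EFinM ?mule0 ltry.
Qed.

(** Absolute continuity on lines in quantitative form. Products of a plateau across the lines and
    one along them give, by Fubini, the one-dimensional weak identity on almost every line of each
    rational box. After countably many exceptions a good line satisfies it for all rational tests at
    once, and [variation_le] applies to every segment of it inside the disk. Continuity of [f] gives
    its values at single points a meaning. *)
Lemma slice_inequality (b : bool) (f g : P -> R) (M : R) :
  measurable_fun (@disk R) f -> (forall z, disk z -> `|f z| <= M) ->
  (forall z, disk z -> {for z, continuous f}) ->
  (@leb2 R).-integrable (@disk R) (EFin \o g) ->
  (forall psi, test_fun (@disk R) psi ->
     (\int[@leb2 R]_(x in @disk R) (f x * 'D_(dir b) psi x)%:E =
      - \int[@leb2 R]_(x in @disk R) (g x * psi x)%:E)%E) ->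
  {ae mu, forall a, forall s s' : R, s < s' -> a ^+ 2 + s ^+ 2 < 1 -> a ^+ 2 + s' ^+ 2 < 1 ->
    ((`|f (pt b a s') - f (pt b a s)|)%:E <= \int[mu]_(y in `[s, s']) (`|g (pt b a y)|)%:E)%E}.
Proof.
move=> mf fM cf ig hw; have [d [K [cd dstep dK d0]]] := step_derivative R.
have mD := measurable_disk.
have mg : measurable_fun (@disk R) g by apply/measurable_EFinP; exact: measurable_int ig.
have M0 : 0 <= M by apply: (le_trans _ (fM 0 _)) => //; rewrite /disk /= expr0n addr0 ltr01.
have K0 : 0 <= K by exact: le_trans (normr_ge0 _) (dK 0).
have mres (k : P -> R) : measurable_fun setT k -> measurable_fun (@disk R) k.
  by move=> mk; apply: measurable_funS (@measurableT _ _) (@subsetT _ _) mk.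
have mpl n c c' : measurable_fun setT (fun z : P => plateau n c c' (along b z)).
  by apply: (@measurableT_comp _ _ _ _ _ _ (plateau n c c')); [exact: measurable_plateau | exact: measurable_along].
have mpa n c c' : measurable_fun setT (fun z : P => plateau n c c' (across b z)).
  by apply: (@measurableT_comp _ _ _ _ _ _ (plateau n c c')); [exact: measurable_plateau | exact: measurable_across].
have mbu n c : measurable_fun setT (fun z : P => bump_at d n c (along b z)).
  apply: (@measurableT_comp _ _ _ _ _ _ (bump_at d n c)); last exact: measurable_along.
  by apply: continuous_measurable_fun; exact: continuous_bump_at.
pose eta' (n c c' : R) (z : P) := bump_at d n c (along b z) - bump_at d n c' (along b z).
have meta n c c' : measurable_fun (@disk R) (eta' n c c').
  by apply: measurable_funB; exact: mres.
have if1 n c c' : 0 < n -> (@leb2 R).-integrable (@disk R) (EFin \o (fun z => f z * eta' n c c' z)).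
  move=> n0; apply: measurable_bounded_integrable => //; first exact: leb2_disk_lty.
    by apply: measurable_funM => //; exact: meta.
  exists (M * (n * K + n * K)); split; first exact: num_real.
  move=> B hB z zD; apply: (le_trans _ (ltW hB)); rewrite normrM; apply: ler_pM => //; first exact: fM.
  by apply: (le_trans (ler_normB _ _)); apply: lerD; exact: bump_at_le.
have ig1 n c c' : (@leb2 R).-integrable (@disk R) (EFin \o (fun z => g z * plateau n c c' (along b z))).
  apply: le_integrable ig => //.
    by apply/measurable_EFinP; apply: measurable_funM => //; exact: mres.
  by move=> z _ /=; rewrite lee_fin normrM ler_piMr// plateau_le1.
pose k (n c c' : R) : P -> \bar R := (EFin \o (fun z => f z * eta' n c c' z + g z * plateau n c c' (along b z))) \_ (@disk R).
have ik n c c' : 0 < n -> (@leb2 R).-integrable setT (k n c c').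
  move=> n0; apply/(@integrable_mkcond _ _ _ (@leb2 R) (@disk R) _ mD).
  by have := @integrableD _ _ _ (@leb2 R) _ mD _ _ (if1 n c c' n0) (ig1 n c c'); exact.
have test (A B : R) (n : nat) (q1 q2 : R) : q1 < q2 ->
    (forall a y, A <= a <= B -> q1 <= y <= q2 + n.+1%:R^-1 -> a ^+ 2 + y ^+ 2 < 1) ->
    {ae mu, forall a, A < a < B -> (\int[mu]_(y in `[q1, (q2 + n.+1%:R^-1)%R])
      (f (pt b a y) * (bump_at d n.+1%:R q1 y - bump_at d n.+1%:R q2 y) +
       g (pt b a y) * plateau n.+1%:R q1 q2 y)%:E = 0)%E}.
  move=> q12 box; have n0 : (0 : R) < n.+1%:R by [].
  move: (n.+1%:R : R) n0 box => N n0 box.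
  have key : {ae mu, forall a, A < a < B -> (\int[mu]_s k N q1 q2 (pt b a s) = 0)%E}.
    apply: slice_ae_eq0; first exact: ik.
    move=> n' c c' n'0 cc' Ac cB.
    have tf : test_fun (@disk R) (fun z => plateau n' c c' (across b z) * plateau N q1 q2 (along b z)).
      case: (b) => /=.
        apply: test_fun_plateau => //; first exact: ltW.
        move=> z /andP[z1 z2] /andP[z3 z4]; apply: (box z.1 z.2); clear -z1 z2 z3 z4 Ac cB; apply/andP; split; lra.
      rewrite (_ : (fun z : P => _) = (fun z : P => plateau N q1 q2 z.1 * plateau n' c c' z.2)); last first.
        by apply/funext => z; rewrite mulrC.
      apply: test_fun_plateau => //; first exact: ltW.
      move=> z /andP[z1 z2] /andP[z3 z4]; rewrite /disk /= addrC.
      by apply: (box z.2 z.1); clear -z1 z2 z3 z4 Ac cB; apply/andP; split; lra.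
    have Dpsi z : 'D_(dir b) (fun z => plateau n' c c' (across b z) * plateau N q1 q2 (along b z)) z =
        plateau n' c c' (across b z) * eta' N q1 q2 z.
      have p1 := is_derive_plateau dstep n' c c'; have p2 := is_derive_plateau dstep N q1 q2.
      rewrite /eta'; case: (b) => /=.
        by have [_ ->] := derive_tensor z p1 p2.
      rewrite (_ : (fun z : P => _) = (fun z : P => plateau N q1 q2 z.1 * plateau n' c c' z.2)); last first.
        by apply/funext => y; rewrite mulrC.
      by have [-> _] := derive_tensor z p2 p1; rewrite mulrC.
    have J1 : (@leb2 R).-integrable (@disk R) (EFin \o (fun z => f z * (plateau n' c c' (across b z) * eta' N q1 q2 z))).
      apply: le_integrable (if1 N q1 q2 n0) => //.
        apply/measurable_EFinP; apply: measurable_funM => //.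
        by apply: measurable_funM; [apply: mres; exact: mpa | exact: meta].
      move=> z _ /=; rewrite lee_fin mulrCA normrM -[X in _ <= X]mul1r ler_wpM2r//; exact: plateau_le1.
    have J2 : (@leb2 R).-integrable (@disk R) (EFin \o (fun z => g z * (plateau n' c c' (across b z) * plateau N q1 q2 (along b z)))).
      apply: le_integrable (ig1 N q1 q2) => //.
        apply/measurable_EFinP; apply: measurable_funM => //.
        by apply: measurable_funM; apply: mres; [exact: mpa | exact: mpl].
      move=> z _ /=; rewrite lee_fin mulrCA normrM -[X in _ <= X]mul1r ler_wpM2r//; exact: plateau_le1.
    have := hw _ tf; under eq_integral do rewrite Dpsi.
    move=> e.
    transitivity (\int[@leb2 R]_(z in @disk R) ((f z * (plateau n' c c' (across b z) * eta' N q1 q2 z))%:E +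
       (g z * (plateau n' c c' (across b z) * plateau N q1 q2 (along b z)))%:E))%E.
      rewrite [RHS]integral_mkcond; apply: eq_integral => z _; rewrite /k !patchE.
      by case: ifP => _; rewrite ?mule0//= -EFinM -EFinD; congr EFin; ring.
    have := @integralD _ _ _ (@leb2 R) _ mD _ _ J1 J2; rewrite /= => ->.
    rewrite e addeC subee//.
    by have := @integrable_fin_num _ _ _ (@leb2 R) _ mD _ J2; exact.
  apply: (ae_impl _ key) => a ha aAB; have := ha aAB => {ha}; move=> <-.
  have {aAB}aAB : A <= a <= B by case/andP: aAB => *; rewrite !ltW.
  (* Outside [[q1, q2 + 1/N]] the bumps and the plateau vanish, and inside it the point belongs to
     the disk, so the whole line and the interval give the same integral. *)
  rewrite integral_mkcond; apply: eq_integral => y _; rewrite /k !patchE.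
  case: ifPn => yI.
    move: yI; rewrite inE /= in_itv /= => yI.
    rewrite ifT; last by rewrite inE; apply/disk_pt; exact: box.
    by rewrite /= /eta' along_pt.
  case: ifP => // _; rewrite /= /eta' along_pt.
  move: yI; rewrite notin_setE /= in_itv /= => yI.
  have v0 : 0 < N^-1 by rewrite invr_gt0.
  have [yl|yl] := ltP y q1.
    rewrite !(bump_at_eq0 d0 n0); [|left; lra|left; lra].
    by rewrite subrr mulr0 plateau_eq0 ?mulr0 ?addr0//; [exact: ltW | left; exact: ltW].
  have {}yl : q2 + N^-1 < y by rewrite ltNge; apply/negP => h; apply: yI; rewrite yl.
  rewrite !(bump_at_eq0 d0 n0); [|right; lra|right; lra].
  by rewrite subrr mulr0 plateau_eq0 ?mulr0 ?addr0//; [exact: ltW | right; exact: ltW].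
(* The index collects a rational range []A, B[] of lines, the plateau endpoints and its steepness.
   Boxes not contained in the disk make the statement vacuous. *)
have all_tests := @ae_countable _ (fun (i : (rat * rat) * (rat * rat) * nat) (a : R) =>
   ratr i.1.2.1 < ratr i.1.2.2 :> R ->
   (forall a y : R, ratr i.1.1.1 <= a <= ratr i.1.1.2 -> ratr i.1.2.1 <= y <= ratr i.1.2.2 + i.2.+1%:R^-1 ->
      a ^+ 2 + y ^+ 2 < 1) ->
   ratr i.1.1.1 < a < ratr i.1.1.2 ->
   (\int[mu]_(y in `[ratr i.1.2.1, (ratr i.1.2.2 + i.2.+1%:R^-1)%R])
      (f (pt b a y) * (bump_at d i.2.+1%:R (ratr i.1.2.1) y - bump_at d i.2.+1%:R (ratr i.1.2.2) y) +
       g (pt b a y) * plateau i.2.+1%:R (ratr i.1.2.1) (ratr i.1.2.2) y)%:E = 0)%E).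
have igD : (@leb2 R).-integrable setT ((EFin \o g) \_ (@disk R)) by apply/(@integrable_mkcond _ _ _ (@leb2 R) (@disk R) _ mD).
apply: (ae_impl2 _ (all_tests _) (slice_integrable b igD)); last first.
  move=> [[[A B] [q1 q2]] n] /=.
  have [q12|q12] := boolP (ratr q1 < ratr q2 :> R); last by apply: aeW => a.
  have [box|box] := pselect (forall a y : R, ratr A <= a <= ratr B -> ratr q1 <= y <= ratr q2 + n.+1%:R^-1 -> a ^+ 2 + y ^+ 2 < 1);
    last by apply: aeW => a _ h; exfalso; apply: box.
  by apply: (ae_impl _ (test _ _ n _ _ q12 box)) => a h _ _.
move=> a {}all_tests iga s s' ss' hs hs'.
have conv y : s <= y <= s' -> y ^+ 2 <= Num.max (s ^+ 2) (s' ^+ 2).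
  move=> /andP[y1 y2]; rewrite le_max; have [y0|y0] := leP 0 y.
    by apply/orP; right; nra.
  by apply/orP; left; nra.
pose m := Num.max (s ^+ 2) (s' ^+ 2).
have hm : a ^+ 2 + m < 1 by rewrite /m; case: (leP (s ^+ 2)).
have {conv}conv y : s <= y <= s' -> y ^+ 2 <= m by exact: conv.
have m0 : 0 <= m by rewrite /m le_max sqr_ge0.
clearbody m.
(* A margin for neighbouring lines: |a' - a| <= r changes the square by less than 4 r, because |a +
   a'| < 3. *)
pose r := (1 - m - a ^+ 2) / 4.
have r0 : 0 < r by rewrite divr_gt0//; lra.
have a1 : -1 < a < 1.
  by clear -hm m0; apply/andP; split; nra.
have near_a a' : a - r <= a' <= a + r -> a' ^+ 2 + m < 1.
  move=> /andP[h1 h2]; case/andP: a1 => a1 a2.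
  have r1 : r < 1 by rewrite /r; have := sqr_ge0 a; lra.
  have e1 : a' ^+ 2 = a ^+ 2 + (a' - a) * (a + a') by ring.
  have e2 : (a' - a) * (a + a') < 4 * r.
    by clear -h1 h2 a1 a2 r0 r1; have [h|h] := leP 0 (a' - a); nra.
  by rewrite e1; move: e2; rewrite /r; lra.
have [A hA] : exists q : rat, ratr q \in `](a - r), a[ by apply: rat_in_itvoo; lra.
have [B hB] : exists q : rat, ratr q \in `]a, (a + r)[ by apply: rat_in_itvoo; lra.
move: hA hB; rewrite !in_itv /= => /andP[A1 A2] /andP[B1 B2].
have vle := @variation_le d K cd dstep dK d0 (fun y => f (pt b a y)) (fun y => g (pt b a y)) s s' ss'.
apply: vle.
- move=> y hy.
  have c : {for y, continuous (f \o pt b a)}.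
    apply: continuous_comp.
      by case: (b); apply: cvg_pairP; by [exact: cvg_cst | exact: cvg_id].
    by apply: cf; apply/disk_pt; have := conv y hy; lra.
  exact: c.
- have mss : measurable ([set` `[s, s']] : set R) by exact: measurable_itv.
  have h : mu.-integrable [set` `[s, s']] (fun y => ((EFin \o g) \_ (@disk R)) (pt b a y)).
    by apply: (@integrableS _ _ _ mu setT) => //; exact: iga.
  apply: eq_integrable h => // y; rewrite inE /= in_itv /= => hy.
  by rewrite patchE ifT// inE; apply/disk_pt; have := conv y hy; lra.
move=> n q1 q2 sq1 q12 q2s.
apply: (all_tests ((A, B), (q1, q2), n)) => /=.
- by rewrite ltr_rat.
- move=> a' y /andP[h1 h2] /andP[h3 h4].
  have : y ^+ 2 <= m by apply: conv; rewrite (ltW (lt_le_trans sq1 h3)) (ltW (le_lt_trans h4 q2s)).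
  have : a' ^+ 2 + m < 1 by apply: near_a; rewrite (le_trans (ltW A1) h1) (le_trans h2 (ltW B2)).
  lra.
- by rewrite A2 B1.
Qed.

End Slices.

(** * The clamped angle *)

Section Angle.
Variable R : realType.
Notation P := (R * R)%type.

(** Real induction: the supremum of the points [t] with e a <= e t belongs to that set and could be
    moved to the right if it were smaller than [b]. *)
Lemma le_of_locally_nondecreasing (e : R -> R) (a b : R) : a <= b ->
  (forall t, a <= t <= b -> exists2 d, 0 < d & forall t', a <= t' <= b -> `|t' - t| < d ->
     (t <= t' -> e t <= e t') /\ (t' <= t -> e t' <= e t)) -> e a <= e b.
Proof.
move=> ab loc.
pose S := [set t | a <= t <= b /\ e a <= e t].
have Sa : S a by rewrite /S /= lexx ab.
have Sb : has_sup S by split; [exists a | exists b => t [/andP[]]].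
pose m := sup S.
have ma : a <= m by apply: ub_le_sup => //; case: Sb.
have mb : m <= b by apply: ge_sup; [exists a | move=> t [/andP[]]].
have [d d0 hd] := loc m (introT andP (conj ma mb)).
have [t [tab et] mt] := sup_adherent d0 Sb.
have tm : t <= m by apply: ub_le_sup => //; case: Sb.
have em : e a <= e m.
  apply: (le_trans et); have [] := hd t tab; last by move=> _; apply.
  by rewrite ltr_norml; apply/andP; split; move: mt; rewrite -/m; lra.
have [bm|mb'] := leP b m; first by rewrite (_ : b = m)//; apply/eqP; rewrite eq_le bm mb.
pose t' := Num.min b (m + d / 2).
have mt' : m < t' by rewrite /t' lt_min mb' ltrDl divr_gt0.
have t'b : t' <= b by rewrite /t' ge_min lexx.
have t'd : t' <= m + d / 2 by rewrite /t' ge_min lexx orbT.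
have : S t'.
  split; first by rewrite t'b andbT; lra.
  apply: (le_trans em); have [] := hd t'; first by rewrite t'b andbT; lra.
    by rewrite ltr_norml; apply/andP; split; lra.
  by move=> + _; apply; exact: ltW.
move/(ub_le_sup (proj2 Sb)); rewrite -/m; lra.
Qed.

(** The function [E] bounds the length of the path from above. Both K E - u o g and K E + u o g are
    locally nondecreasing, hence ordered at the endpoints. The radius of the Lipschitz condition may
    depend on the point. *)
Lemma local_lipschitz_path (u : P -> R) (g : R -> P) (E : R -> R) (K a b : R) : 0 <= K -> a <= b ->
  (forall t t', a <= t -> t <= t' -> t' <= b -> enorm (g t' - g t) <= E t' - E t) ->
  (forall t, a <= t <= b -> exists2 d, 0 < d & forall t', a <= t' <= b -> `|t' - t| < d ->
     `|u (g t') - u (g t)| <= K * enorm (g t' - g t)) ->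
  `|u (g b) - u (g a)| <= K * (E b - E a).
Proof.
move=> K0 ab gE loc.
have key (s : R) : s = 1 \/ s = -1 -> K * E a - s * u (g a) <= K * E b - s * u (g b).
  move=> hs; apply: (@le_of_locally_nondecreasing (fun t => K * E t - s * u (g t))) => // t tab.
  have [d d0 hd] := loc t tab; exists d => // t' tab' td.
  have := hd t' tab' td; case/andP: tab => t1 t2; case/andP: tab' => t3 t4.
  rewrite ler_norml => /andP[h1 h2]; split => tt.
    have h : K * enorm (g t' - g t) <= K * (E t' - E t) by rewrite ler_wpM2l// gE.
    by case: hs => ->; lra.
  have h : K * enorm (g t' - g t) <= K * (E t - E t') by rewrite ler_wpM2l// enorm_distC gE.
  by case: hs => ->; lra.
have h1 := key 1 (or_introl erefl); have h2 := key (-1) (or_intror erefl).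
by rewrite ler_norml; apply/andP; split; lra.
Qed.

Variable m : R.

(** With [lateral], the coordinates in the orthonormal frame whose first vector is - [tip], the
    inward normal of the disk at [tip]. *)
Definition axial (w : P) : R := 3 / 5 * w.1 + 4 / 5 * w.2.
Definition lateral (w : P) : R := 3 / 5 * w.2 - 4 / 5 * w.1.

(* A continuous branch, on the spiralling domain, of the argument relative to [- tip]. *)
Definition angle (y : P) : R :=
  enorm y `^ (- m) + atan (lateral (twist (-1) m y) / axial (twist (-1) m y)).

(** After untwisting, the point lies in the open half plane on which [atan] computes the
    argument. *)
Definition in_range (y : P) := 0 < axial (twist (-1) m y).

Lemma axial_lateral (w : P) : axial w ^+ 2 + lateral w ^+ 2 = enorm w ^+ 2.
Proof. by rewrite sqr_enorm /axial /lateral; field. Qed.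

Lemma in_range_gt0 y : in_range y -> 0 < enorm y.
Proof.
rewrite /in_range => h; apply: enorm_gt0; apply/eqP => y0; move: h.
have -> : twist (-1) m y = 0 by apply: enorm_eq0; rewrite enorm_twist y0 enorm0.
by rewrite /axial /= !mulr0 addr0 ltxx.
Qed.

Lemma polar_atan (w : P) : 0 < axial w ->
  axial w = enorm w * cos (atan (lateral w / axial w)) /\
  lateral w = enorm w * sin (atan (lateral w / axial w)).
Proof.
move=> w0; set t := lateral w / axial w.
have n0 : 0 < enorm w.
  rewrite lt_def enorm_ge0 andbT; apply/eqP => h.
  by have := axial_lateral w; rewrite h expr0n /=; have := sqr_ge0 (lateral w); nra.
have cpos : 0 < cos (atan t) by apply: cos_gt0_pihalf; rewrite atan_gtNpi2 atan_ltpi2.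
have tE : sin (atan t) = t * cos (atan t) by rewrite -{2}(atanK t) /tan divfK// gt_eqF.
have c2 : (enorm w * cos (atan t)) ^+ 2 = axial w ^+ 2.
  have h := cos2Dsin2 (atan t); rewrite tE in h.
  have e : lateral w = t * axial w by rewrite /t divfK// gt_eqF.
  rewrite exprMn -axial_lateral e.
  by transitivity (axial w ^+ 2 * (cos (atan t) ^+ 2 + (t * cos (atan t)) ^+ 2)); [ring | rewrite h mulr1].
have e1 : axial w = enorm w * cos (atan t).
  apply/eqP; rewrite -(@eqrXn2 _ 2)// ?c2 ?eqxx//; first exact: ltW.
  by rewrite mulr_ge0// ltW.
split => //; rewrite tE mulrCA -e1 /t divfK// gt_eqF//.
Qed.

Lemma polar (y : P) : in_range y ->
  y.1 = enorm y * (rotp (angle y) (3 / 5, 4 / 5)).1 /\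
  y.2 = enorm y * (rotp (angle y) (3 / 5, 4 / 5)).2.
Proof.
move=> /polar_atan; rewrite /angle.
set w := twist (-1) m y; set t := atan _ => -[e1 e2].
have yw : y = rotp (enorm y `^ (- m)) w.
  by have := twistVK m y; rewrite -/w => {1}<-; rewrite /twist enorm_twist mul1r.
have nw : enorm w = enorm y by exact: enorm_twist.
have w1 : w.1 = enorm y * (rotp t (3 / 5, 4 / 5)).1.
  have -> : w.1 = 3 / 5 * axial w - 4 / 5 * lateral w by rewrite /axial /lateral; field.
  by rewrite e1 e2 nw /=; ring.
have w2 : w.2 = enorm y * (rotp t (3 / 5, 4 / 5)).2.
  have -> : w.2 = 4 / 5 * axial w + 3 / 5 * lateral w by rewrite /axial /lateral; field.
  by rewrite e1 e2 nw /=; ring.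
move: yw; set th := enorm y `^ (- m) => yw; rewrite -!rotpD; move: (rotp t _) w1 w2 => c w1 w2.
have y1 : y.1 = cos th * w.1 - sin th * w.2 by rewrite {1}yw.
have y2 : y.2 = sin th * w.1 + cos th * w.2 by rewrite {1}yw.
by rewrite y1 y2 w1 w2 /=; split; ring.
Qed.

(** Since [angle] is an argument of [y] itself, the cross product controls its differences. A direct
    estimate would fail: the summand |y|^-m alone has a gradient of order |y|^(-m-1), and only the
    cancellation against the [atan] term leaves 1/|y|. *)
Lemma angle_cross (y z : P) : in_range y -> in_range z ->
  enorm y * enorm z * sin (angle z - angle y) = y.1 * z.2 - y.2 * z.1.
Proof.
move=> /polar[y1 y2] /polar[z1 z2]; rewrite [in RHS]y1 [in RHS]y2 [in RHS]z1 [in RHS]z2 sinB /rotp /=.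
by field.
Qed.

(** The cross product of [y] and [z] equals that of [y] and z - y, which is at most |y| |z - y|; the
    factor |y| cancels. *)
Lemma angle_sin_le (y z : P) : in_range y -> in_range z ->
  enorm z * `|sin (angle z - angle y)| <= enorm (z - y).
Proof.
move=> ry rz; have y0 := in_range_gt0 ry; have z0 := in_range_gt0 rz.
rewrite -(ler_pM2l y0) mulrA.
have -> : enorm y * enorm z * `|sin (angle z - angle y)| = `|y.1 * z.2 - y.2 * z.1|.
  by rewrite -angle_cross// normrM [in RHS]ger0_norm// mulr_ge0// enorm_ge0.
have -> : y.1 * z.2 - y.2 * z.1 = y.1 * (z - y).2 - y.2 * (z - y).1 by rewrite /=; ring.
move: (z - y) => v.
rewrite -[X in _ <= X]ger0_norm ?mulr_ge0 ?enorm_ge0// -ler_sqr ?nnegrE// !real_normK ?num_real//.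
rewrite exprMn !sqr_enorm; have := sqr_ge0 (y.1 * v.1 + y.2 * v.2); nra.
Qed.

Lemma continuous_linear_form (a b : R) : continuous (fun w : P => a * w.1 + b * w.2).
Proof.
move=> w; apply: cvgD; apply: cvgM; (exact: cvg_cst || exact: cvg_fst || exact: cvg_snd).
Qed.

Lemma continuous_axial : continuous axial.
Proof. exact: continuous_linear_form. Qed.

Lemma continuous_lateral : continuous lateral.
Proof.
rewrite (_ : lateral = (fun w : P => (- (4 / 5)) * w.1 + 3 / 5 * w.2)); first exact: continuous_linear_form.
by apply/funext => w; rewrite /lateral; ring.
Qed.

Lemma in_range_near y : in_range y -> \forall z \near y, in_range z.
Proof.
move=> ry.
have c : {for y, continuous (axial \o twist (-1) m)}.
  by apply: continuous_comp; [exact: continuous_twist | exact: continuous_axial].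
by near=> z; rewrite /in_range; near: z; move/cvgr_gt : c; exact.
Unshelve. all: by end_near. Qed.

Lemma continuous_angle y : in_range y -> {for y, continuous angle}.
Proof.
move=> ry.
have c1 : {for y, continuous (axial \o twist (-1) m)}.
  by apply: continuous_comp; [exact: continuous_twist | exact: continuous_axial].
have c2 : {for y, continuous (lateral \o twist (-1) m)}.
  by apply: continuous_comp; [exact: continuous_twist | exact: continuous_lateral].
have c3 : {for y, continuous (fun y => (lateral \o twist (-1) m) y / (axial \o twist (-1) m) y)}.
  by apply: cvgM => //; apply: cvgV => //; rewrite /= gt_eqF.
have c4 : {for y, continuous ((fun x => x `^ (- m)) \o @enorm R)}.
  by apply: continuous_comp; [exact: continuous_enorm | apply: continuous_powR; exact: in_range_gt0].
apply: cvgD; first exact: c4.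
have c5 : {for y, continuous (@atan R \o (fun y => (lateral \o twist (-1) m) y / (axial \o twist (-1) m) y))}.
  by apply: continuous_comp => //; exact: continuous_atan.
exact: c5.
Qed.

Definition clamped_angle (M : R) (y : P) : R := Num.min (angle y) M.

Lemma continuous_clamped_angle M y : in_range y -> {for y, continuous (clamped_angle M)}.
Proof.
move=> /continuous_angle c.
have h : {for y, continuous ((fun z => Num.min z.1 z.2) \o (fun y => (angle y, M)))}.
  apply: continuous_comp; last exact: min_continuous.
  by apply: cvg_pairP => //; exact: cvg_cst.
exact: h.
Qed.

Lemma min_lipschitz (a b M : R) : `|Num.min a M - Num.min b M| <= `|a - b|.
Proof.
have := ler_norm (a - b); have := ler_norm (b - a); rewrite [`|b - a|]distrC => h1 h2.
by rewrite ler_norml; apply/andP; split; case: (leP a M) => ?; case: (leP b M) => ?; lra.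
Qed.

(** Where the angle exceeds [M], the clamped function is locally constant; elsewhere |y| >= d. In 4
    / d, one factor 2 comes from |z| > |y| / 2 and the other from u / 2 <= sin u. *)
Lemma clamped_angle_lipschitz (M d : R) (y : P) : 0 < d -> in_range y -> (angle y <= M -> d <= enorm y) ->
  \forall z \near y, `|clamped_angle M z - clamped_angle M y| <= 4 / d * enorm (z - y).
Proof.
move=> d0 ry hM; have y0 := in_range_gt0 ry; have ca := continuous_angle ry.
have [/hM yd|My] := leP (angle y) M; last first.
  near=> z.
  have : M < angle z by near: z; move/cvgr_gt : ca; exact.
  move=> Mz; rewrite /clamped_angle !min_r ?(ltW My) ?(ltW Mz)// subrr normr0.
  by rewrite mulr_ge0 ?enorm_ge0// divr_ge0// ltW.
near=> z.
have rz : in_range z by near: z; exact: in_range_near.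
have z2 : enorm y / 2 < enorm z.
  near: z; have c := @continuous_enorm R y; move/cvgr_gt : c; apply.
  lra.
have a1 : `|angle y - angle z| < 1 by near: z; move/cvgrPdist_lt : ca; exact.
apply: (le_trans (min_lipschitz _ _ _)).
rewrite distrC in a1.
have sl : `|angle z - angle y| / 2 <= `|sin (angle z - angle y)|.
  have p2 := @pi_ge2 R.
  have [h|h] := leP 0 (angle z - angle y).
    rewrite [X in X / 2]ger0_norm//; apply: le_trans (ler_norm _); apply: ler_sin_half.
    by move: a1; rewrite ger0_norm// => a1; apply/andP; split; lra.
  rewrite [X in X / 2]ltr0_norm// -normrN -sinN; apply: le_trans (ler_norm _); apply: ler_sin_half.
  by move: a1; rewrite ltr0_norm// => a1; apply/andP; split; lra.
have h := angle_sin_le ry rz.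
have key : `|angle z - angle y| * d <= 4 * enorm (z - y).
  have s0 := normr_ge0 (sin (angle z - angle y)); have n0 := normr_ge0 (angle z - angle y).
  apply: (@le_trans _ _ (2 * `|sin (angle z - angle y)| * (2 * enorm z))); last by nra.
  by apply: ler_pM => //; [exact: ltW | lra | lra].
by rewrite mulrAC ler_pdivlMr.
Unshelve. all: by end_near. Qed.

Lemma angle_bounds y : enorm y `^ (- m) - 2 <= angle y <= enorm y `^ (- m) + 2.
Proof.
have h1 := atan_gtNpi2 (lateral (twist (-1) m y) / axial (twist (-1) m y)).
have h2 := atan_ltpi2 (lateral (twist (-1) m y) / axial (twist (-1) m y)).
have [/andP[_ h3] _] := @pihalf_02_cos_pihalf R.
by rewrite /angle; apply/andP; split; lra.
Qed.

(** For |x| <= 1, expanding |x - tip|^2 gives [axial] of x - tip at least |x - tip|^2 / 2, positive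
    away from the tip. *)
Lemma closure_spiral_in_range y : closure (spiral m @` @disk R) y -> y != 0 -> in_range y.
Proof.
rewrite closure_spiral closure_diskE => -[x /= x1 <-] y0; rewrite /in_range /spiral twistK.
have xt : x - tip R != 0.
  apply: contra_neq y0 => e; apply: enorm_eq0.
  by rewrite enorm_spiral e enorm0.
have n0 := enorm_gt0 xt.
have h1 := sqr_enorm (x - tip R); have h2 := sqr_enorm x; have h3 := sqr_tip R.
have h4 := enorm_ge0 x; rewrite /axial; move: h1 h2 h3; rewrite /tip /= => h1 h2 h3.
have : enorm x ^+ 2 <= 1 by nra.
have : 0 < enorm (x - tip R) ^+ 2 by rewrite exprn_gt0.
by rewrite /tip h1 h2; lra.
Qed.

End Angle.

(** * Non-existence of the extension *)

Section NoExtension.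
Variable R : realType.
Notation P := (R * R)%type.
Notation mu := (@lebesgue_measure R).

Lemma powR_neg_unbounded (al N : R) : 0 < al ->
  exists2 r0, 0 < r0 & forall r, 0 < r -> r <= r0 -> N < r `^ (- al).
Proof.
move=> al0; have N1 : 0 < `|N| + 1 by rewrite ltr_wpDl.
exists ((`|N| + 1) `^ (- al^-1)); first by rewrite powR_gt0.
move=> r r0 rN; apply: (@lt_le_trans _ _ (`|N| + 1)); first by have := ler_norm N; lra.
have -> : `|N| + 1 = ((`|N| + 1) `^ (- al^-1)) `^ (- al).
  by rewrite -powRrM mulrNN mulVf ?gt_eqF// powRr1// ltW.
rewrite !(powRN _ al) lef_pV2 ?posrE ?powR_gt0//.
by apply: ge0_ler_powR; rewrite ?nnegrE ?powR_ge0// ltW.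
Qed.

(** Truncation at the level [l], in the role of Hölder's inequality: for x > l the factor (x / l)^(p
    - 1) is at least 1. *)
Lemma le_powR_split (p l x : R) : 1 <= p -> 0 < l -> 0 <= x -> x <= l + l `^ (1 - p) * x `^ p.
Proof.
move=> p1 l0 x0; have [xl|lx] := leP x l.
  by apply: (le_trans xl); rewrite lerDl mulr_ge0 ?powR_ge0.
apply: (@le_trans _ _ (l `^ (1 - p) * x `^ p)); last by rewrite lerDr ltW.
have t1 : 1 <= x / l by rewrite ler_pdivlMr// mul1r ltW.
have := le1r_powR t1 p1; rewrite powRM ?invr_ge0 ?(ltW l0)// -powR_inv1 ?(ltW l0)// -powRrM mulN1r.
rewrite powR_inv1 ?(ltW l0)// ler_pdivrMr// => /le_trans; apply.
have e : l `^ (1 - p) = l * l `^ (- p).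
  by rewrite powRD ?powRr1 ?(ltW l0)// (gt_eqF l0) implybT.
by rewrite e le_eqVlt; apply/orP; left; apply/eqP; ring.
Qed.

(** The weak derivative is extended by zero so that Fubini can be used on the whole plane. It is
    integrable because |g| <= 1 + |g|^p on a set of finite measure. *)
Lemma weak_partial (p : R) (f : P -> R) (b : bool) : 2 < p -> sobolev1p (@disk R) p f ->
  exists g : P -> R, [/\ measurable_fun setT g, (forall z, ~ disk z -> g z = 0),
    (@leb2 R).-integrable setT (EFin \o g), (\int[@leb2 R]_z ((`|g z| `^ p)%R)%:E < +oo)%E &
    forall psi, test_fun (@disk R) psi ->
     (\int[@leb2 R]_(x in @disk R) (f x * 'D_(dir R b) psi x)%:E =
      - \int[@leb2 R]_(x in @disk R) (g x * psi x)%:E)%E].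
Proof.
move=> p2 [_ /(_ (dir R b))].
have hd : dir R b = e1 R \/ dir R b = e2 R by case: b; [right | left].
move=> /(_ hd)[gv [[mgv igv] hw]].
have mD := @measurable_disk R.
pose g := gv \_ (@disk R).
have gD z : disk z -> g z = gv z by move=> hz; rewrite /g patchE ifT// inE.
have gN z : ~ disk z -> g z = 0 by move=> hz; rewrite /g patchE ifF//; apply/negbTE; rewrite notin_setE.
have mg : measurable_fun setT g by exact: (measurable_restrictT gv mD).1.
have mgp : measurable_fun setT (fun z => ((`|g z| `^ p)%R)%:E).
  apply/measurable_EFinP; apply: (measurableT_comp (measurable_powR _)).
  exact: measurableT_comp.
have fin : (\int[@leb2 R]_z ((`|g z| `^ p)%R)%:E < +oo)%E.
  apply: le_lt_trans igv; rewrite [leRHS]integral_mkcond le_eqVlt; apply/orP; left; apply/eqP.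
  apply: eq_integral => z _; rewrite patchE; case: ifPn => hz; first by rewrite gD//; rewrite inE in hz.
  by rewrite gN ?normr0 ?powR0//; [rewrite gt_eqF//; lra | rewrite notin_setE in hz].
have ig : (@leb2 R).-integrable setT (EFin \o g).
  apply/integrableP; split; first exact/measurable_EFinP.
  apply: (@le_lt_trans _ _ (\int[@leb2 R]_z ((\1_(@disk R) z)%:E + ((`|g z| `^ p)%R)%:E))%E).
    apply: ge0_le_integral => //.
    - by apply/measurable_EFinP; exact: measurableT_comp.
    - by apply: emeasurable_funD => //; apply/measurable_EFinP; exact: measurable_indic.
    - move=> z _; rewrite /= lee_fin; have [hz|hz] := pselect (disk z).
        rewrite indicE mem_set//=; have [h|h] := leP `|g z| 1.
          by apply: (le_trans h); rewrite lerDl powR_ge0.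
        have p1 : 1 <= p by lra.
        by have := le1r_powR (ltW h) p1; lra.
      by rewrite gN// normr0 addr_ge0 ?powR_ge0.
  rewrite ge0_integralD//; last by apply/measurable_EFinP; exact: measurable_indic.
  rewrite integral_indic// setIT; apply: lte_add_pinfty => //; exact: leb2_disk_lty.
exists g; split => // psi hpsi; rewrite hw//; congr (- _)%E.
by apply: eq_integral => z; rewrite inE => hz; rewrite gD.
Qed.

(** The starting point of the path lies on the circle, where no slice estimate is available. The
    bound is proved from every later parameter [s], with a right side independent of [s], and passes
    to the limit at [s0]. *)
Lemma path_variation (u : P -> R) (c : R -> P) (g1 g2 : R -> R) (K s0 s1 : R) : 0 <= K -> s0 < s1 ->
  mu.-integrable setT (EFin \o g1) -> mu.-integrable setT (EFin \o g2) ->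
  (forall s s', s0 < s -> s < s' -> s' <= s1 ->
     ((`|(c s').1 - (c s).1|)%:E <= \int[mu]_(y in `[s, s']) (`|g1 y|)%:E)%E) ->
  (forall s s', s0 < s -> s < s' -> s' <= s1 ->
     ((`|(c s').2 - (c s).2|)%:E <= \int[mu]_(y in `[s, s']) (`|g2 y|)%:E)%E) ->
  (forall t, s0 < t <= s1 -> {for t, continuous c}) ->
  (forall t, s0 < t <= s1 -> \forall z \near c t, `|u z - u (c t)| <= K * enorm (z - c t)) ->
  u (c s) @[s --> s0^'+] --> u (c s0) ->
  ((`|u (c s1) - u (c s0)|)%:E <= K%:E * \int[mu]_(y in `[s0, s1]) (`|g1 y| + `|g2 y|)%:E)%E.
Proof.
move=> K0 s01 i1 i2 h1 h2 cc uc u0.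
have mI a b : measurable ([set` Interval a b] : set R) by exact: measurable_itv.
pose G y := `|g1 y| + `|g2 y|.
have iG : mu.-integrable setT (EFin \o G).
  rewrite (_ : EFin \o G = ((EFin \o (Num.norm \o g1)) \+ (EFin \o (Num.norm \o g2)))%E)//.
  by apply: integrableD => //; exact: integrable_norm.
have iGI a b : mu.-integrable [set` Interval a b] (EFin \o G) by apply: (@integrableS _ _ _ mu setT).
have RE a b : (\int[mu]_(y in [set` Interval a b]) (G y)%:E)%E = (\int[mu]_(y in [set` Interval a b]) G y)%:E.
  by rewrite /Rintegral fineK//; exact: (@integrable_fin_num _ _ _ mu _ (mI _ _) _ (iGI _ _)).
rewrite (RE (BLeft s0) (BRight s1)) -EFinM lee_fin.
set V := K * _.
have bound s : s0 < s -> s < s1 -> `|u (c s1) - u (c s)| <= V.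
  move=> ss ss1.
  (* The bounds on the increments of both coordinates make this integral dominate the lengths of the
     chords of the path. *)
  pose E t := \int[mu]_(y in `[s0, t]) G y.
  have E0 : 0 <= E s by apply: Rintegral_ge0 => y _; rewrite addr_ge0.
  have ED t t' : s <= t -> t <= t' -> t' <= s1 -> enorm (c t' - c t) <= E t' - E t.
    move=> st tt' ts1.
    have [->|ne] := eqVneq t t'; first by rewrite !subrr enorm0.
    have lt : t < t' by rewrite lt_neqAle ne.
    have s0t : s0 < t by lra.
    rewrite /E Rintegral_itvB; [|exact: iGI | rewrite bnd_simp; lra | by rewrite bnd_simp].
    rewrite Rintegral_itv_obnd_cbnd// -lee_fin -RE.
    apply: (@le_trans _ _ (\int[mu]_(y in `[t, t']) (`|g1 y|)%:E + \int[mu]_(y in `[t, t']) (`|g2 y|)%:E)%E).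
      apply: le_trans (leeD (h1 t t' s0t lt ts1) (h2 t t' s0t lt ts1)).
      by rewrite -EFinD lee_fin; exact: enorm_le_abs.
    rewrite -ge0_integralD//; apply: (measurable_funS measurableT) => //; apply/measurable_EFinP.
      by apply: measurableT_comp => //; apply/measurable_EFinP; exact: measurable_int i1.
    by apply: measurableT_comp => //; apply/measurable_EFinP; exact: measurable_int i2.
  apply: (@le_trans _ _ (K * (E s1 - E s))); last first.
    by rewrite /V ler_wpM2l// lerBlDr lerDl.
  apply: (@local_lipschitz_path _ u c) => //; first exact: ltW.
  move=> t /andP[t1 t2]; have st : s0 < t <= s1 by rewrite t2 andbT; lra.
  have := cc t st _ (uc t st); rewrite /= => /nbhs_ballP[d /= d0 hd].
  exists d => // t' _ td; apply: hd; by rewrite /ball /= distrC.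
rewrite leNgt; apply/negP => VL.
have : \forall s \near s0^'+, V < `|u (c s1) - u (c s)|.
  have cv : `|u (c s1) - u (c s)| @[s --> s0^'+] --> `|u (c s1) - u (c s0)|.
    by apply: cvg_norm; apply: cvgB => //; exact: cvg_cst.
  by move/cvgr_gt : cv; apply.
move=> nV.
have [s [[hs1 hs2] hs3]] : exists s, (s0 < s /\ s < s1) /\ V < `|u (c s1) - u (c s)|.
  apply: (@filter_ex _ (s0^'+)); near=> s; do 2?split; near: s => //; [exact: nbhs_right_gt | exact: nbhs_right_lt].
by have := bound s hs1 hs2; lra.
Unshelve. all: by end_near. Qed.

Lemma sqr_pt (b : bool) (a s : R) : (pt b a s).1 ^+ 2 + (pt b a s).2 ^+ 2 = a ^+ 2 + s ^+ 2.
Proof. by case: b; rewrite //= addrC. Qed.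

Lemma homeo_continuous (B : set P) (h : P -> P) : homeo_onto (closure (@disk R)) B h ->
  forall z, disk z -> {for z, continuous h}.
Proof.
move=> [g [_ _ _ _ [ch _]]] z hz.
have : {within @disk R, continuous h} by apply: continuous_subspaceW ch; exact: subset_closure.
by rewrite continuous_open_subspace; [apply; rewrite inE | exact: open_disk].
Qed.

(** The chord from [s0] to - [s0] stays in the closed disk, so continuity within the closed disk
    gives the one-sided limit. *)
Lemma homeo_cvg_boundary (B : set P) (h : P -> P) (b : bool) (a s0 : R) : homeo_onto (closure (@disk R)) B h ->
  a ^+ 2 + s0 ^+ 2 = 1 -> s0 < 0 -> h (pt b a s) @[s --> s0^'+] --> h (pt b a s0).
Proof.
move=> [g [_ _ _ _ [ch _]]] as0 s0n U nU.
have cl s : s0 <= s <= - s0 -> closure (@disk R) (pt b a s).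
  move=> /andP[l1 l2]; rewrite closure_diskE /=; apply: enorm_le => //.
  by rewrite sqr_pt; nra.
have A0 : closure (@disk R) (pt b a s0) by apply: cl; lra.
have nW : within (closure (@disk R)) (nbhs (pt b a s0)) (h @^-1` U).
  by rewrite (nbhs_subspace_in A0); exact: (ch (pt b a s0) U nU).
have cp : {for s0, continuous (pt b a)}.
  by case: (b); apply: cvg_pairP; by [exact: cvg_cst | exact: cvg_id].
have := cp _ nW => nW2.
suff : \forall s \near s0^'+, U (h (pt b a s)) by [].
near=> s; have hs : s0 < s by near: s; exact: nbhs_right_gt.
have hs' : s < - s0 by near: s; apply: nbhs_right_lt; lra.
have : (fun s => closure (@disk R) (pt b a s) -> U (h (pt b a s))) s by near: s; apply: cvg_within; exact: nW2.
by apply; apply: cl; rewrite !ltW.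
Unshelve. all: by end_near. Qed.

Lemma homeo_enorm_le (m : R) (h : P -> P) (z : P) :
  homeo_onto (closure (@disk R)) (closure (spiral m @` @disk R)) h -> enorm z <= 1 -> enorm (h z) <= 2.
Proof.
move=> [g [hA _ _ _ _]] z1; have : closure (@disk R) z by rewrite closure_diskE.
move=> /hA; rewrite closure_spiral closure_diskE => -[x /= x1 <-]; rewrite enorm_spiral.
by have := ler_enormB x (tip R); rewrite enorm_tip; lra.
Qed.

(** By injectivity no other point is sent to 0, the image of the tip. *)
Lemma homeo_in_range (m : R) (h : P -> P) (z : P) :
  homeo_onto (closure (@disk R)) (closure (spiral m @` @disk R)) h ->
  (forall x, @circle R x -> h x = spiral m x) ->
  enorm z <= 1 -> z != tip R -> in_range m (h z).
Proof.
move=> [g [hA _ gK _ _]] hb z1 zt.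
have clz : closure (@disk R) z by rewrite closure_diskE.
apply: closure_spiral_in_range; first exact: hA.
apply: contra_neq zt => hz0.
have ct : @circle R (tip R) by apply/circleE; exact: enorm_tip.
have ht : h (tip R) = 0 by rewrite hb//; apply: enorm_eq0; rewrite enorm_spiral subrr enorm0.
by rewrite -(gK _ clz) hz0 -ht gK// closure_diskE /= enorm_tip.
Qed.

(** What is used of a single line: [g1] and [g2] stand for the derivatives of the two components of
    [h] along it, and the inequalities concern points of the open disk only. *)
Definition good_slice (h : P -> P) (g1 g2 : P -> R) (b : bool) (a : R) : Prop :=
  [/\ mu.-integrable setT (fun s => (g1 (pt b a s))%:E), mu.-integrable setT (fun s => (g2 (pt b a s))%:E),
   (forall s s' : R, s < s' -> a ^+ 2 + s ^+ 2 < 1 -> a ^+ 2 + s' ^+ 2 < 1 ->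
     ((`|(h (pt b a s')).1 - (h (pt b a s)).1|)%:E <= \int[mu]_(y in `[s, s']) (`|g1 (pt b a y)|)%:E)%E) &
   (forall s s' : R, s < s' -> a ^+ 2 + s ^+ 2 < 1 -> a ^+ 2 + s' ^+ 2 < 1 ->
     ((`|(h (pt b a s')).2 - (h (pt b a s)).2|)%:E <= \int[mu]_(y in `[s, s']) (`|g2 (pt b a y)|)%:E)%E)].

(** The clamp d^-m - 2 is adapted to [angle_bounds]: an angle below it forces |y|^-m <= d^-m, that
    is |y| >= d, so the clamped angle is locally 4/d-Lipschitz along the whole image. *)
Lemma slice_clamped_angle_le (m d : R) (h : P -> P) (g1 g2 : P -> R) (b : bool) (a s0 s1 : R) : 0 < m -> 0 < d ->
  homeo_onto (closure (@disk R)) (closure (spiral m @` @disk R)) h ->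
  (forall x, @circle R x -> h x = spiral m x) ->
  good_slice h g1 g2 b a -> s0 < s1 -> s0 < 0 -> a ^+ 2 + s0 ^+ 2 = 1 -> a ^+ 2 + s1 ^+ 2 < 1 ->
  pt b a s0 != tip R ->
  ((`|clamped_angle m (d `^ (- m) - 2) (h (pt b a s1)) - clamped_angle m (d `^ (- m) - 2) (h (pt b a s0))|)%:E <=
    (4 / d)%:E * \int[mu]_(y in `[s0, s1]) (`|g1 (pt b a y)| + `|g2 (pt b a y)|)%:E)%E.
Proof.
move=> m0 d0 hh hb [i1 i2 v1 v2] s01 s0n as0 as1 nt; set u := clamped_angle _ _.
have s1n : s1 < - s0 by rewrite ltNge; apply/negP => ?; nra.
have inD s : s0 < s -> s <= s1 -> a ^+ 2 + s ^+ 2 < 1.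
  move=> l1 l2; have : 0 < (s - s0) * (- s0 - s) by rewrite mulr_gt0//; lra.
  by rewrite (_ : (s - s0) * (- s0 - s) = s0 ^+ 2 - s ^+ 2); [lra | ring].
have inD' s : s0 < s -> s <= s1 -> @disk R (pt b a s) by move=> ? ?; apply/disk_pt; exact: inD.
have range s : s0 <= s -> s <= s1 -> in_range m (h (pt b a s)).
  rewrite le_eqVlt => /orP[/eqP <- _|l1 l2].
    apply: homeo_in_range => //; apply: enorm_le => //.
    by rewrite sqr_pt as0 expr1n.
  have dz := inD' s l1 l2; apply: homeo_in_range => //; first by apply/ltW/diskE.
  apply/eqP => e; have /circleE/= : enorm (tip R) = 1 := enorm_tip R.
  by move: dz; rewrite e /disk /= => ? ?; lra.
apply: (@path_variation u (fun s => h (pt b a s)) (fun s => g1 (pt b a s)) (fun s => g2 (pt b a s))) => //.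
- by rewrite divr_ge0// ltW.
- by move=> s s' l1 l2 l3; apply: v1 => //; apply: inD => //; lra.
- by move=> s s' l1 l2 l3; apply: v2 => //; apply: inD => //; lra.
- move=> t /andP[l1 l2].
  have c : {for t, continuous (h \o pt b a)}.
    apply: continuous_comp; first by case: (b); apply: cvg_pairP; by [exact: cvg_cst | exact: cvg_id].
    by apply: (homeo_continuous hh); exact: inD'.
  exact: c.
- move=> t /andP[l1 l2]; have rt := range t (ltW l1) l2.
  apply: clamped_angle_lipschitz => // hM.
  have /andP[lo _] := angle_bounds m (h (pt b a t)).
  have e0 := in_range_gt0 rt.
  have le : enorm (h (pt b a t)) `^ (- m) <= d `^ (- m) by lra.
  rewrite leNgt; apply/negP => lt; move: le; rewrite !powRN lef_pV2 ?posrE ?powR_gt0// leNgt => /negP; apply.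
  by rewrite gt0_ltr_powR// nnegrE ltW.
- have cu : {for h (pt b a s0), continuous u}.
    by apply: continuous_clamped_angle; apply: range => //; exact: ltW.
  have X : h (pt b a s) @[s --> s0^'+] --> h (pt b a s0) by exact: (@homeo_cvg_boundary _ h b a s0 hh as0 s0n).
  apply: continuous_cvg; [exact: cu | exact: X].
Qed.

Definition box (r : R) : set P :=
  [set` `[(- (3 / 5) - 9 * r)%R, (- (3 / 5) + 9 * r)%R]] `*`
  [set` `[(- (4 / 5) - 9 * r)%R, (- (4 / 5) + 9 * r)%R]].

Lemma measurable_box r : measurable (box r).
Proof. by apply: measurableX; exact: measurable_itv. Qed.

Lemma leb2_box r : 0 < r -> @leb2 R (box r) = ((18 * r) ^+ 2)%:E.
Proof.
move=> r0; rewrite /leb2 /box product_measure1E//=.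
rewrite !lebesgue_measure_itv /= !lte_fin !ifT; [|lra|lra].
by rewrite -!EFinB -EFinM; congr (_%:E); ring.
Qed.

(** The cut-off by the box replaces the segment, whose endpoints vary from line to line. The
    integrand is then the slice of one fixed function on the plane, and integrating over [a] gives
    an integral over the box. *)
Definition slice_energy (g1 g2 : P -> R) (r : R) (b : bool) (a : R) : \bar R :=
  (\int[mu]_s ((`|g1 (pt b a s)| + `|g2 (pt b a s)|) * \1_(box r) (pt b a s))%:E)%E.

Lemma measurable_pt (b : bool) (a : R) : measurable_fun [set: R] (pt b a).
Proof. by case: b; apply: measurable_fun_pair. Qed.

Lemma integral_le_slice_energy (h : P -> P) (g1 g2 : P -> R) (r : R) (b : bool) (a s0 s1 : R) :
  good_slice h g1 g2 b a -> (forall y, s0 <= y <= s1 -> box r (pt b a y)) ->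
  (\int[mu]_(y in `[s0, s1]) (`|g1 (pt b a y)| + `|g2 (pt b a y)|)%:E <= slice_energy g1 g2 r b a)%E.
Proof.
move=> [/measurable_int/measurable_EFinP m1 /measurable_int/measurable_EFinP m2 _ _] inb.
have mI : measurable ([set` `[s0, s1]] : set R) by exact: measurable_itv.
have mF : measurable_fun setT (fun s => ((`|g1 (pt b a s)| + `|g2 (pt b a s)|) * \1_(box r) (pt b a s))%:E).
  apply/measurable_EFinP; apply: measurable_funM.
    by apply: measurable_funD; exact: measurableT_comp.
  apply: (measurableT_comp (measurable_indic (measurable_box r))); exact: measurable_pt.
rewrite /slice_energy; apply: le_trans (ge0_subset_integral mu mI measurableT mF _ (@subsetT _ _)); last first.
  by move=> y _; rewrite lee_fin mulr_ge0 ?addr_ge0.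
rewrite le_eqVlt; apply/orP; left; apply/eqP; apply: eq_integral => y; rewrite inE /= in_itv /= => hy.
by rewrite indicE mem_set ?mulr1//; exact: inb.
Qed.

Lemma powR_neg_le (m x y : R) : 0 < m -> 0 < x -> x <= y -> y `^ (- m) <= x `^ (- m).
Proof.
move=> m0 x0 xy; have y0 := lt_le_trans x0 xy.
by rewrite !powRN lef_pV2 ?posrE ?powR_gt0// ge0_ler_powR// ?nnegrE ltW.
Qed.

(** To first order |x|^2 - 1 is -6/5 al + 8/5 be, which is below -48/5 r + 16/5 r; the squares are
    at most 85 r^2 and are absorbed because r <= 1/1000. *)
Lemma corner_in_disk (r x1 x2 : R) : 0 < r -> r <= 1 / 1000 ->
  8 * r < x1 + 3 / 5 < 9 * r -> r < - (4 / 5) - x2 < 2 * r -> x1 ^+ 2 + x2 ^+ 2 < 1.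
Proof.
move=> r0 r1; set al := x1 + 3 / 5; set be := - (4 / 5) - x2.
rewrite (_ : x1 = al - 3 / 5); last by rewrite /al; ring.
rewrite (_ : x2 = - (4 / 5) - be); last by rewrite /be; ring.
by clearbody al be => /andP[a1 a2] /andP[b1 b2]; nra.
Qed.

Lemma below_circle (a s : R) : a ^+ 2 + s ^+ 2 < 1 -> exists2 s0, s0 < 0 & a ^+ 2 + s0 ^+ 2 = 1.
Proof.
move=> h; have s2 := sqr_ge0 s; exists (- Num.sqrt (1 - a ^+ 2)).
  by rewrite oppr_lt0 sqrtr_gt0; lra.
by rewrite sqrrN sqr_sqrtr; lra.
Qed.

(** Near the tip the circle follows its tangent 3 dx + 4 dy = 0: a horizontal offset below 9 r
    lowers the circle by about 27/4 r at most, and a vertical offset below 2 r moves it by about 8/3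
    r at most. The bounds 9 r and 3 r leave room for the curvature. *)
Lemma corner_endpoints (r x1 x2 s0 t0 : R) : 0 < r -> r <= 1 / 1000 ->
  8 * r < x1 + 3 / 5 < 9 * r -> r < - (4 / 5) - x2 < 2 * r ->
  s0 < 0 -> t0 < 0 -> x1 ^+ 2 + s0 ^+ 2 = 1 -> x2 ^+ 2 + t0 ^+ 2 = 1 ->
  [/\ s0 < x2, t0 < x1, - (4 / 5) - 9 * r <= s0 & - (3 / 5) <= t0 /\ t0 <= - (3 / 5) + 3 * r].
Proof.
move=> r0 r1 al be s0n t0n S1 T1; have C1 := corner_in_disk r0 r1 al be.
case/andP: al => al1 al2; case/andP: be => be1 be2.
split; last split.
- by rewrite ltNge; apply/negP => l; nra.
- by rewrite ltNge; apply/negP => l; nra.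
- by rewrite leNgt; apply/negP => l; nra.
- by rewrite leNgt; apply/negP => l; nra.
- by rewrite leNgt; apply/negP => l; nra.
Qed.

(** The horizontal offset alone gives 8 r for the first point; for the second, (3 r)^2 + (2 r)^2 <=
    (4 r)^2. *)
Lemma corner_endpoints_dist (r x1 x2 s0 t0 : R) : 0 < r ->
  r < - (4 / 5) - x2 < 2 * r -> - (3 / 5) <= t0 -> t0 <= - (3 / 5) + 3 * r -> 8 * r < x1 + 3 / 5 < 9 * r ->
  8 * r <= enorm (pt true x1 s0 - tip R) /\ enorm (pt false x2 t0 - tip R) <= 4 * r.
Proof.
move=> r0 /andP[b1 b2] t1 t2 /andP[a1 _]; split.
  by apply: le_trans (abs_le_enorm1 _); rewrite /= opprK (le_trans (ltW a1))// ler_norm.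
apply: enorm_le; first by rewrite mulr_ge0// ltW.
rewrite /= !opprK; have h1 : (t0 + 3 / 5) ^+ 2 <= (3 * r) ^+ 2 by rewrite ler_sqr ?nnegrE; lra.
have h2 : (- (x2 + 4 / 5)) ^+ 2 <= (2 * r) ^+ 2 by rewrite ler_sqr ?nnegrE; lra.
by rewrite sqrrN in h2; have := sqr_ge0 r; rewrite !exprMn in h1 h2 *; lra.
Qed.

Lemma corner_boxP (r x1 x2 s0 y : R) : 0 < r -> 8 * r < x1 + 3 / 5 < 9 * r -> r < - (4 / 5) - x2 < 2 * r ->
  - (4 / 5) - 9 * r <= s0 -> s0 <= y <= x2 -> box r (pt true x1 y).
Proof.
move=> r0 /andP[a1 a2] /andP[b1 b2] s1 /andP[l1 l2].
by split; rewrite /= in_itv /=; apply/andP; split; lra.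
Qed.

Lemma corner_boxQ (r x1 x2 t0 y : R) : 0 < r -> 8 * r < x1 + 3 / 5 < 9 * r -> r < - (4 / 5) - x2 < 2 * r ->
  - (3 / 5) <= t0 -> t0 <= y <= x1 -> box r (pt false x2 y).
Proof.
move=> r0 /andP[a1 a2] /andP[b1 b2] s1 /andP[l1 l2].
by split; rewrite /= in_itv /=; apply/andP; split; lra.
Qed.

(* The clamped angle attains its maximum at the endpoint [(t0, x2)] and is about [(8r)^-m] at the endpoint
   [(x1, s0)]; the two segments join these points to the corner [(x1, x2)]. *)
Lemma corner_energy (m r : R) (h : P -> P) (g1 g2 : bool -> P -> R) (x1 x2 : R) :
  0 < m -> 0 < r -> r <= 1 / 1000 ->
  homeo_onto (closure (@disk R)) (closure (spiral m @` @disk R)) h ->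
  (forall x, @circle R x -> h x = spiral m x) ->
  8 * r < x1 + 3 / 5 < 9 * r -> r < - (4 / 5) - x2 < 2 * r ->
  good_slice h (g1 true) (g2 true) true x1 -> good_slice h (g1 false) (g2 false) false x2 ->
  ((r * ((4 * r) `^ (- m) - (8 * r) `^ (- m) - 4))%:E <=
   slice_energy (g1 true) (g2 true) r true x1 + slice_energy (g1 false) (g2 false) r false x2)%E.
Proof.
move=> m0 r0 r1 hh hb al be good1 good2.
have C1 := corner_in_disk r0 r1 al be; have C2 : x2 ^+ 2 + x1 ^+ 2 < 1 by rewrite addrC.
have [s0 s0n S1] := below_circle C1; have [t0 t0n T1] := below_circle C2.
have [s0x2 t0x1 s0b [t0b t0c]] := corner_endpoints r0 r1 al be s0n t0n S1 T1.
have [P2 Q1] := corner_endpoints_dist s0 r0 be t0b t0c al.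
have boxP y : s0 <= y <= x2 -> box r (pt true x1 y) by exact: corner_boxP al be s0b.
have boxQ y : t0 <= y <= x1 -> box r (pt false x2 y) by exact: corner_boxQ al be t0b.
have d0 : 0 < 4 * r by rewrite mulr_gt0.
have r8 : 0 < 8 * r by rewrite mulr_gt0.
have Pt : pt true x1 s0 != tip R by apply/eqP => e; move: P2; rewrite e subrr enorm0 leNgt r8.
have Qt : pt false x2 t0 != tip R.
  by apply/eqP => -[_ e]; case/andP: be => + _; rewrite e subrr ltNge (ltW r0).
have I1 := slice_clamped_angle_le m0 d0 hh hb good1 s0x2 s0n S1 C1 Pt.
have I2 := slice_clamped_angle_le m0 d0 hh hb good2 t0x1 t0n T1 C2 Qt.
have B1 : (\int[mu]_(y in `[s0, x2]) (`|g1 true (pt true x1 y)| + `|g2 true (pt true x1 y)|)%:E <=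
    slice_energy (g1 true) (g2 true) r true x1)%E by exact: (integral_le_slice_energy good1 boxP).
have B2 : (\int[mu]_(y in `[t0, x1]) (`|g1 false (pt false x2 y)| + `|g2 false (pt false x2 y)|)%:E <=
    slice_energy (g1 false) (g2 false) r false x2)%E by exact: (integral_le_slice_energy good2 boxQ).
(* For d = 4 r the Lipschitz constant 4 / d is 1 / r, and multiplication by [r] clears it. *)
have scale (D : R) (I W : \bar R) : (D%:E <= (4 / (4 * r))%:E * I)%E -> (I <= W)%E -> ((r * D)%:E <= W)%E.
  move=> hD hW; apply: le_trans hW; rewrite EFinM.
  have := lee_wpmul2l (ltW r0 : (0 <= r%:E)%E) hD => /le_trans; apply.
  by rewrite muleA -EFinM (_ : r * (4 / (4 * r)) = 1) ?mul1e//; field; rewrite gt_eqF.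
have J1 := scale _ _ _ I1 B1; have J2 := scale _ _ _ I2 B2.
apply: le_trans (leeD J1 J2); rewrite -EFinD lee_fin -mulrDr ler_wpM2l//; first exact: ltW.
have eC : pt true x1 x2 = pt false x2 x1 by [].
rewrite eC; set u := clamped_angle _ _; set z := h (pt false x2 x1).
(* This endpoint is within 4 r of the tip, so its angle has reached the clamp. At the other endpoint
   the angle is at most (8 r)^-m + 2, and the two errors of 2 make up the loss of 4. *)
have uQ : u (h (pt false x2 t0)) = (4 * r) `^ (- m) - 2.
  rewrite /u /clamped_angle min_r// hb; last by rewrite /circle /= addrC.
  have /andP[lo _] := angle_bounds m (spiral m (pt false x2 t0)); apply: le_trans lo.
  rewrite lerD2r enorm_spiral powR_neg_le//; apply: enorm_gt0.
  by rewrite subr_eq0.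
have uP : u (h (pt true x1 s0)) <= (8 * r) `^ (- m) + 2.
  rewrite /u /clamped_angle ge_min; apply/orP; left; rewrite hb//.
  have /andP[_ hi] := angle_bounds m (spiral m (pt true x1 s0)); apply: (le_trans hi).
  by rewrite lerD2r enorm_spiral powR_neg_le.
have a1 := ler_norm (u z - u (h (pt true x1 s0))).
have a2 := ler_norm (- (u z - u (h (pt false x2 t0)))); rewrite normrN in a2.
clear -uP uQ a1 a2; lra.
Qed.

Lemma ae_good_slice (m p : R) (h : P -> P) (b : bool) : 2 < p ->
  homeo_onto (closure (@disk R)) (closure (spiral m @` @disk R)) h ->
  sobolev1p_R2 (@disk R) p h ->
  exists g1 g2 : P -> R, [/\ measurable_fun setT g1, measurable_fun setT g2,
    (@leb2 R).-integrable setT (EFin \o g1), (@leb2 R).-integrable setT (EFin \o g2) &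
    [/\ (\int[@leb2 R]_z ((`|g1 z| `^ p)%R)%:E < +oo)%E, (\int[@leb2 R]_z ((`|g2 z| `^ p)%R)%:E < +oo)%E &
    {ae mu, forall a, good_slice h g1 g2 b a}]].
Proof.
move=> p2 hh [s1 s2].
have [g1 [mg1 z1 i1 l1 w1]] := weak_partial b p2 s1.
have [g2 [mg2 z2 i2 l2 w2]] := weak_partial b p2 s2.
have mf1 : measurable_fun (@disk R) (fun x => (h x).1) by case: s1 => -[].
have mf2 : measurable_fun (@disk R) (fun x => (h x).2) by case: s2 => -[].
have h2 z : disk z -> enorm (h z) <= 2 by move=> /diskE/ltW; exact: homeo_enorm_le hh.
have cf1 z : disk z -> {for z, continuous (fun x => (h x).1)}.
  move=> hz; have c : {for z, continuous (fst \o h)}.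
    by apply: continuous_comp; [exact: homeo_continuous hh _ hz | exact: cvg_fst].
  exact: c.
have cf2 z : disk z -> {for z, continuous (fun x => (h x).2)}.
  move=> hz; have c : {for z, continuous (snd \o h)}.
    by apply: continuous_comp; [exact: homeo_continuous hh _ hz | exact: cvg_snd].
  exact: c.
have iD g : (@leb2 R).-integrable setT (EFin \o g) -> (@leb2 R).-integrable (@disk R) (EFin \o g).
  by apply: (@integrableS _ _ _ (@leb2 R) setT) => //; exact: measurable_disk.
have v1 := @slice_inequality R b _ g1 2 mf1 (fun z hz => le_trans (abs_le_enorm1 _) (h2 z hz)) cf1 (iD _ i1) w1.
have v2 := @slice_inequality R b _ g2 2 mf2 (fun z hz => le_trans (abs_le_enorm2 _) (h2 z hz)) cf2 (iD _ i2) w2.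
exists g1, g2; split => //; split => //.
apply: (ae_impl2 _ (slice_integrable b i1)); last first.
  by apply: (ae_impl2 _ (slice_integrable b i2)); last first; [exact: (ae_impl2 (fun a x y => conj x y) v1 v2) | move=> a x y; exact: (conj x y)].
by move=> a ? [? [? ?]]; split.
Qed.

(** Integrates the truncation inequality: the linear part costs the area (18 r)^2 of the box, once
    for each of the two functions. *)
Lemma box_energy_le (p l r : R) (g1 g2 : P -> R) : 2 < p -> 0 < l -> 0 < r ->
  measurable_fun setT g1 -> measurable_fun setT g2 ->
  (\int[@leb2 R]_z ((`|g1 z| + `|g2 z|) * \1_(box r) z)%:E <=
   (2 * l * (18 * r) ^+ 2)%:E + (l `^ (1 - p))%:E *
     (\int[@leb2 R]_z ((`|g1 z| `^ p)%R)%:E + \int[@leb2 R]_z ((`|g2 z| `^ p)%R)%:E))%E.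
Proof.
move=> p2 l0 r0 m1 m2; have mB := measurable_box r.
have mp (g : P -> R) : measurable_fun setT g -> measurable_fun setT (fun z => ((`|g z| `^ p)%R)%:E).
  move=> mg; apply/measurable_EFinP; apply: (measurableT_comp (measurable_powR _)); exact: measurableT_comp.
have mi : measurable_fun setT (fun z : P => (\1_(box r) z : R)%:E) by apply/measurable_EFinP; exact: measurable_indic.
have c0 : 0 <= l `^ (1 - p) by exact: powR_ge0.
have l2 : 0 <= 2 * l by lra.
pose F (z : P) := ((2 * l)%:E * (\1_(box r) z)%:E +
   (l `^ (1 - p))%:E * (((`|g1 z| `^ p)%R)%:E + ((`|g2 z| `^ p)%R)%:E))%E.
have mS : measurable_fun setT (fun z => ((`|g1 z| `^ p)%R)%:E + ((`|g2 z| `^ p)%R)%:E)%E.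
  by apply: emeasurable_funD; exact: mp.
apply: (@le_trans _ _ (\int[@leb2 R]_z F z)%E).
  apply: ge0_le_integral => //.
  - apply/measurable_EFinP; apply: measurable_funM; last exact/measurable_EFinP.
    by apply: measurable_funD; exact: measurableT_comp.
  - by apply: emeasurable_funD; apply: emeasurable_funM => //; exact: measurable_cst.
  - move=> z _; 
    have -> : F z = (2 * l * \1_(box r) z + l `^ (1 - p) * (`|g1 z| `^ p + `|g2 z| `^ p))%:E.
      by rewrite EFinD (EFinM (2 * l)) (EFinM (l `^ (1 - p))) (EFinD (`|g1 z| `^ p)).
    rewrite lee_fin.
    have p1 : 1 <= p by lra.
    have h1 := le_powR_split p1 l0 (normr_ge0 (g1 z)); have h2 := le_powR_split p1 l0 (normr_ge0 (g2 z)).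
    have i01 : 0 <= l `^ (1 - p) * (`|g1 z| `^ p + `|g2 z| `^ p) by rewrite mulr_ge0 ?addr_ge0 ?powR_ge0.
    by rewrite indicE; case: (z \in box r) => /=; rewrite ?mulr1 ?mulr0 ?add0r//; rewrite mulrDr; lra.
rewrite /F ge0_integralD//; last 4 first.
- by move=> z _; rewrite -EFinM lee_fin mulr_ge0.
- by apply: emeasurable_funM => //; exact: measurable_cst.
- by move=> z _; rewrite -EFinD -EFinM lee_fin mulr_ge0 ?addr_ge0 ?powR_ge0.
- by apply: emeasurable_funM => //; exact: measurable_cst.
rewrite ge0_integralZl_EFin//.
rewrite ge0_integralZl_EFin//; last by move=> z _; rewrite -EFinD lee_fin addr_ge0 ?powR_ge0.
rewrite ge0_integralD//; [|exact: mp|exact: mp].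
rewrite integral_indic// setIT [X in (_ * X)%E](_ : _ = ((18 * r) ^+ 2)%:E); last exact: leb2_box.
by rewrite -EFinM.
Qed.

Lemma le_integral_of_ae_itv (F : R -> \bar R) (k l a : R) : 0 <= k -> 0 < l -> measurable_fun setT F ->
  (forall x, 0 <= F x)%E -> {ae mu, forall x, a < x < a + l -> (k%:E <= F x)%E} ->
  ((k * l)%:E <= \int[mu]_x F x)%E.
Proof.
move=> k0 l0 mF F0 h; have mI : measurable ([set` `]a, (a + l)%R[] : set R) by exact: measurable_itv.
apply: (le_trans _ (ge0_subset_integral mu mI measurableT mF (fun x _ => F0 x) (@subsetT _ _))).
apply: (@le_trans _ _ (\int[mu]_(x in `]a, (a + l)%R[) cst k%:E x)%E).
  rewrite integral_cst//= lebesgue_measure_itv /= lte_fin ltrDl l0 -EFinB -EFinM lee_fin.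
  by rewrite (_ : a + l - a = l)//; ring.
apply: ae_ge0_le_integral => //; exact: measurable_funTS.
Qed.

(** Either some admissible [x] has F x < c / 2, and then G y >= c / 2 for every admissible [y], or F
    >= c / 2 at all admissible [x]. One exceptional line thus suffices to handle a whole family of
    pairs. *)
Lemma integral_dichotomy (F G : R -> \bar R) (Q1 Q2 : R -> Prop) (c l a b : R) : 0 <= c -> 0 < l ->
  measurable_fun setT F -> measurable_fun setT G -> (forall x, 0 <= F x)%E -> (forall x, 0 <= G x)%E ->
  {ae mu, forall x, Q1 x} -> {ae mu, forall x, Q2 x} ->
  (forall x y, a < x < a + l -> b < y < b + l -> Q1 x -> Q2 y -> (c%:E <= F x + G y)%E) ->
  ((c / 2 * l)%:E <= \int[mu]_x F x)%E \/ ((c / 2 * l)%:E <= \int[mu]_x G x)%E.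
Proof.
move=> c0 l0 mF mG F0 G0 q1 q2 hFG; have c20 : 0 <= c / 2 by rewrite divr_ge0.
have [[x [xI xQ xF]]|noF] := pselect (exists x, [/\ a < x < a + l, Q1 x & (F x < (c / 2)%:E)%E]).
  right; apply: (@le_integral_of_ae_itv _ _ _ b) => //; apply: (ae_impl _ q2) => y yQ yI.
  rewrite leNgt; apply/negP => yG; have := hFG x y xI yI xQ yQ.
  by rewrite leNgt => /negP; apply; rewrite [X in (_ < X)%E](_ : _ = (c / 2)%:E + (c / 2)%:E)%E ?lteD// -EFinD -splitr.
left; apply: (@le_integral_of_ae_itv _ _ _ a) => //; apply: (ae_impl _ q1) => x xQ xI.
by rewrite leNgt; apply/negP => xF; apply: noF; exists x.
Qed.

Lemma corner_coordinates (r x1 x2 : R) :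
  - (3 / 5) + 8 * r < x1 < - (3 / 5) + 8 * r + r -> - (4 / 5) - 2 * r < x2 < - (4 / 5) - 2 * r + r ->
  8 * r < x1 + 3 / 5 < 9 * r /\ r < - (4 / 5) - x2 < 2 * r.
Proof. by move=> /andP[a1 a2] /andP[b1 b2]; split; apply/andP; split; lra. Qed.

(** Here w = l r^2: the lower bound carries 4 * 18^2, twice the 2 * 18^2 of the linear part, so half
    of it survives and 2 * 18^2 is at least 1. *)
Lemma absorb_le (w A : R) : 0 <= w -> 4 * (18 * 18) * w <= 2 * (18 * 18) * w + A -> w <= A.
Proof. lra. Qed.

(* The truncation level [l] is chosen so that the linear part of [box_energy_le] is at most half of the
   lower bound coming from [corner_energy]. *)
Lemma energy_at_scale (m p : R) (h : P -> P) : 0 < m -> 2 < p ->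
  homeo_onto (closure (@disk R)) (closure (spiral m @` @disk R)) h ->
  (forall x, @circle R x -> h x = spiral m x) -> sobolev1p_R2 (@disk R) p h ->
  exists2 N : R, 0 <= N & forall l r, 0 < l -> 0 < r -> r <= 1 / 1000 ->
    (4 * r) `^ (- m) - (8 * r) `^ (- m) - 4 = 8 * (18 * 18) * l -> r ^+ 2 * l `^ p <= N.
Proof.
move=> m0 p2 hh hb hs.
have [f1 [f2 [mf1 mf2 if1 if2 [lf1 lf2 gf]]]] := ae_good_slice true p2 hh hs.
have [k1 [k2 [mk1 mk2 ik1 ik2 [lk1 lk2 gk]]]] := ae_good_slice false p2 hh hs.
pose I (g : P -> R) := (\int[@leb2 R]_z ((`|g z| `^ p)%R)%:E)%E.
have I0 g : (0 <= I g)%E by apply: integral_ge0 => z _; rewrite lee_fin powR_ge0.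
have If g : (I g < +oo)%E -> I g = (fine (I g))%:E by move=> h1; rewrite fineK// ge0_fin_numE.
have fI0 g : 0 <= fine (I g) by apply: fine_ge0.
pose N := fine (I f1) + fine (I f2) + (fine (I k1) + fine (I k2)).
have N0 : 0 <= N by rewrite /N !addr_ge0.
exists N => // l r l0 r0 r1 eD.
have eK : 8 * (18 * 18) = 8 * (18 * 18) :> R by []; move: eD eK; move: {1 3}(8 * (18 * 18)) => K eD eK.
have K0 : 0 < K by rewrite -eK; lra.
have rl : 0 <= r * (K * l) by apply: mulr_ge0; [exact: ltW | apply: mulr_ge0; exact: ltW].
pose E (g1 g2 : P -> R) b := slice_energy g1 g2 r b.
have E0 g1 g2 b a : (0 <= E g1 g2 b a)%E by apply: integral_ge0 => z _; rewrite lee_fin mulr_ge0 ?addr_ge0.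
have iE (g1 g2 : P -> R) : (@leb2 R).-integrable setT (EFin \o g1) -> (@leb2 R).-integrable setT (EFin \o g2) ->
    (@leb2 R).-integrable setT (fun z => ((`|g1 z| + `|g2 z|) * \1_(box r) z)%:E).
  move=> i1 i2; apply: (@le_integrable _ _ _ (@leb2 R) _ measurableT _ (fun z => (`|g1 z| + `|g2 z|)%:E)).
  - apply/measurable_EFinP; apply: measurable_funM; last exact: (measurable_indic (measurable_box r)).
    by apply: measurable_funD; apply: measurableT_comp => //; apply/measurable_EFinP; [exact: measurable_int i1 | exact: measurable_int i2].
  - move=> z _; rewrite /= lee_fin normrM ler_piMr// indicE; case: (z \in _) => /=; by rewrite ?normr1 ?normr0.
  - have j1 := integrable_norm i1; have j2 := integrable_norm i2.
    exact: (@integrableD _ _ _ (@leb2 R) _ measurableT _ _ j1 j2).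
have bound (g1 g2 : P -> R) b : measurable_fun setT g1 -> measurable_fun setT g2 ->
    (@leb2 R).-integrable setT (EFin \o g1) -> (@leb2 R).-integrable setT (EFin \o g2) ->
    (I g1 < +oo)%E -> (I g2 < +oo)%E -> fine (I g1) + fine (I g2) <= N ->
    ((r * (K * l) / 2 * r)%:E <= \int[mu]_a E g1 g2 b a)%E -> r ^+ 2 * l `^ p <= N.
  move=> m1 m2 i1 i2 l1 l2 leN hE.
  have := box_energy_le p2 l0 r0 m1 m2; rewrite -/(I g1) -/(I g2) (If _ l1) (If _ l2).
  rewrite -(integral_slice b (iE _ _ i1 i2)) => /(le_trans hE).
  rewrite -(EFinD (fine (I g1))) -(EFinM (l `^ (1 - p))) -EFinD lee_fin => {}hE.
  have c0 : 0 < l `^ (1 - p) by exact: powR_gt0.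
  have w0 : 0 <= l * r ^+ 2 by rewrite mulr_ge0 ?sqr_ge0 ?ltW.
  have hE2 : l * r ^+ 2 <= l `^ (1 - p) * N.
    have : l `^ (1 - p) * (fine (I g1) + fine (I g2)) <= l `^ (1 - p) * N by rewrite ler_pM2l.
    have e : r * (K * l) / 2 * r = 4 * (18 * 18) * (l * r ^+ 2) by rewrite -eK; field.
    have e' : 2 * l * (18 * r) ^+ 2 = 2 * (18 * 18) * (l * r ^+ 2) by ring.
    by apply: le_trans; apply: absorb_le => //; rewrite e e' in hE.
  (* Multiplying by l^p cancels the truncation factor l^(1-p) down to [l]. *)
  have ep : l `^ (1 - p) * l `^ p = l by rewrite -powRD ?subrK ?powRr1 ?(ltW l0)// (gt_eqF l0) implybT.
  have lp : 0 < l `^ p by exact: powR_gt0.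
  by rewrite -(ler_pM2l l0) mulrA; have := ler_wpM2r (ltW lp) hE2; rewrite [leRHS]mulrAC ep.
have mE (g1 g2 : P -> R) b : (@leb2 R).-integrable setT (EFin \o g1) -> (@leb2 R).-integrable setT (EFin \o g2) ->
    measurable_fun setT (E g1 g2 b).
  by move=> i1 i2; exact: (measurable_int _ (integrable_slice b (iE _ _ i1 i2))).
have corner x1 x2 : - (3 / 5) + 8 * r < x1 < - (3 / 5) + 8 * r + r -> - (4 / 5) - 2 * r < x2 < - (4 / 5) - 2 * r + r ->
    good_slice h f1 f2 true x1 -> good_slice h k1 k2 false x2 ->
    ((r * (K * l))%:E <= E f1 f2 true x1 + E k1 k2 false x2)%E.
  move=> a1 a2 G1 G2.
  have [A B] := corner_coordinates a1 a2.
  have := @corner_energy m r h (fun b => if b then f1 else k1) (fun b => if b then f2 else k2) x1 x2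
    m0 r0 r1 hh hb A B G1 G2.
  by rewrite eD.
have [hE|hE] := integral_dichotomy rl r0 (mE _ _ true if1 if2) (mE _ _ false ik1 ik2) (E0 f1 f2 true)
  (E0 k1 k2 false) gf gk corner.
  by apply: (bound f1 f2 true mf1 mf2 if1 if2 lf1 lf2 _ hE); rewrite /N lerDl addr_ge0.
by apply: (bound k1 k2 false mk1 mk2 ik1 ik2 lk1 lk2 _ hE); rewrite /N lerDr addr_ge0.
Qed.

(** The level [l] solves the equation of [energy_at_scale]. Since (4 r)^-m - (8 r)^-m = c r^-m with
    c > 0, it is at least k r^-m for small [r], and r^2 l^p >= k^p r^(2 - m p) exceeds every
    bound. *)
Lemma no_sobolev_extension (m p : R) (h : P -> P) : 0 < m -> 2 < p -> 2 < m * p ->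
  homeo_onto (closure (@disk R)) (closure (spiral m @` @disk R)) h ->
  (forall x, @circle R x -> h x = spiral m x) -> ~ sobolev1p_R2 (@disk R) p h.
Proof.
move=> m0 p2 mp hh hb hs; have [N N0 hN] := energy_at_scale m0 p2 hh hb hs.
pose c : R := 4 `^ (- m) - 8 `^ (- m).
have c0 : 0 < c.
  rewrite subr_gt0 !powRN ltf_pV2 ?posrE ?powR_gt0// gt0_ltr_powR// ?nnegrE//; lra.
have [K K0 hK] : exists2 K : R, 0 < K & 8 * (18 * 18) = K by exists (8 * (18 * 18)) => //; lra.
rewrite hK in hN; pose k := c / 2 / K; have k0 : 0 < k by rewrite !divr_gt0.
have al0 : 0 < m * p - 2 by lra.
have [r1 r10 hr1] := powR_neg_unbounded (N / k `^ p) al0.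
have [r2 r20 hr2] := powR_neg_unbounded (8 / c) m0.
pose r := Num.min (1 / 1000) (Num.min r1 r2).
have r0 : 0 < r by rewrite /r !lt_min r10 r20 !andbT; lra.
have ra : r <= 1 / 1000 by rewrite /r ge_min lexx.
have rb : r <= r1 by rewrite /r !ge_min lexx !orbT.
have rc : r <= r2 by rewrite /r !ge_min lexx !orbT.
have {}hr1 := hr1 r r0 rb; have {}hr2 := hr2 r r0 rc; clearbody r.
have D : (4 * r) `^ (- m) - (8 * r) `^ (- m) = c * r `^ (- m).
  by rewrite !powRM ?(ltW r0)// /c mulrBl.
(* The constant loss of 4 is then at most half of c r^-m; this is the 1/2 in [k]. *)
have X8 : 8 < c * r `^ (- m) by move: hr2; rewrite ltr_pdivrMr// mulrC.
pose l := (c * r `^ (- m) - 4) / K.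
have kl : k * r `^ (- m) <= l.
  by rewrite /k /l mulrAC ler_pM2r ?invr_gt0//; lra.
have l0 : 0 < l by apply: lt_le_trans kl; rewrite mulr_gt0// powR_gt0.
have eD : (4 * r) `^ (- m) - (8 * r) `^ (- m) - 4 = K * l by rewrite D /l [RHS]mulrC divfK// gt_eqF.
have := hN l r l0 r0 ra eD; apply/negP; rewrite -ltNge.
have kp : 0 < k `^ p by exact: powR_gt0.
have lp : (k * r `^ (- m)) `^ p <= l `^ p.
  have p0 : 0 <= p by lra.
  have kr0 : 0 <= k * r `^ (- m) by rewrite mulr_ge0 ?powR_ge0 ?ltW.
  by rewrite ge0_ler_powR ?nnegrE ?(ltW l0).
apply: (@lt_le_trans _ _ (r ^+ 2 * (k * r `^ (- m)) `^ p)); last by rewrite ler_wpM2l// sqr_ge0.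
rewrite powRM ?powR_ge0 ?(ltW k0)// -powRrM.
have e : r ^+ 2 * r `^ (- m * p) = r `^ (- (m * p - 2)).
  by rewrite -powR_mulrn ?(ltW r0)// -powRD ?(gt_eqF r0) ?implybT//; congr (_ `^ _); ring.
by rewrite mulrCA e mulrC -ltr_pdivrMr.
Qed.

End NoExtension.

(** With q = p - 1 > 1 the witness 2 q / (q^2 + 1) is below 1 since (q - 1)^2 > 0, below 2 / q
    trivially, and above 2 / (q + 1) since q > 1. *)
Lemma exists_exponent (R : realType) (p : R) : 2 < p ->
  exists m : R, [/\ 0 < m < 1, 2 < m * p & m * (p - 1) < 2].
Proof.
move=> p2; have D0 : 0 < (p - 1) ^+ 2 + 1 by nra.
exists (2 * (p - 1) / ((p - 1) ^+ 2 + 1)); split.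
- by rewrite divr_gt0 ?mulr_gt0//=; [rewrite ltr_pdivrMr//; nra | lra].
- by rewrite mulrAC ltr_pdivlMr//; nra.
- by rewrite mulrAC ltr_pdivrMr//; nra.
Qed.

Theorem theorem1p4 (R : realType) (p : R) (hp : 2 < p) :
  exists (Y : set (R * R)) (phi : R * R -> R * R),
    [/\ jordan_domain Y, rectifiable_boundary Y,
        homeo_onto (@circle R) (closure Y `\` Y) phi,
        (\int[lebesgue_measure]_(s in `[0%R, (2 * pi)%R])
          \int[lebesgue_measure]_(t in `[0%R, (2 * pi)%R])
            (powR (pdist (phi (cexp s)) (phi (cexp t))) p /
             powR (pdist (cexp s) (cexp t)) p)%:E < +oo)%E &
        ~ exists h : R * R -> R * R,
            [/\ homeo_onto (closure (@disk R)) (closure Y) h,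
                (forall x, @circle R x -> h x = phi x) &
                sobolev1p_R2 (@disk R) p h]].
Proof.
have [m [m01 mp mp1]] := exists_exponent hp; have /andP[m0 _] := m01.
have [jp bd] := jordan_boundary m; have sb := spiral_boundary m.
exists (spiral m @` @disk R), (spiral m); split.
- split; [exact: open_spiral_disk | exact: connected_spiral_disk | exact: bounded_spiral_disk |].
  by exists (boundary_param m); rewrite sb.
- by exists (boundary_param m); rewrite sb; split => //; exact: rectifiable_boundary_param.
- by rewrite sb; exact: homeo_onto_spiral.
- exact: energy_finite.
- by move=> [h [hh hb hs]]; exact: (no_sobolev_extension m0 hp mp hh hb hs).
Qed.
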